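(* Work in the setting of the context (problem $(\mathrm P_{t,x})$ with the basic assumptions). Suppose that $\Lambda$ satisfies the structure assumption (A) and Condition (S). Unless $\Lambda$ is real valued (i.e. $\mathrm{Dom}(\Lambda)=[0,T]\times\mathbb R^n\times\mathbb R^m$), assume moreover: (h$_1$) $\mathrm{Dom}(\Lambda)=[0,T]\times D$ for some $D\subseteq\mathbb R^n\times\mathbb R^m$; (h$_2$) for every $\ell>0$ there is $r>0$ such that $\Lambda(s,z,v)\ge \ell$ whenever $(s,z,v)\in\mathrm{Dom}(\Lambda)$, $v\in\mathcal U$ and $\mathrm{dist}((s,z,v),\partial\mathrm{Dom}(\Lambda))<r$. Let $t\in[0,T[$, $x\in\mathcal S$, and suppose that $\Lambda$ satisfies the growth condition (H$_B^{\delta}$) with $\delta=t$ and $B=J_t(y,u)$ for some admissible pair $(y,u)$ for $(\mathrm P_{t,x})$. Moreover, suppose that: - for a.e. $s\in[t,T]$ the function $(y,u)\mapsto\Lambda(s,y,u)$ is lower semicontinuous; - for a.e. $s\in[t,T]$ and every $y\in\mathbb R^n$ the function $u\mapsto\Lambda(s,y,u)$ is convex; - $g$ is lower semicontinuous and $b$ is continuous; - $\mathcal U\subseteq\mathbb R^m$ is closed and convex and $\mathcal S\subseteq\mathbb R^n$ is closed. Then problem $(\mathrm P_{t,x})$ admits a solution (an admissible pair minimizing $J_t$) $(y_*,u_* )$, with $y_*$ Lipschitz and $u_*$ bounded.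
   Context: **Problem.** $T>0$, $n,m\ge1$. For $t\in[0,T[$ and $x\in\mathcal S$, problem $(\mathrm P_{t,x})$ is to minimize $J_t(y,u):=\int_t^T\Lambda(s,y(s),u(s))\,ds+g(y(T))$ over pairs $(y,u)$ with $y\in W^{1,1}([t,T];\mathbb R^n)$, $u:[t,T]\to\mathbb R^m$ measurable, $y'(s)=b(y(s))u(s)$ for a.e. $s\in[t,T]$, $y(t)=x$, $u(s)\in\mathcal U$ for a.e. $s$, $y(s)\in\mathcal S$ for all $s\in[t,T]$. Such a pair is *admissible* if moreover $J_t(y,u)<+\infty$. It is assumed that for each $t\in[0,T[$, $x\in\mathcal S$ there is at least one admissible pair. **Basic assumptions.** $\Lambda:[0,T]\times\mathbb R^n\times\mathbb R^m\to[0,+\infty]$ is Lebesgue–Borel measurable (w.r.t. the $\sigma$-algebra generated by products of Lebesgue subsets of $[0,T]$ and Borel subsets of $\mathbb R^n\times\mathbb R^m$); $b$ is a Borel map from $\mathbb R^n$ to the linear maps $\mathbb R^m\to\mathbb R^n$ with $|b(y)|\le\theta(1+|y|)$ for some $\theta\ge0$; $\mathcal S\subseteq\mathbb R^n$ is nonempty; $\mathcal U\subseteq\mathbb R^m$ is a nonempty cone ($u\in\mathcal U,\lambda>0\Rightarrow\lambda u\in\mathcal U$); $g:\mathcal S\to[0,+\infty]$ is not identically $+\infty$; there are fixed $\alpha>0$, $d\ge0$ with $\Lambda(s,y,u)\ge\alpha|u|-d$ for a.e. $s\in[0,T]$ and all $y\in\mathbb R^n,u\in\mathcal U$. $\mathrm{Dom}(\Lambda):=\{(s,y,u):\Lambda(s,y,u)<+\infty\}$;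 for a.e. $s$ and every $y$: $\Lambda(s,y,u)<+\infty$, $0<r\le1$ imply $\Lambda(s,y,ru)<+\infty$. $\partial\mathrm{Dom}(\Lambda)$ is the boundary in $[0,T]\times\mathbb R^n\times\mathbb R^m$ and $\mathrm{dist}$ the Euclidean distance ($+\infty$ if the boundary is empty). **Assumption (A).** At least one holds: (A$_c$) (radial convex case) for a.e. $s\in[0,T]$ and all $y\in\mathbb R^n$, $u\in\mathcal U$, the map $0<r\mapsto\Lambda(s,y,ru)$ is convex; (A$_d$) (partial differentiable case) for a.e. $s$ and all $y$, the limit $D_u\Lambda(s,y,u):=\lim_{h\to0}\frac{\Lambda(s,y,u+hu)-\Lambda(s,y,u)}h$ exists (finite) at every $u\in\mathcal U$ with $(s,y,u)\in\mathrm{Dom}(\Lambda)$. **Condition (S).** There are $\kappa,A\ge0$, $\gamma\in L^1[0,T]$, $\varepsilon_*>0$ such that for a.e. $s\in[0,T]$: $|\Lambda(s_2,y,u)-\Lambda(s_1,y,u)|\le(\kappa\Lambda(s,y,u)+A|u|+\gamma(s))|s_2-s_1|$ whenever $s_1,s_2\in[s-\varepsilon_*,s+\varepsilon_*]\cap[0,T]$, $y\in\mathbb R^n$, $u\in\mathcal U$, $(s_1,y,u),(s_2,y,u)\in\mathrm{Dom}(\Lambda)$. **Constants.** $c_t(B):=\frac{B+d(T-t)}{\alpha(T-t)}$, $\Phi(B):=\kappa B+\frac A\alpha(B+dT)+\|\gamma\|_1$, with $\kappa,A,\gamma$ from (S), taken to be $0$ if $\Lambda$ does not depend on $s$. **Subdifferential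 and selections.** For $(s,y,u)\in\mathrm{Dom}(\Lambda)$, $\partial_r\Lambda(s,y,ru)_{r=1}:=\{q\in\mathbb R:\ \Lambda(s,y,ru)-\Lambda(s,y,u)\ge q(r-1)\ \forall r>0\}$. A selection $Q$ of it assigns to each $(s,y,u)\in\mathrm{Dom}(\Lambda)$, $u\in\mathcal U$, at which this set is nonempty one of its elements; in the partial differentiable case put $Q(s,y,u):=D_u\Lambda(s,y,u)$ where it exists. Suprema and infima of $\Lambda-Q$ below are over the points of the indicated sets where $Q$ is defined; $\sup\emptyset=-\infty$, $\inf\emptyset=+\infty$. For $K\ge0$, $\nu,c,\rho>0$ set $E_{K,\nu}:=\{(s,y,u)\in\mathrm{Dom}(\Lambda): |y|\le K,\ u\in\mathcal U,\ |u|\ge\nu\}$, $F_{K,c,\rho}:=\{(s,y,u)\in\mathrm{Dom}(\Lambda): |y|\le K,\ u\in\mathcal U,\ |u|<c,\ \mathrm{dist}((s,y,u),\partial\mathrm{Dom}(\Lambda))\ge\rho\}$. **Growth condition (H$_B^\delta$)** ($0\le\delta<T$, $B\ge0$; presupposes (S)). For all $K\ge0$ there are $\overline\nu>0$ and $c>c_\delta(B)$ such that: either (A$_c$) holds and there is a selection $Q$ of $\partial_r\Lambda(s,y,ru)_{r=1}$, or (A$_d$) holds and $Q=D_u\Lambda$, with, for all $\rho>0$, $$\sup_{E_{K,\overline\nu}}\{\Lambda-Q\}+2\Phi(B)<\inf_{F_{K,c,\rho}}\{\Lambda-Q\}.$$ *)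

(* Defs.v *)
From HB Require Import structures.
From mathcomp Require Import all_boot all_order all_algebra.
From mathcomp Require Import all_classical all_reals all_analysis.
From mathcomp Require Import measurable_realfun.

Set Implicit Arguments.
Unset Strict Implicit.
Unset Printing Implicit Defensive.

Import Order.TTheory GRing.Theory Num.Theory.
Import numFieldNormedType.Exports.

Local Open Scope classical_set_scope.
Local Open Scope ring_scope.

(* The measurable sets of [lebT R] are all the Lebesgue measurable sets, not
   only the Borel ones. *)
Notation leb R := (@completed_lebesgue_measure R).
Notation lebT R :=
  (caratheodory_type (@wlength R idfun)^*%mu).

Notation borel X := (g_sigma_algebraType (@open X)).

(* The library norm on matrices is the max norm, hence these definitions. *)
Definition enorm (R : realType) (n : nat) (v : 'cV[R]_n) : R :=
  Num.sqrt (\sum_(i < n) v i 0 ^+ 2).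

Definition opnorm (R : realType) (n m : nat) (M : 'M[R]_(n, m)) : R :=
  sup [set enorm (M *m v) | v in [set v : 'cV[R]_m | enorm v <= 1]].

Notation point R n m := (R * ('cV[R]_n * 'cV[R]_m))%type.

Definition edist (R : realType) (n m : nat) (p q : point R n m) : R :=
  Num.sqrt ((p.1 - q.1) ^+ 2 + enorm (p.2.1 - q.2.1) ^+ 2
            + enorm (p.2.2 - q.2.2) ^+ 2).

Definition dist (R : realType) (n m : nat) (p : point R n m)
    (A : set (point R n m)) : \bar R :=
  ereal_inf [set (edist p q)%:E | q in A].

(* All maps are total; the values of the lagrangian at times outside
   [0, horizon] and those of the end cost outside the state set are junk. *)
Record problem (R : realType) (n m : nat) := Problem {
  horizon : R ;
  lagrangian : R -> 'cV[R]_n -> 'cV[R]_m -> \bar R ;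
  dynamics : 'cV[R]_n -> 'M[R]_(n, m) ;
  states : set 'cV[R]_n ;
  controls : set 'cV[R]_m ;
  endcost : 'cV[R]_n -> \bar R }.

(* On an interval, W^{1,1} consists of the primitives of integrable functions:
   [W11_deriv t T y v] says that y is in W^{1,1}([t, T]; R^n) with y' = v. *)
Definition W11_deriv (R : realType) (n : nat) (t T : R)
    (y v : R -> 'cV[R]_n) : Prop :=
  forall i : 'I_n,
    (leb R).-integrable `[t, T] (fun s => (v s i 0)%:E) /\
    (forall s, s \in `[t, T] ->
      y s i 0 = y t i 0 + \int[leb R]_(r in `[t, s]) v r i 0).

Section problem.
Context (R : realType) (n m : nat) (P : problem R n m).
Local Notation T := (horizon P).
Local Notation L := (lagrangian P).
Local Notation b := (dynamics P).
Local Notation S := (states P).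
Local Notation U := (controls P).
Local Notation g := (endcost P).
Local Notation lbT := (lebT R * borel ('cV[R]_n * 'cV[R]_m)%type)%type.

Definition cost (t : R) (y : R -> 'cV[R]_n) (u : R -> 'cV[R]_m) : \bar R :=
  (\int[leb R]_(s in `[t, T]) L s (y s) (u s) + g (y T))%E.

Definition feasible (t : R) (x : 'cV[R]_n)
    (y : R -> 'cV[R]_n) (u : R -> 'cV[R]_m) : Prop :=
  [/\ exists2 v, W11_deriv t T y v &
        \forall s \ae leb R, s \in `[t, T] -> v s = b (y s) *m u s,
      measurable_fun (`[t, T] : set (lebT R)) (u : lebT R -> borel 'cV[R]_m),
      y t = x,
      \forall s \ae leb R, s \in `[t, T] -> U (u s) &
      forall s, s \in `[t, T] -> S (y s)].

Definition admissible (t : R) (x : 'cV[R]_n)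
    (y : R -> 'cV[R]_n) (u : R -> 'cV[R]_m) : Prop :=
  feasible t x y u /\ (cost t y u < +oo)%E.

Definition solution (t : R) (x : 'cV[R]_n)
    (y : R -> 'cV[R]_n) (u : R -> 'cV[R]_m) : Prop :=
  admissible t x y u /\
  forall y' u', feasible t x y' u' -> (cost t y u <= cost t y' u')%E.

Definition Dom : set (point R n m) :=
  [set p | p.1 \in `[0, T] /\ (L p.1 p.2.1 p.2.2 < +oo)%E].

(* The boundary relative to the closed set [0, T] x R^n x R^m. *)
Definition bdDom : set (point R n m) :=
  closure Dom `&` closure ((`[0, T] `*` setT) `\` Dom).

Record basic_assumptions (alpha d : R) : Prop := BasicAssumptions {
  horizon_gt0 : 0 < T ;
  alpha_gt0 : 0 < alpha ;
  d_ge0 : 0 <= d ;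
  lagrangian_ge0 : forall s y u, s \in `[0, T] -> (0 <= L s y u)%E ;
  lagrangian_meas :
    measurable_fun (`[0, T] `*` setT : set lbT)
      (fun p : lbT => L p.1 p.2.1 p.2.2) ;
  dynamics_meas : measurable_fun setT (b : borel 'cV[R]_n -> borel 'M[R]_(n, m)) ;
  dynamics_growth : exists2 theta : R, 0 <= theta &
    forall y, opnorm (b y) <= theta * (1 + enorm y) ;
  states_neq0 : S !=set0 ;
  controls_neq0 : U !=set0 ;
  controls_cone : forall u (lambda : R), U u -> 0 < lambda -> U (lambda *: u) ;
  endcost_ge0 : forall y, S y -> (0 <= g y)%E ;
  endcost_proper : exists2 y, S y & (g y < +oo)%E ;
  lagrangian_growth : \forall s \ae leb R, s \in `[0, T] ->
    forall y u, U u -> ((alpha * enorm u - d)%:E <= L s y u)%E ;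
  Dom_radial : \forall s \ae leb R, s \in `[0, T] ->
    forall y u (r : R), (L s y u < +oo)%E -> 0 < r <= 1 ->
      (L s y (r *: u) < +oo)%E ;
  admissible_ex : forall t x, 0 <= t < T -> S x ->
    exists y u, admissible t x y u }.

Definition radial_convex : Prop :=
  \forall s \ae leb R, s \in `[0, T] ->
    forall y u, U u -> forall r1 r2 l : R, 0 < r1 -> 0 < r2 -> 0 <= l <= 1 ->
      (L s y ((l * r1 + (1 - l) * r2) *: u) <=
       l%:E * L s y (r1 *: u) + (1 - l)%:E * L s y (r2 *: u))%E.

Definition Dquot (s : R) (y : 'cV[R]_n) (u : 'cV[R]_m) (h : R) : \bar R :=
  ((L s y (u + h *: u) - L s y u) * (h^-1)%:E)%E.

Definition has_Du (s : R) (y : 'cV[R]_n) (u : 'cV[R]_m) : Prop :=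
  exists q : R, Dquot s y u h @[h --> 0^'] --> q%:E.

Definition Du (s : R) (y : 'cV[R]_n) (u : 'cV[R]_m) : R :=
  fine (lim (Dquot s y u h @[h --> 0^'])).

Definition partial_differentiable : Prop :=
  \forall s \ae leb R, s \in `[0, T] ->
    forall y u, U u -> (L s y u < +oo)%E -> has_Du s y u.

Definition condS (kappa A : R) (gamma : R -> R) (eps : R) : Prop :=
  [/\ 0 <= kappa, 0 <= A, 0 < eps,
      (leb R).-integrable `[0, T] (fun s => (gamma s)%:E) &
      \forall s \ae leb R, s \in `[0, T] ->
        forall s1 s2 y u,
          s1 \in `[s - eps, s + eps] -> s1 \in `[0, T] ->
          s2 \in `[s - eps, s + eps] -> s2 \in `[0, T] -> U u ->
          Dom (s1, (y, u)) -> Dom (s2, (y, u)) ->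
          (`|L s2 y u - L s1 y u| <=
           (kappa%:E * L s y u + (A * enorm u + gamma s)%:E)
           * `|s2 - s1|%:E)%E].

Definition autonomous : Prop :=
  forall s1 s2 y u, s1 \in `[0, T] -> s2 \in `[0, T] -> L s1 y u = L s2 y u.

Definition cbound (alpha d t B : R) : R :=
  (B + d * (T - t)) / (alpha * (T - t)).

(* The constants of [condS] count as 0 when L does not depend on time. *)
Definition Phi (alpha d kappa A : R) (gamma : R -> R) (B : R) : R :=
  if `[< autonomous >] then 0
  else kappa * B + A / alpha * (B + d * T)
       + \int[leb R]_(s in `[0, T]) `|gamma s|.

Definition subdiff (s : R) (y : 'cV[R]_n) (u : 'cV[R]_m) : set R :=
  [set q | forall r : R, 0 < r ->
    ((q * (r - 1))%:E <= L s y (r *: u) - L s y u)%E].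

Definition selection (Q : R -> 'cV[R]_n -> 'cV[R]_m -> R) : Prop :=
  forall s y u, Dom (s, (y, u)) -> U u -> subdiff s y u !=set0 ->
    subdiff s y u (Q s y u).

Definition Eset (K nu : R) : set (point R n m) :=
  [set p | [/\ Dom p, enorm p.2.1 <= K, U p.2.2 & nu <= enorm p.2.2]].

Definition Fset (K c rho : R) : set (point R n m) :=
  [set p | [/\ Dom p, enorm p.2.1 <= K, U p.2.2, enorm p.2.2 < c &
               (rho%:E <= dist p bdDom)%E]].

(* [def] is the set of points where the partial function Q is defined. *)
Definition gap_values (def : R -> 'cV[R]_n -> 'cV[R]_m -> Prop)
    (Q : R -> 'cV[R]_n -> 'cV[R]_m -> R) (A : set (point R n m)) :
    set (\bar R) :=
  [set (L p.1 p.2.1 p.2.2 - (Q p.1 p.2.1 p.2.2)%:E)%E |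
    p in A `&` [set p | def p.1 p.2.1 p.2.2]].

Definition growth_gap (K nu c phi : R)
    (def : R -> 'cV[R]_n -> 'cV[R]_m -> Prop)
    (Q : R -> 'cV[R]_n -> 'cV[R]_m -> R) : Prop :=
  forall rho : R, 0 < rho ->
    (ereal_sup (gap_values def Q (Eset K nu)) + (2 * phi)%:E <
     ereal_inf (gap_values def Q (Fset K c rho)))%E.

Definition growth_condition (alpha d kappa A : R) (gamma : R -> R)
    (delta B : R) : Prop :=
  forall K : R, 0 <= K ->
    exists nu c : R, [/\ 0 < nu, cbound alpha d delta B < c &
      (radial_convex /\ exists2 Q, selection Q &
         growth_gap K nu c (Phi alpha d kappa A gamma B)
           (fun s y u => subdiff s y u !=set0) Q)
      \/
      (partial_differentiable /\
         growth_gap K nu c (Phi alpha d kappa A gamma B) has_Du Du)].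

Definition real_valued : Prop := Dom = `[0, T] `*` setT.

Definition h1 : Prop :=
  exists D : set ('cV[R]_n * 'cV[R]_m), Dom = `[0, T] `*` D.

Definition h2 : Prop :=
  forall l : R, 0 < l -> exists2 r : R, 0 < r &
    forall p, Dom p -> U p.2.2 -> (dist p bdDom < r%:E)%E ->
      (l%:E <= L p.1 p.2.1 p.2.2)%E.

End problem.

Definition econvex (R : realType) (m : nat) (f : 'cV[R]_m -> \bar R) : Prop :=
  forall (u v : 'cV[R]_m) (l : R), 0 <= l <= 1 ->
    (f (l *: u + (1 - l) *: v)%R <= l%:E * f u + (1 - l)%:E * f v)%E.

(* Main.v *)
(* A Gronwall argument bounds all trajectories of cost at most B in a fixed
   ball. On such a trajectory the control is large only on a set of small
   measure, where time is slowed down so that it becomes bounded; the time lost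
   is regained by running faster on part of the set where both the control and
   the running cost are moderate. Writing r for the factor, convexity of
   r |-> r L(s, y, u / r) bounds the change of the running cost by
   (r - 1)(L - Q)(s, y, u / r), and the gap 2 Phi(B) in the growth condition
   gains more than the shift of the time variable loses by Condition (S). Hence
   a minimizing sequence may be taken with uniformly bounded controls and
   equi-Lipschitz states.
   For such a sequence, Ascoli's theorem gives a pointwise limit of the states,
   and convex combinations of the tails of the controls, chosen almost of minimal
   norm in L^2, form a Cauchy sequence by the parallelogram identity and converge
   almost everywhere. Since the dynamics is linear in the control, the limit is a
   trajectory; since L(s, ., .) is lower semicontinuous and convex in u, its
   supporting affine functions persist near the limit state, so Fatou's lemma
   shows that the limit is optimal. *)

From HB Require Import structures.
Require Import Defs.
From mathcomp Require Import all_boot all_order all_algebra.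
From mathcomp Require Import all_classical all_reals all_analysis.
From mathcomp Require Import measurable_realfun ring lra.
Import Order.TTheory GRing.Theory Num.Theory.
Import numFieldNormedType.Exports.
Local Open Scope classical_set_scope.
Local Open Scope ring_scope.

Set Implicit Arguments.
Unset Strict Implicit.
Unset Printing Implicit Defensive.

(** * Measures with a density *)

(** The cost bounds the controls in $L^1$ only, which gives no weak compactness; hence the detour
    through bounded controls. A time change keeps the range and the endpoints of the state and the
    integral of $|u|$, so the a priori bounds survive it. The inequality $c > c_t(B)$ says that $c$
    exceeds the bound on the mean of $|u|$. Markov's inequality then leaves a set of measure bounded
    below on which the control is below some $c' < c$ and the running cost below some level. There
    (h$_2$) keeps the points away from the boundary of the domain, so that slightly larger multiples
    of the control stay inside: a subgradient exists at the accelerated control, and the infimum of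
    the growth condition applies to it. By (h$_1$) a shift in time does not leave the domain. As the
    measurable sets are the Lebesgue sets, continuity of a time change does not give its
    measurability; null sets must be followed in both directions. In the limit the weights of the
    convex combinations do not depend on time, so the same ones serve for controls, velocities and
    costs, while the states converge by themselves. *)

Definition density d (T : measurableType d) (R : realType)
    (mu : {measure set T -> \bar R}) (w : T -> R) (w0 : forall x, 0 <= w x)
    (mw : measurable_fun setT w) (A : set T) : \bar R :=
  (\int[mu]_(x in A) (w x)%:E)%E.

Section density.
Context d (T : measurableType d) (R : realType).
Context (mu : {measure set T -> \bar R}) (w : T -> R) (w0 : forall x, 0 <= w x).
Context (mw : measurable_fun setT w).
Local Notation nu := (density mu w0 mw).

Let nu0 : nu set0 = 0%E. Proof. exact: integral_set0. Qed.

Let nu_ge0 A : (0 <= nu A)%E.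
Proof. by apply: integral_ge0 => x _; rewrite lee_fin. Qed.

Let mEw D : measurable_fun D (fun x => (w x)%:E).
Proof. by apply/measurable_EFinP; exact: measurable_funS mw. Qed.

Let nu_sigma_additive : semi_sigma_additive nu.
Proof.
move=> F mF tF mUF.
rewrite /density (@ge0_integral_bigcup _ _ _ mu F _ mF (@mEw _) _ tF)//.
  by apply: is_cvg_ereal_nneg_natsum_cond => n _ _; exact: nu_ge0.
by move=> x _; rewrite lee_fin.
Qed.

HB.instance Definition _ := isMeasure.Build _ _ _ nu nu0 nu_ge0 nu_sigma_additive.

Import HBNNSimple.

(** Monotone convergence on both sides reduces the identity to simple functions, hence to indicators
    of their level sets. *)
Lemma ge0_integral_density (f : T -> \bar R) :
  measurable_fun setT f -> (forall x, 0 <= f x)%E ->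
  (\int[nu]_x f x = \int[mu]_x (f x * (w x)%:E))%E.
Proof.
move=> mf f0.
pose f_ := nnsfun_approx measurableT mf.
transitivity (limn (fun n => \int[nu]_x (f_ n x)%:E))%E.
  rewrite -monotone_convergence//.
  - apply: eq_integral => y _; apply/esym/cvg_lim => //.
    exact: cvg_nnsfun_approx.
  - by move=> n; exact/measurable_EFinP/measurable_funP.
  - by move=> n y _; rewrite lee_fin.
  - by move=> y _ m n mn; rewrite lee_fin; exact/lefP/nd_nnsfun_approx.
have -> : (\int[mu]_x (f x * (w x)%:E) =
    limn (fun n => \int[mu]_x ((f_ n x)%:E * (w x)%:E)))%E.
  rewrite -monotone_convergence//.
  - apply: eq_integral => y _; apply/esym/cvg_lim => //.
    apply: cvgeMr => //.
    exact: cvg_nnsfun_approx.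
  - move=> n; apply: emeasurable_funM => //.
    exact/measurable_EFinP/measurable_funP.
  - by move=> n y _; rewrite mule_ge0// lee_fin.
  - move=> y _ m n mn; rewrite lee_wpmul2r ?lee_fin//.
    exact/lefP/nd_nnsfun_approx.
congr (limn _); apply/funext => n.
under [LHS]eq_integral do rewrite fimfunE -fsumEFin//.
rewrite ge0_integral_fsum//; last 2 first.
- by move=> r; exact/measurable_EFinP/measurable_funM.
- by move=> r x _; rewrite nnfun_muleindic_ge0.
under [RHS]eq_integral.
  move=> x _; rewrite fimfunE -fsumEFin// ge0_mule_fsuml; last first.
    by move=> r; rewrite nnfun_muleindic_ge0.
  over.
rewrite ge0_integral_fsum//; last 2 first.
- move=> r; apply: emeasurable_funM => //.
  exact/measurable_EFinP/measurable_funM.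
- by move=> r x _; rewrite mule_ge0 ?nnfun_muleindic_ge0// lee_fin.
apply: eq_fsbigr => r rf.
have [x rE] : exists x, f_ n x = r by move: rf; rewrite inE/= => -[x _ <-]; exists x.
have r0 : 0 <= r by rewrite -rE.
rewrite integralZl_indic_nnsfun// integral_indic//= setIT.
have -> : (fun x => (r * \1_(f_ n @^-1` [set r]) x)%:E * (w x)%:E)%E =
  (fun x => r%:E * ((EFin \o w) \_ (f_ n @^-1` [set r])) x)%E.
  apply/funext => y; rewrite patchE indicE/=.
  by case: ifPn; rewrite ?mulr1 ?mulr0 ?mul0e ?mule0.
have mfn : measurable (f_ n @^-1` [set r]) by exact: measurable_funPTI.
rewrite ge0_integralZl//; last 2 first.
- exact/(measurable_restrictT _ _).1.
- by move=> y _; rewrite patchE; case: ifPn => //; rewrite lee_fin.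
by rewrite -integral_mkcond.
Qed.

End density.

Lemma null_density d (T : measurableType d) (R : realType)
    (mu : {measure set T -> \bar R}) (w : T -> R) (w0 : forall x, 0 <= w x)
    (mw : measurable_fun setT w) (A : set T) :
  measurable A -> mu A = 0%E -> density mu w0 mw A = 0%E.
Proof.
move=> mA A0; apply: null_set_integral => //.
by apply/measurable_EFinP; exact: measurable_funS mw.
Qed.

(** The hypothesis says that [phi] pushes the measure of density [w] to [mu]. It is applied to a
    time change, with [w = 1 + rho]. *)
Lemma ge0_integral_pushforward_density d (T : measurableType d) (R : realType)
    (mu : {measure set T -> \bar R}) (w : T -> R) (w0 : forall x, 0 <= w x)
    (mw : measurable_fun setT w) (phi : T -> T) (mphi : measurable_fun setT phi) :
  (forall A, measurable A -> density mu w0 mw (phi @^-1` A) = mu A) ->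
  forall f : T -> \bar R, measurable_fun setT f -> (forall x, 0 <= f x)%E ->
  (\int[mu]_x f x = \int[mu]_x (f (phi x) * (w x)%:E))%E.
Proof.
move=> phiE f mf f0.
pose nu : {measure set T -> \bar R} := density mu w0 mw.
pose nuphi : {measure set T -> \bar R} :=
  measure_function_pushforward__canonical__measure_function_Measure nu mphi.
transitivity (\int[nuphi]_x f x)%E.
  by apply: eq_measure_integral => A mA _; apply/esym; exact: phiE.
rewrite ge0_integral_pushforward// preimage_setT ge0_integral_density//.
  exact: measurableT_comp.
by move=> x; exact: f0.
Qed.

(** * The completed Lebesgue measure *)

Notation lmeasurable R := (@measurable _ (lebT R)).
Notation lmeasurable_fun := (@measurable_fun _ _ (lebT _) _).

Section completed_lebesgue.
Context {R : realType}.
Implicit Types A B : set R.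

Lemma borel_lmeasurable A : measurable A -> lmeasurable R A.
Proof. exact: sub_caratheodory. Qed.

Lemma lmeasurable_itv (i : interval R) : lmeasurable R [set` i].
Proof. exact: borel_lmeasurable. Qed.

Lemma leb_itvcc (a b : R) : a <= b -> leb R `[a, b] = (b - a)%:E.
Proof.
move=> ab; transitivity (@lebesgue_measure R `[a, b]%classic) => //.
rewrite lebesgue_measure_itv/= lte_fin; case: ltP => [_|ba] //.
by have -> : a = b; [apply/eqP; rewrite eq_le ab ba|rewrite subrr].
Qed.

Lemma leb_itvoc (a b : R) : a <= b -> leb R `]a, b] = (b - a)%:E.
Proof.
move=> ab; transitivity (@lebesgue_measure R `]a, b]%classic) => //.
rewrite lebesgue_measure_itv/= lte_fin; case: ltP => [_|ba] //.
by have -> : a = b; [apply/eqP; rewrite eq_le ab ba|rewrite subrr].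
Qed.

Lemma leb_set1 (a : R) : leb R [set a] = 0%E.
Proof. exact: lebesgue_measure_set1. Qed.

Lemma borel_lmeasurable_fun d (X : measurableType d) (f : R -> X) :
  measurable_fun setT f -> @measurable_fun _ _ (lebT R) X setT f.
Proof.
by move=> mf _ Y mY; apply: borel_lmeasurable; exact: mf.
Qed.

Lemma leb_negligible_measurable A : (leb R).-negligible A -> lmeasurable R A.
Proof. exact: negligible_sub_caratheodory. Qed.

(** The form in which Lebesgue sets are pulled back by a time change: a Borel part, and a remainder
    inside a Borel null set. *)
Lemma lmeasurable_split A : lmeasurable R A ->
  exists B N : set (measurableTypeR R),
    [/\ measurable B, (measurable N /\ leb R N = 0%E) &
    B `<=` A /\ A `\` B `<=` N].
Proof.
move=> mA.
have : completed_algebra_gen (@lebesgue_measure R) A.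
  by rewrite -g_sigma_completed_algebra_genE completed_caratheodory_measurable.
move=> [/= B mB [M [N [mN N0 MN]]] <-].
exists B, N; split => //; split; first by move=> x Bx; left.
by move=> x [[//|Mx] _]; exact: MN.
Qed.

End completed_lebesgue.

Section Rintegral_itv.
Context {R : realType} (f : R -> R).
Hypothesis fi : (leb R).-integrable setT (EFin \o f).

Lemma integrable_leb (A : set R) : lmeasurable R A ->
  (leb R).-integrable A (EFin \o f).
Proof. by move=> mA; exact: (integrableS measurableT). Qed.

Lemma Rintegral_itvNy_split (a b : R) : a <= b ->
  \int[leb R]_(x in `]-oo, b]) f x =
  \int[leb R]_(x in `]-oo, a]) f x + \int[leb R]_(x in `]a, b]) f x.
Proof.
move=> ab.
rewrite (@itv_bndbnd_setU _ _ -oo%O (BRight a) (BRight b))//.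
rewrite Rintegral_setU//; try exact: lmeasurable_itv.
- by apply: integrable_leb; apply: measurableU; exact: lmeasurable_itv.
- apply/disj_setPS => x [] /=; rewrite !in_itv/= => xa /andP[ax _].
  by move: (le_lt_trans xa ax); rewrite ltxx.
Qed.

(** Absolute continuity of the integral: an increment is an integral over an interval of small
    measure. *)
Lemma Rintegral_leb_continuous :
  continuous (fun s => \int[leb R]_(x in `]-oo, s]) f x).
Proof.
move=> s; apply/cvgrPdist_lt => e e0.
have [d [d0 Hd]] := integral_normr_continuous fi e0.
have key a b : a <= b -> b - a < d ->
    `|\int[leb R]_(x in `]-oo, b]) f x - \int[leb R]_(x in `]-oo, a]) f x| < e.
  move=> ab bad; rewrite (Rintegral_itvNy_split ab) addrC addKr.
  apply: le_lt_trans (Hd `]a, b]%classic _ _).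
  - apply: le_normr_Rintegral; first exact: lmeasurable_itv.
    by apply: integrable_leb; exact: lmeasurable_itv.
  - exact: lmeasurable_itv.
  - by rewrite [ltLHS](leb_itvoc ab) lte_fin.
near=> u.
have su : `|s - u| < d by near: u; apply: cvgr_dist_lt.
have [us|/ltW su'] := leP u s.
  by apply: key => //; apply: le_lt_trans su; exact: ler_norm.
rewrite distrC; apply: key => //; apply: le_lt_trans su.
by rewrite distrC ler_norm.
Unshelve. all: by end_near. Qed.

End Rintegral_itv.

(** * Time changes *)

(** [phi] sends the time of the original trajectory to the time of the new one, at rate [1 + rho];
    [psi] is its inverse. The record collects what trajectories and costs require, so that the
    construction can be forgotten. *)
Record time_change (R : realType) (t T : R) (rho phi psi : R -> R) : Prop := TimeChange {
  tc_phiE : forall s, phi s = s + \int[leb R]_(x in `]-oo, s]) rho x ;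
  tc_gt0 : forall s, 0 < 1 + rho s ;
  tc_phiK : cancel phi psi ;
  tc_psiK : cancel psi phi ;
  tc_phi_le : {mono phi : a b / a <= b} ;
  tc_psi_le : {mono psi : a b / a <= b} ;
  tc_psi_left : psi t = t ;
  tc_psi_right : psi T = T ;
  tc_phi_meas : @measurable_fun _ _ (lebT R) (lebT R) setT phi ;
  tc_psi_meas : @measurable_fun _ _ (lebT R) (lebT R) setT psi ;
  tc_ae_phi : forall Q : R -> Prop,
    (\forall s \ae leb R, Q s) -> \forall s \ae leb R, Q (phi s) ;
  tc_ae_psi : forall Q : R -> Prop,
    (\forall s \ae leb R, Q s) -> \forall s \ae leb R, Q (psi s) ;
  tc_change : forall f : R -> \bar R,
    lmeasurable_fun setT f -> (forall s, 0 <= f s)%E ->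
    (\int[leb R]_s f s = \int[leb R]_s (f (phi s) * (1 + rho s)%:E))%E }.

Section time_change.
Context {R : realType} (rho : R -> R) (t T r0 : R).
Hypothesis tT : t <= T.
Hypothesis r0_gt0 : 0 < r0.
Hypothesis rho_int : (leb R).-integrable setT (EFin \o rho).
Hypothesis rho_out : forall s, s \notin `]t, T] -> rho s = 0.
Hypothesis rho_ge : forall s, r0 <= 1 + rho s.
Hypothesis rho_tot : \int[leb R]_s rho s = 0.

(** Integrating from [-oo] defines the time change on the whole line. It is the identity outside
    []t, T]], because [rho] vanishes there and has total integral 0. *)
Definition reparam s := s + \int[leb R]_(x in `]-oo, s]) rho x.
Local Notation phi := reparam.

Let mrho : lmeasurable_fun setT rho.
Proof. by apply/measurable_EFinP; exact: measurable_int rho_int. Qed.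

Lemma reparam_continuous : continuous phi.
Proof.
by move=> s; apply: cvgD; [exact: cvg_id|exact: Rintegral_leb_continuous].
Qed.

Lemma reparamB a b : a <= b ->
  phi b - phi a = (b - a) + \int[leb R]_(x in `]a, b]) rho x.
Proof. by move=> ab; rewrite /phi (Rintegral_itvNy_split rho_int ab); ring. Qed.

Let cst_int (k : R) a b : (leb R).-integrable `]a, b] (EFin \o cst k).
Proof.
apply: measurable_bounded_integrable; first exact: lmeasurable_itv.
- have [ab|ba] := leP a b.
    by rewrite [ltLHS](leb_itvoc ab) ltry.
  by rewrite set_itv_ge ?measure0// bnd_simp -leNgt; exact: ltW.
- exact: measurable_cst.
- by exists `|k|; split; [exact: num_real|move=> x kx y _; exact: ltW].
Qed.

Let Rint_cst (k a b : R) : a <= b ->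
  \int[leb R]_(x in `]a, b]) k = k * (b - a).
Proof.
move=> ab; rewrite Rintegral_cst; last exact: lmeasurable_itv.
by rewrite [X in fine X](leb_itvoc ab).
Qed.

(** Monotonicity with a rate, from [rho >= r0 - 1]; it makes the inverse Lipschitz with constant
    [r0^-1]. *)
Lemma reparam_expand a b : a <= b -> r0 * (b - a) <= phi b - phi a.
Proof.
move=> ab; rewrite reparamB//.
have : \int[leb R]_(x in `]a, b]) (r0 - 1) <= \int[leb R]_(x in `]a, b]) rho x.
  apply: le_Rintegral.
  - exact: lmeasurable_itv.
  - exact: cst_int.
  - exact: integrable_leb (lmeasurable_itv _).
  - by move=> x _; have := rho_ge x; lra.
by rewrite Rint_cst// => H; lra.
Qed.

Lemma reparam_left s : s <= t -> phi s = s.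
Proof.
move=> st; rewrite /phi (@eq_Rintegral _ _ _ _ _ (cst 0)).
  by rewrite /= Rintegral_cst ?mul0r ?addr0//; exact: lmeasurable_itv.
move=> x; rewrite inE/= in_itv/= => xs; apply: rho_out.
by rewrite in_itv/= negb_and -leNgt (le_trans xs st).
Qed.

Lemma reparam_right s : T <= s -> phi s = s.
Proof.
move=> Ts; rewrite /phi Rintegral_mkcond.
rewrite (_ : rho \_ _ = rho) ?rho_tot ?addr0//.
apply/funext => x; rewrite patchE; case: ifPn => //.
rewrite notin_setE/= in_itv/= => /negP; rewrite -ltNge => sx.
by rewrite rho_out// in_itv/= negb_and orbC -ltNge (le_lt_trans Ts sx).
Qed.

Lemma reparam_lt a b : a < b -> phi a < phi b.
Proof.
move=> ab; rewrite -subr_gt0; apply: lt_le_trans (reparam_expand (ltW ab)).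
by rewrite mulr_gt0// subr_gt0.
Qed.

Lemma reparam_le : {mono phi : a b / a <= b}.
Proof. by apply: le_mono => a b; exact: reparam_lt. Qed.

Lemma reparam_surj v : exists s, phi s = v.
Proof.
(* Since [a <= t] and [T <= b], both are fixed points of [phi], and [v] lies between them. *)
pose a := Num.min v t; pose b := Num.max v T.
have av : a <= v by rewrite ge_min lexx.
have vb : v <= b by rewrite /b le_max lexx.
have at_ : a <= t by rewrite ge_min lexx orbT.
have Tb : T <= b by rewrite le_max lexx orbT.
have ab : a <= b by exact: le_trans vb.
have [||c _ <-] := @IVT R phi a b v ab.
- by apply: continuous_subspaceT; exact: reparam_continuous.
- by rewrite reparam_left// reparam_right// min_l// max_r// av vb.
by exists c.
Qed.

Definition unparam v := projT1 (cid (reparam_surj v)).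
Local Notation psi := unparam.

Lemma unparamK : cancel psi phi.
Proof. by move=> v; rewrite /unparam; case: cid. Qed.

Lemma reparamK : cancel phi psi.
Proof. by move=> s; apply: (inc_inj reparam_le); rewrite unparamK. Qed.

Lemma unparam_le : {mono psi : a b / a <= b}.
Proof. by move=> a b; rewrite -reparam_le !unparamK. Qed.

Lemma unparam_left s : s <= t -> psi s = s.
Proof. by move=> st; rewrite -[in LHS](reparam_left st) reparamK. Qed.

Lemma unparam_right s : T <= s -> psi s = s.
Proof. by move=> st; rewrite -[in LHS](reparam_right st) reparamK. Qed.

Lemma unparam_lipschitz a b : a <= b -> r0 * (psi b - psi a) <= b - a.
Proof.
move=> ab; have := @reparam_expand (psi a) (psi b); rewrite unparam_le.
by move=> /(_ ab); rewrite !unparamK.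
Qed.

Lemma unparam_continuous : continuous psi.
Proof.
have lip a b : `|psi a - psi b| <= r0^-1 * `|a - b|.
  wlog ab : a b / a <= b.
    move=> H; have [/H//|/ltW/H] := leP a b.
    by rewrite distrC [X in _ -> _ <= _ * X]distrC.
  rewrite distrC [X in _ <= _ * X]distrC ger0_norm ?subr_ge0 ?unparam_le//.
  by rewrite ger0_norm ?subr_ge0// mulrC ler_pdivlMr// mulrC unparam_lipschitz.
move=> s; apply/cvgrPdist_lt => e e0.
near=> u; apply: (le_lt_trans (lip _ _)).
rewrite mulrC ltr_pdivrMr//.
near: u; have : 0 < e * r0 by rewrite mulr_gt0.
by move=> ?; exact: cvgr_dist_lt.
Unshelve. all: by end_near. Qed.

Let w s := 1 + rho s.
Let w0 s : 0 <= w s. Proof. exact: le_trans (ltW r0_gt0) (rho_ge s). Qed.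
Let mw : lmeasurable_fun setT w.
Proof. exact: measurable_funD. Qed.
Let nu : {measure set (lebT R) -> \bar R} := density (leb R) w0 mw.

Let mphi : @measurable_fun _ _ (lebT R) (measurableTypeR R) setT phi.
Proof.
apply: (@borel_lmeasurable_fun R _ (measurableTypeR R)).
exact: (continuous_measurable_fun reparam_continuous).
Qed.

(** The preimage is []psi a, psi b]], over which [1 + rho] integrates to the increment of [phi]. *)
Let nu_phi_itv a b : a <= b -> nu (phi @^-1` `]a, b]) = (b - a)%:E.
Proof.
move=> ab.
have -> : phi @^-1` `]a, b] = `]psi a, psi b]%classic.
  apply/seteqP; split => s /=; rewrite !in_itv/= !ltNge;
    by rewrite -(reparam_le s (psi a)) -(reparam_le s (psi b)) !unparamK.
have pab : psi a <= psi b by rewrite unparam_le.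
rewrite /nu/= /density.
have wi : (leb R).-integrable `]psi a, psi b] (EFin \o w).
  apply: (@integrableD _ _ _ (leb R) _ (lmeasurable_itv _) (EFin \o cst 1) (EFin \o rho)).
    exact: cst_int.
  exact: integrable_leb (lmeasurable_itv _).
rewrite -(@fineK _ (\int[leb R]_(x in _) _)%E); last first.
  exact: (integrable_fin_num (lmeasurable_itv _) wi).
congr EFin; rewrite -[LHS]/(\int[leb R]_(x in `]psi a, psi b]) (1 + rho x)).
rewrite RintegralD; first last.
- exact: integrable_leb (lmeasurable_itv _).
- exact: cst_int.
- exact: lmeasurable_itv.
by rewrite Rint_cst// mul1r -reparamB// !unparamK.
Qed.

(** Uniqueness of Lebesgue measure: the pushforward of [nu] by [phi] has the right values on
    half-open intervals. *)
Let nu_phi_borel (A : set R) : measurable A -> nu (phi @^-1` A) = leb R A.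
Proof.
move=> mA.
pose nuphi : {measure set (measurableTypeR R) -> \bar R} :=
  measure_function_pushforward__canonical__measure_function_Measure nu mphi.
transitivity (nuphi A) => //; apply/esym.
apply: (@lebesgue_measure_unique R nuphi) => // _ [[a b] _ <-].
have [ab|ba] := leP a b; last first.
  by rewrite set_itv_ge ?measure0// bnd_simp -leNgt; exact: ltW.
transitivity (b - a)%:E; first exact: leb_itvoc.
by apply/esym; exact: nu_phi_itv.
Qed.

(** The density is positive everywhere. With the converse [null_nu], the measures [nu] and [leb R]
    have the same null sets. *)
Let nu_null (A : set R) : lmeasurable R A -> nu A = 0%E -> leb R A = 0%E.
Proof.
move=> mA; rewrite /nu/= /density => h.
have mwA : lmeasurable_fun A (fun x => (w x)%:E).
  by apply/measurable_EFinP; exact: measurable_funS mw.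
have : (\int[leb R]_(x in A) `|(w x)%:E| = 0)%E.
  by under eq_integral do rewrite gee0_abs ?lee_fin//.
move/(ae_eq_integral_abs (leb R) mA mwA) => [N [mN N0 AN]].
apply: (subset_measure0 mA mN) => // x Ax; apply: AN => /(_ Ax)/= [] wx.
by have := lt_le_trans r0_gt0 (rho_ge x); rewrite -/(w x) wx ltxx.
Qed.

Let null_nu (A : set R) : lmeasurable R A -> leb R A = 0%E -> nu A = 0%E.
Proof. exact: null_density. Qed.

Let phi_null (N : set R) : measurable (N : set (measurableTypeR R)) ->
  leb R N = 0%E -> leb R (phi @^-1` N) = 0%E.
Proof.
move=> mN N0; apply: nu_null; last by rewrite nu_phi_borel.
by rewrite -[X in lmeasurable R X]setTI; exact: mphi.
Qed.

(** Continuity settles the Borel part of [A]. The preimage of the remainder lies in the preimage of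
    a null set, which is null because [nu] and Lebesgue measure have the same null sets. *)
Lemma reparam_lmeasurable : @measurable_fun _ _ (lebT R) (lebT R) setT phi.
Proof.
move=> _ A mA; rewrite setTI.
have [B [N [mB [mN N0] [BA ABN]]]] := lmeasurable_split mA.
have -> : phi @^-1` A = phi @^-1` B `|` phi @^-1` (A `\` B).
  by rewrite -preimage_setU setDUK.
apply: measurableU.
  by rewrite -[X in lmeasurable R X]setTI; exact: mphi.
apply: leb_negligible_measurable; exists (phi @^-1` N); split.
- by rewrite -[X in lmeasurable R X]setTI; exact: mphi.
- exact: phi_null.
- exact: preimage_subset.
Qed.

Let nu_phi (A : set R) : lmeasurable R A -> nu (phi @^-1` A) = leb R A.
Proof.
move=> mA.
have [B [N [mB [mN N0] [BA ABN]]]] := lmeasurable_split mA.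
have mB' := borel_lmeasurable mB.
have mAB : lmeasurable R (A `\` B) by exact: measurableD.
have mpB (C : set R) : lmeasurable R C -> lmeasurable R (phi @^-1` C).
  by move=> mC; rewrite -[X in lmeasurable R X]setTI; exact: reparam_lmeasurable.
have AE : A = B `|` (A `\` B) by rewrite setDUK.
rewrite [in LHS]AE preimage_setU measureU; [|exact: mpB|exact: mpB|]; last first.
  by apply/seteqP; split => // x /= [? []].
rewrite [X in (X + _)%E](nu_phi_borel mB).
have h0 : nu (phi @^-1` (A `\` B)) = 0%E.
  apply: null_nu; first exact: mpB.
  apply: (subset_measure0 (mpB _ mAB) (mpB _ (borel_lmeasurable mN))).
    exact: preimage_subset.
  exact: phi_null.
rewrite [X in (_ + X)%E]h0 adde0; apply/eqP; rewrite eq_le; apply/andP; split.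
  by apply: le_measure; rewrite ?inE.
rewrite [in leLHS]AE; apply: le_trans (measureU2 _ mB' mAB) _.
have h1 : leb R (A `\` B) = 0%E.
  by apply: (subset_measure0 mAB (borel_lmeasurable mN)).
by rewrite [X in (_ + X)%E]h1 adde0.
Qed.

Lemma unparam_lmeasurable : @measurable_fun _ _ (lebT R) (lebT R) setT psi.
Proof.
have mpsi : measurable_fun setT psi.
  exact: continuous_measurable_fun unparam_continuous.
have mps (C : set R) : measurable (C : set (measurableTypeR R)) ->
    lmeasurable R (psi @^-1` C).
  move=> mC; rewrite -[X in lmeasurable R X]setTI; apply: borel_lmeasurable.
  exact: mpsi.
move=> _ A mA; rewrite setTI.
have [B [N [mB [mN N0] [BA ABN]]]] := lmeasurable_split mA.
have -> : psi @^-1` A = psi @^-1` B `|` psi @^-1` (A `\` B).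
  by rewrite -preimage_setU setDUK.
apply: measurableU; first exact: mps.
apply: leb_negligible_measurable; exists (psi @^-1` N); split.
- exact: mps.
- rewrite -[LHS]nu_phi; last exact: mps.
  have -> : phi @^-1` (psi @^-1` N) = N.
    by apply/seteqP; split => x; rewrite /preimage/= reparamK.
  by apply: null_nu => //; exact: borel_lmeasurable.
- exact: preimage_subset.
Qed.

Lemma ae_reparam (Q : R -> Prop) :
  (\forall s \ae leb R, Q s) -> \forall s \ae leb R, Q (phi s).
Proof.
move=> [N [mN N0 QN]]; exists (phi @^-1` N); split.
- by rewrite -[X in lmeasurable R X]setTI; exact: reparam_lmeasurable.
- apply: nu_null; last by rewrite nu_phi.
  by rewrite -[X in lmeasurable R X]setTI; exact: reparam_lmeasurable.
- by move=> x Qx; exact: QN.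
Qed.

Lemma ae_unparam (Q : R -> Prop) :
  (\forall s \ae leb R, Q s) -> \forall s \ae leb R, Q (psi s).
Proof.
move=> [N [mN N0 QN]]; exists (psi @^-1` N); split.
- by rewrite -[X in lmeasurable R X]setTI; exact: unparam_lmeasurable.
- rewrite -[LHS]nu_phi; last first.
    by rewrite -[X in lmeasurable R X]setTI; exact: unparam_lmeasurable.
  have -> : phi @^-1` (psi @^-1` N) = N.
    by apply/seteqP; split => x; rewrite /preimage/= reparamK.
  exact: null_nu.
- by move=> x Qx; exact: QN.
Qed.

Lemma ge0_integral_reparam (f : R -> \bar R) :
  lmeasurable_fun setT f -> (forall s, 0 <= f s)%E ->
  (\int[leb R]_s f s = \int[leb R]_s (f (phi s) * (1 + rho s)%:E))%E.
Proof.
by move=> mf f0; exact: (ge0_integral_pushforward_density reparam_lmeasurable nu_phi).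
Qed.

Lemma time_change_ex : exists phi psi, time_change t T rho phi psi.
Proof.
exists phi, psi; split.
- by [].
- by move=> s; exact: lt_le_trans r0_gt0 (rho_ge s).
- exact: reparamK.
- exact: unparamK.
- exact: reparam_le.
- exact: unparam_le.
- exact: unparam_left.
- exact: unparam_right.
- exact: reparam_lmeasurable.
- exact: unparam_lmeasurable.
- exact: ae_reparam.
- exact: ae_unparam.
- exact: ge0_integral_reparam.
Qed.

End time_change.

(** * Measurability of vector-valued maps *)

(** In a separable space every open set is a countable union of balls with radii [k.+1^-1] and
    centres in a countable dense family. *)
Lemma measurable_fun_borel_ball d (T : measurableType d) (R : realType)
    (X : pseudoMetricType R) (p0 : X) (I : countType) (c : I -> X)
    (D : set T) (f : T -> X) :
  (forall x (e : R), 0 < e -> exists i, ball x e (c i)) ->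
  (forall i (k : nat), measurable (D `&` f @^-1` ball (c i) k.+1%:R^-1)) ->
  forall O, open O -> measurable (D `&` f @^-1` O).
Proof.
move=> cdense mball O oO.
pose J : set (I * nat) := [set ik | ball (c ik.1) (ik.2.+1%:R^-1 : R) `<=` O].
have -> : D `&` f @^-1` O =
    \bigcup_(ik in J) (D `&` f @^-1` ball (c ik.1) ik.2.+1%:R^-1).
  apply/seteqP; split => [x [Dx Ofx]|x [ik Jik [Dx fx]]]; last by split=> //; exact: Jik.
  have : nbhs (f x) O by exact: open_nbhs_nbhs.
  move=> /nbhs_ballP[e /= e0 eO].
  have [k ke] : exists k : nat, k.+1%:R^-1 < e / 2.
    have e20 : 0 < e / 2 by rewrite divr_gt0.
    have [N _ /(_ N)] := near_infty_natSinv_lt (PosNum e20).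
    by move=> /(_ (leqnn N)); exists N.
  have k0 : 0 < (k.+1%:R^-1 : R) by rewrite invr_gt0.
  have [i ci] := cdense (f x) _ k0.
  exists (i, k) => //=; last by split => //; exact: ball_sym.
  move=> z ciz; apply: eO; rewrite [e]splitr.
  apply: (@ball_triangle _ _ (c i)).
    exact: (le_ball (ltW ke)) ci.
  exact: (le_ball (ltW ke)) ciz.
rewrite bigcup_mkcond.
apply: (@countable_bigcupT_measurable _ T (I * nat)%type) => [|ik].
  exact: countableP.
by case: ifPn => // _; exact: mball.
Qed.

Section column_measurability.
Context {R : realType} (n : nat).

Lemma ratr_col_dense (x : 'cV[R]_n) (e : R) : 0 < e ->
  exists q : 'cV[rat]_n, ball x e (map_mx ratr q : 'cV[R]_n).
Proof.
move=> e0.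
have ex i : exists q : rat, `|x i 0 - ratr q| < e.
  have xe : x i 0 - e < x i 0 + e by lra.
  have [q] := rat_in_itvoo xe.
  by rewrite in_itv/= => /andP[q1 q2]; exists q; rewrite ltr_norml; apply/andP; split; lra.
exists (\col_i projT1 (cid (ex i))).
split=> // i j; rewrite !mxE ord1.
by case: cid => q /=.
Qed.

Lemma measurable_col_coord d (T : measurableType d) (D : set T) (u : T -> 'cV[R]_n) :
  measurable D -> @measurable_fun _ _ T (borel 'cV[R]_n) D u ->
  forall i, measurable_fun D (fun s => u s i 0).
Proof.
move=> mD mu i; apply: (measurability _ (RGenOpens.measurableE R)).
move=> _ [_ [a [b ->] <-]].
apply: (mu mD (fun v : 'cV[R]_n => v i 0 \in `]a, b[)).
apply: sub_sigma_algebra.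
have /continuousP/(_ `]a, b[%classic) := @coord_continuous R n 1 i 0.
apply; exact: interval_open.
Qed.

Lemma measurable_col d (T : measurableType d) (D : set T) (u : T -> 'cV[R]_n) :
  measurable D -> (forall i, measurable_fun D (fun s => u s i 0)) ->
  @measurable_fun _ _ T (borel 'cV[R]_n) D u.
Proof.
move=> mD mu.
apply: (@measurability _ _ T (borel 'cV[R]_n) D u (@open 'cV[R]_n)) => //.
move=> _ [V oV <-].
apply: (@measurable_fun_borel_ball _ _ _ _ 0 _ _ _ _ ratr_col_dense) => // q k.
have -> : D `&` u @^-1` ball (map_mx ratr q : 'cV[R]_n) k.+1%:R^-1 =
    D `&` \bigcap_(i in [set: 'I_n])
      (D `&` (fun s => u s i 0) @^-1` ball (ratr (q i 0) : R) k.+1%:R^-1).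
  apply/seteqP; split => [s [Ds [k0 H]]|s [Ds H]]; split => //.
    by move=> i _; split => //; have := H i 0; rewrite !mxE.
  by split; [rewrite invr_gt0|move=> i j; rewrite !mxE ord1; have [] := H i I].
apply: measurableI => //; apply: fin_bigcap_measurable => // i _.
apply: mu => //; exact: measurable_ball.
Qed.

End column_measurability.

(** The lagrangian is measurable for the Borel sets of the product space, generated by its open
    sets. Balls of that space with rational centres are products of balls, which brings back the
    coordinates. *)
Lemma measurable_col_pair d (T : measurableType d) (R : realType) (n m : nat)
    (D : set T) (y : T -> 'cV[R]_n) (u : T -> 'cV[R]_m) :
  measurable D -> (forall i, measurable_fun D (fun s => y s i 0)) ->
  (forall i, measurable_fun D (fun s => u s i 0)) ->
  @measurable_fun _ _ T (borel ('cV[R]_n * 'cV[R]_m)%type) D (fun s => (y s, u s)).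
Proof.
move=> mD my mu; apply: (@measurability _ _ T
  (borel ('cV[R]_n * 'cV[R]_m)%type) D _ (@open ('cV[R]_n * 'cV[R]_m)%type)) => //.
move=> _ [V oV <-].
pose c (q : 'cV[rat]_n * 'cV[rat]_m) : 'cV[R]_n * 'cV[R]_m :=
  (map_mx ratr q.1, map_mx ratr q.2).
have cd x (e : R) : 0 < e -> exists q, ball x e (c q).
  move=> e0; have [q1 h1] := ratr_col_dense x.1 e0.
  by have [q2 h2] := ratr_col_dense x.2 e0; exists (q1, q2).
apply: (@measurable_fun_borel_ball _ _ _ _ 0 _ _ _ _ cd) => // q k.
have -> : D `&` (fun s => (y s, u s)) @^-1` ball (c q) k.+1%:R^-1 =
  (D `&` y @^-1` ball (c q).1 k.+1%:R^-1) `&` (D `&` u @^-1` ball (c q).2 k.+1%:R^-1).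
  by apply/seteqP; split => [s [Ds [? ?]]|s [[Ds ?] [_ ?]]].
have h p (z : T -> 'cV[R]_p) (x : 'cV[R]_p) :
    (forall i, measurable_fun D (fun s => z s i 0)) ->
    measurable (D `&` z @^-1` ball x (k.+1%:R^-1 : R)).
  move=> mz; apply: (measurable_col mD mz) => //.
  by apply: sub_sigma_algebra; exact: ball_open.
by apply: measurableI; exact: h.
Qed.

(** * The Euclidean norm *)

Section enorm.
Context {R : realType}.

Lemma sum_sqr_ge0 n (v : 'cV[R]_n) : 0 <= \sum_(i < n) v i 0 ^+ 2.
Proof. by apply: sumr_ge0 => i _; exact: sqr_ge0. Qed.

Lemma enorm_ge0 n (v : 'cV[R]_n) : 0 <= enorm v.
Proof. exact: sqrtr_ge0. Qed.

Lemma sqr_enorm n (v : 'cV[R]_n) : enorm v ^+ 2 = \sum_(i < n) v i 0 ^+ 2.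
Proof. by rewrite sqr_sqrtr ?sum_sqr_ge0. Qed.

Lemma coord_le_enorm n (v : 'cV[R]_n) i : `|v i 0| <= enorm v.
Proof.
rewrite -ler_sqr ?nnegrE ?enorm_ge0// sqr_enorm real_normK ?num_real//.
by rewrite (bigD1 i)//= lerDl sumr_ge0// => j _; exact: sqr_ge0.
Qed.

Lemma enorm_le_sum n (v : 'cV[R]_n) : enorm v <= \sum_(i < n) `|v i 0|.
Proof.
rewrite -ler_sqr ?nnegrE ?enorm_ge0 ?sumr_ge0// sqr_enorm expr2 mulr_suml.
apply: ler_sum => i _; rewrite -(real_normK (num_real (v i 0))) expr2 ler_wpM2l//.
by rewrite (bigD1 i)//= lerDl sumr_ge0.
Qed.

Lemma enormZ n (a : R) (v : 'cV[R]_n) : enorm (a *: v) = `|a| * enorm v.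
Proof.
rewrite /enorm -sqrtr_sqr -sqrtrM ?sqr_ge0// mulr_sumr; congr Num.sqrt.
by apply: eq_bigr => i _; rewrite mxE exprMn.
Qed.

Lemma enorm0 n : enorm (0 : 'cV[R]_n) = 0.
Proof. by rewrite -(scale0r (0 : 'cV[R]_n)) enormZ normr0 mul0r. Qed.

Lemma enorm_gt0 n (v : 'cV[R]_n) : v != 0 -> 0 < enorm v.
Proof.
move=> v0; rewrite lt_neqAle enorm_ge0 andbT eq_sym; apply: contra v0 => /eqP v0.
apply/eqP/colP => i; rewrite mxE; apply/eqP; rewrite -normr_le0 -v0.
exact: coord_le_enorm.
Qed.

Lemma enorm_mulmx n m (M : 'M[R]_(n, m)) (v : 'cV[R]_m) :
  enorm (M *m v) <= opnorm M * enorm v.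
Proof.
set A := [set enorm (M *m v) | v in [set v : 'cV[R]_m | enorm v <= 1]].
(* The supremum defining [opnorm] is an upper bound only because the set is bounded; the sum of the
   absolute values of the entries bounds it. *)
have ubA : has_ubound A.
  exists (\sum_(i < n) \sum_(j < m) `|M i j|) => _ [w /= w1 <-].
  apply: le_trans (enorm_le_sum _) _; apply: ler_sum => i _; rewrite mxE.
  apply: le_trans (ler_norm_sum _ _ _) _; apply: ler_sum => j _.
  rewrite normrM ler_piMr//; apply: le_trans w1; exact: coord_le_enorm.
have [->|v0] := eqVneq v 0.
  by rewrite mulmx0 !enorm0 mulr0.
have v1 := enorm_gt0 v0.
rewrite -ler_pdivrMr//.
apply: ub_le_sup => //.
exists ((enorm v)^-1 *: v); last first.
  by rewrite -scalemxAr enormZ ger0_norm ?invr_ge0 ?enorm_ge0// mulrC.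
by rewrite /= enormZ ger0_norm ?invr_ge0 ?enorm_ge0// mulVf ?gt_eqF.
Qed.

Lemma measurable_enorm d (T : measurableType d) n (D : set T) (u : T -> 'cV[R]_n) :
  (forall i, measurable_fun D (fun s => u s i 0)) ->
  measurable_fun D (fun s => enorm (u s)).
Proof.
move=> mu; rewrite /enorm.
apply: (@measurableT_comp _ _ _ _ _ _ (@Num.sqrt R)).
  exact: continuous_measurable_fun (@sqrt_continuous R).
apply: measurable_sum => i; exact: measurable_funX.
Qed.

Lemma edist_radial n m (s : R) (y : 'cV[R]_n) (u : 'cV[R]_m) (a : R) :
  Defs.edist (s, (y, u)) (s, (y, a *: u)) = `|1 - a| * enorm u.
Proof.
rewrite /Defs.edist/= !subrr enorm0 expr0n/= !add0r sqrtr_sqr ger0_norm ?enorm_ge0//.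
by rewrite -{1}[u]scale1r -scalerBl enormZ.
Qed.

Lemma sqr_enorm_split n (u v w : 'cV[R]_n) :
  enorm (u - w) ^+ 2 <= 2 * enorm (u - v) ^+ 2 + 2 * enorm (v - w) ^+ 2.
Proof.
rewrite !sqr_enorm !mulr_sumr -big_split/=; apply: ler_sum => i _.
rewrite !mxE; have := sqr_ge0 ((u i 0 - v i 0) - (v i 0 - w i 0)); nra.
Qed.

(** The factor 4 leaves room for squared distances in place of the triangle inequality: from
    [16 rho^2 <= 2 rho^2 + 2 e^2] follows [rho <= e]. *)
Lemma edist_shift n m (p p' q : Defs.point R n m) (rho : R) : 0 < rho ->
  4 * rho <= Defs.edist p q -> Defs.edist p p' <= rho -> rho <= Defs.edist p' q.
Proof.
move=> r0.
have P0 (a b : Defs.point R n m) : 0 <= (a.1 - b.1) ^+ 2 + enorm (a.2.1 - b.2.1) ^+ 2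
            + enorm (a.2.2 - b.2.2) ^+ 2.
  by rewrite !addr_ge0// sqr_ge0.
have E0 (a b : Defs.point R n m) : 0 <= Defs.edist a b by exact: sqrtr_ge0.
have sE (a b : Defs.point R n m) : Defs.edist a b ^+ 2 =
   (a.1 - b.1) ^+ 2 + enorm (a.2.1 - b.2.1) ^+ 2 + enorm (a.2.2 - b.2.2) ^+ 2.
  by rewrite sqr_sqrtr.
have H : Defs.edist p q ^+ 2 <= 2 * Defs.edist p p' ^+ 2 + 2 * Defs.edist p' q ^+ 2.
  rewrite !sE; have := sqr_enorm_split p.2.1 p'.2.1 q.2.1.
  have := sqr_enorm_split p.2.2 p'.2.2 q.2.2.
  have := sqr_ge0 ((p.1 - p'.1) - (p'.1 - q.1)); nra.
move=> h1 h2; have := E0 p' q; have := E0 p p'; nra.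
Qed.

End enorm.

(** * The radial subdifferential *)

Section radial.
Context {R : realType} (f : R -> \bar R).
Hypothesis f0 : forall r, (0 <= f r)%E.
Hypothesis cf : forall r1 r2 l : R, 0 < r1 -> 0 < r2 -> 0 <= l <= 1 ->
  (f (l * r1 + (1 - l) * r2) <= l%:E * f r1 + (1 - l)%:E * f r2)%E.

Let fin r : (f r < +oo)%E -> f r = (fine (f r))%:E.
Proof. by move=> fr; rewrite fineK// ge0_fin_numE. Qed.

(** The infimum of the slopes to the right of 1 is a subgradient. The finite value at [rp] makes the
    set of slopes nonempty, and by convexity any slope to the left of 1 bounds it from below. *)
Lemma convex_subgradient_ex (rp : R) : 1 < rp -> (f rp < +oo)%E ->
  (forall r, 0 < r <= 1 -> (f r < +oo)%E) ->
  exists q : R, forall r, 0 < r -> ((q * (r - 1))%:E <= f r - f 1)%E.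
Proof.
move=> rp1 frp fr1.
have f1 := fin (fr1 1 ltac:(by rewrite ltr01 lexx)).
pose g r := fine (f r).
pose A := [set (g r - g 1) / (r - 1) | r in [set r | 1 < r /\ (f r < +oo)%E]].
have A0 : A !=set0 by exists ((g rp - g 1) / (rp - 1)); exists rp.
have slope r : 0 < r < 1 -> lbound A ((g 1 - g r) / (1 - r)).
  move=> /andP[r0 r1] _ [r' /= [r'1 fr'] <-].
  have frfin : f r = (fine (f r))%:E by apply/fin/fr1; lra.
  have rr' : 0 < r' - r by lra.
  pose l := (r' - 1) / (r' - r).
  have l01 : 0 <= l <= 1.
    by rewrite /l divr_ge0/= ?ler_pdivrMr//; lra.
  have lE : l * r + (1 - l) * r' = 1 by rewrite /l; field; rewrite gt_eqF.
  have r'0 : 0 < r' by lra.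
  have := cf r0 r'0 l01; rewrite lE f1 frfin (fin fr').
  rewrite -!EFinM -EFinD lee_fin -/(g 1) -/(g r) -/(g r') => H.
  rewrite ler_pdivrMr ?subr_gt0// mulrAC ler_pdivlMr ?subr_gt0//.
  have : g 1 * (r' - r) <= (l * g r + (1 - l) * g r') * (r' - r).
    by rewrite ler_wpM2r// ltW.
  have -> : (l * g r + (1 - l) * g r') * (r' - r) = (r' - 1) * g r + (1 - r) * g r'.
    by rewrite /l; field; rewrite gt_eqF.
  by move=> H2; lra.
have hA : has_lbound A by exists ((g 1 - g 2^-1) / (1 - 2^-1)); apply: slope; lra.
exists (inf A) => r r0.
have [r1|r1|->] := ltgtP r 1; last by rewrite subrr mulr0 f1 -EFinB subrr.
- have frfin : f r = (fine (f r))%:E by apply/fin/fr1; lra.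
  rewrite f1 frfin -EFinB lee_fin.
  have : (g 1 - g r) / (1 - r) <= inf A.
    by apply: lb_le_inf => //; apply: slope; rewrite r0.
  by rewrite ler_pdivrMr ?subr_gt0// -/(g 1) -/(g r) => ?; lra.
- have [fr|] := ltP (f r) +oo%E; last first.
    by rewrite leye_eq => /eqP ->; rewrite f1 addye// leey.
  rewrite f1 (fin fr) -EFinB lee_fin.
  have : inf A <= (g r - g 1) / (r - 1) by apply: ge_inf => //; exists r.
  by rewrite ler_pdivlMr ?subr_gt0.
Qed.

(** The limit is two-sided, so [h] may be taken of the form [l * (r - 1)] with small [l > 0]; there
    [1 + h] lies on the segment from 1 to [r], and convexity compares the quotient with the
    chord. *)
Lemma convex_derivative_subgradient (q : R) : (f 1 < +oo)%E ->
  ((f (1 + h) - f 1) * (h^-1)%:E)%E @[h --> 0^'] --> q%:E ->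
  forall r, 0 < r -> ((q * (r - 1))%:E <= f r - f 1)%E.
Proof.
move=> /fin f1 qlim r r0.
have [->|r1] := eqVneq r 1; first by rewrite subrr mulr0 f1 -EFinB subrr.
have [fr|] := ltP (f r) +oo%E; last first.
  by rewrite leye_eq => /eqP ->; rewrite f1 addye// leey.
rewrite (fin fr) f1 -EFinB lee_fin; set a := fine (f 1); set b := fine (f r).
have r10 : r - 1 != 0 by rewrite subr_eq0.
have quot (e : R) : 0 < e -> exists h, [/\ `|h| < e, h != 0, 0 < h / (r - 1) <= 1 &
    (f (1 + h) <= (a + h / (r - 1) * (b - a))%:E)%E].
  move=> e0; pose l := Num.min 1 (e / 2 / `|r - 1|).
  have l0 : 0 < l by rewrite lt_min ltr01 divr_gt0 ?divr_gt0 ?normr_gt0.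
  have l1 : l <= 1 by rewrite ge_min lexx.
  exists (l * (r - 1)).
  have lK : l * (r - 1) / (r - 1) = l by rewrite mulfK.
  rewrite lK l0 l1 mulf_neq0// ?gt_eqF//; split => //.
    rewrite normrM gtr0_norm//; apply: (@le_lt_trans _ _ (e / 2)); last lra.
    by rewrite -ler_pdivlMr ?normr_gt0// ge_min lexx orbT.
  have := @cf r 1 l r0 ltr01; rewrite l1 ltW// => /(_ isT).
  have -> : l * r + (1 - l) * 1 = 1 + l * (r - 1) by ring.
  move=> /le_trans; apply; rewrite f1 (fin fr) -!EFinM -EFinD lee_fin -/a -/b.
  by lra.

have [qfin /cvgrPdist_lt qfine] := (fine_cvgP _ _).1 qlim.
have close (e : R) : 0 < e -> exists2 d, 0 < d & forall h, `|h| < d -> h != 0 ->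
    (f (1 + h)%R < +oo)%E -> `|q - (fine (f (1 + h)) - a) / h| < e.
  move=> e0; have [d /= d0 Hd] : \forall h \near 0^',
      ((f (1 + h)%R - f 1) * (h^-1)%:E)%E \is a fin_num /\
      `|q - fine ((f (1 + h)%R - f 1) * (h^-1)%:E)%E| < e.
    by apply: filterI; [exact: qfin|exact: qfine].
  exists d => // h hd h0 /fin fh; have [] := Hd h; rewrite /ball_/= ?sub0r ?normrN//.
  by rewrite f1 fh.
apply/ler_addgt0Pr => e e0.
have r1n : 0 < `|r - 1| by rewrite normr_gt0.
have [d d0 Hd] := close (e / `|r - 1|) ltac:(by rewrite divr_gt0).
have [h [hd h0 /andP[l0 l1] fle]] := quot d d0.
have fhy : (f (1 + h)%R < +oo)%E by apply: le_lt_trans fle (ltry _).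
have := Hd h hd h0 fhy; rewrite ltr_pdivlMr// -normrM.
move: fle; rewrite (fin fhy) lee_fin; set g := fine _ => fle.
move=> /ltW /(le_trans (ler_norm _)).
have -> : (q - (g - a) / h) * (r - 1) = q * (r - 1) - (g - a) / (h / (r - 1)).
  by field; rewrite r10 h0.
have : (g - a) / (h / (r - 1)) <= b - a.
  by rewrite ler_pdivrMr// mulrC; lra.
move=> h1; rewrite lerBlDr => /le_trans; apply.
by rewrite [leRHS]addrC lerD2l.
Qed.
End radial.

Section radial_lagrangian.
Context {R : realType} (n m : nat) (P : problem R n m).
Variables (s : R) (y : 'cV[R]_n) (w : 'cV[R]_m).
Hypothesis L0 : forall u, (0 <= lagrangian P s y u)%E.
Hypothesis Lc : econvex (lagrangian P s y).

Let f r := lagrangian P s y (r *: w).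
Let f1 : f 1 = lagrangian P s y w. Proof. by rewrite /f scale1r. Qed.
Let cf : forall r1 r2 l : R, 0 < r1 -> 0 < r2 -> 0 <= l <= 1 ->
  (f (l * r1 + (1 - l) * r2) <= l%:E * f r1 + (1 - l)%:E * f r2)%E.
Proof.
move=> r1 r2 l _ _ l01; rewrite /f scalerDl -!scalerA; exact: Lc.
Qed.

Lemma subdiff_ex (rp : R) : 1 < rp -> (lagrangian P s y (rp *: w) < +oo)%E ->
  (forall r, 0 < r <= 1 -> (lagrangian P s y (r *: w) < +oo)%E) ->
  subdiff P s y w !=set0.
Proof.
move=> rp1 frp fr1.
have [q Hq] := convex_subgradient_ex (f := f) (fun r => L0 _) cf rp1 frp fr1.
by exists q => r r0; rewrite /= -f1; exact: Hq.
Qed.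

Lemma Du_subdiff : (lagrangian P s y w < +oo)%E -> has_Du P s y w ->
  subdiff P s y w (Du P s y w).
Proof.
move=> Lw [q Hq].
have -> : Du P s y w = q by rewrite /Du (cvg_lim _ Hq).
move=> r r0; rewrite -f1.
apply: (convex_derivative_subgradient (f := f) (fun r => L0 _) cf) => //.
  by rewrite f1.
rewrite f1; apply: cvg_trans Hq; apply: near_eq_cvg; near=> h.
by rewrite /Dquot /f scalerDl scale1r.
Unshelve. all: by end_near. Qed.

(* With [u = r *: w], this compares the cost [r * L s y (u / r)] of running
   along [u] with its speed divided by [r] to the cost [L s y u]. *)
Lemma subdiff_rescale (q r : R) : 0 < r -> (lagrangian P s y w < +oo)%E ->
  subdiff P s y w q ->
  (lagrangian P s y w * r%:E <= lagrangian P s y (r *: w) +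
    ((r - 1) * (fine (lagrangian P s y w) - q))%:E)%E.
Proof.
move=> r0 Lw /(_ r r0)/=.
have Lf : lagrangian P s y w = (fine (lagrangian P s y w))%:E.
  by rewrite fineK// ge0_fin_numE.
rewrite Lf; set a := fine _.
case: (lagrangian P s y (r *: w)) (L0 (r *: w)) => [x _|_|]//=.
  by rewrite -?EFinM -?EFinD -?EFinB !lee_fin => ?; lra.
by move=> _; rewrite leey.
Qed.

End radial_lagrangian.

(** * A Gronwall inequality *)

(* The continuous weight [a] splits [t, T] into [N] intervals of increment at most
   1/2, on each of which [f] at most doubles. *)
Lemma doubling_gronwall (R : realType) (f a : R -> R) (t T : R) (N : nat) :
  t <= T -> {within `[t, T], continuous f} -> {within `[t, T], continuous a} ->
  (forall s, s \in `[t, T] -> 0 <= f s) ->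
  (forall s1 s2, t <= s1 -> s1 <= s2 -> s2 <= T -> a s1 <= a s2) ->
  a t = 0 ->
  (forall s1 s2 M, t <= s1 -> s1 <= s2 -> s2 <= T ->
    (forall s, s1 <= s <= s2 -> f s <= M) -> f s2 <= f s1 + M * (a s2 - a s1)) ->
  a T <= N%:R / 2 ->
  forall s, s \in `[t, T] -> f s <= 2 ^+ N * f t.
Proof.
move=> tT cf ca f0 a_nd at0 Hf aT.
have step s0 s : t <= s0 -> s0 <= s -> s <= T -> a s - a s0 <= 2^-1 -> f s <= 2 * f s0.
  move=> ts0 s0s sT as_.
  have sub : `[s0, s] `<=` `[t, T].
    by move=> z /=; rewrite !in_itv/= => /andP[? ?]; rewrite (le_trans ts0)// (le_trans _ sT).
  (* At a maximum point [s1] of [f] on [[s0, s]], the hypothesis with [M = f s1] gives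
     [f s1 <= f s0 + f s1 / 2]. *)
  have [s1 + s1max] := EVT_max s0s (continuous_subspaceW sub cf).
  rewrite in_itv/= => /andP[s01 s1s].
  have fs : f s <= f s1 by apply: s1max; rewrite in_itv/= s0s lexx.
  have fs1 : f s1 <= f s0 + f s1 * (a s1 - a s0).
    apply: Hf => //; first exact: le_trans sT.
    move=> z /andP[z1 z2]; apply: s1max; rewrite in_itv/= z1.
    exact: le_trans s1s.
  have h1 : a s1 <= a s by apply: a_nd => //; exact: le_trans s01.
  have h2 : 0 <= f s1.
    by apply: f0; rewrite in_itv/= (le_trans ts0)//= (le_trans s1s).
  have : f s1 * (a s1 - a s0) <= f s1 * 2^-1 by rewrite ler_wpM2l//; lra.
  by lra.
have subT s : s <= T -> `[t, s] `<=` `[t, T].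
  by move=> sT z /=; rewrite !in_itv/= => /andP[-> zs]; exact: le_trans sT.
have ft0 : 0 <= f t by apply: f0; rewrite in_itv/= lexx.
have main j s : s \in `[t, T] -> a s <= j%:R / 2 -> f s <= 2 ^+ j * f t.
  elim: j s => [|j IH] s sI.
    rewrite mul0r expr0 mul1r => as0; move: (sI); rewrite in_itv/= => /andP[ts sT].
    have [s1 + s1max] := EVT_max ts (continuous_subspaceW (subT s sT) cf).
    rewrite in_itv/= => /andP[ts1 s1s].
    have fs : f s <= f s1 by apply: s1max; rewrite in_itv/= ts lexx.
    have fs1 : f s1 <= f t + f s1 * (a s1 - a t).
      apply: Hf => //; first exact: le_trans sT.
      move=> z /andP[z1 z2]; apply: s1max; rewrite in_itv/= z1.
      exact: le_trans s1s.
    have h1 : a s1 <= a s by apply: a_nd.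
    have h2 : 0 <= f s1.
      by apply: f0; rewrite in_itv/= ts1 (le_trans s1s).
    have : f s1 * (a s1 - a t) <= 0 by rewrite mulr_ge0_le0//; lra.
    by lra.
  move=> asj; have [|asj'] := leP (a s) (j%:R / 2).
    move=> /(IH _ sI) /le_trans; apply; rewrite ler_wpM2r//.
    by rewrite ler_weXn2l// ler1n.
  move: (sI); rewrite in_itv/= => /andP[ts sT].
  have ca' : {within `[t, s], continuous a}.
    exact: (continuous_subspaceW (subT s sT) ca).
  (* [s0] is a time at which the weight is exactly [j / 2]; between [s0] and [s] it grows by at most
     1/2, so one doubling suffices. *)
  have [|s0 + as0] := IVT (v := j%:R / 2) ts ca'.
    rewrite at0 ge_min divr_ge0//= le_max (ltW asj') orbT//.
  rewrite in_itv/= => /andP[ts0 s0s].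
  apply: le_trans (step s0 s ts0 s0s sT _) _.
    by rewrite as0; move: asj; rewrite -[in j.+1%:R]addn1 natrD; lra.
  rewrite exprS -mulrA ler_wpM2l//; apply: IH; last by rewrite as0.
  by rewrite in_itv/= ts0 (le_trans s0s).
move=> s sI; apply: main => //; apply: le_trans aT.
by move: sI; rewrite in_itv/= => /andP[? ?]; exact: a_nd.
Qed.

(** * Trajectories and a priori bounds *)

Lemma integrable_ae_eq d (T : measurableType d) (R : realType)
    (mu : {measure set T -> \bar R}) (D : set T) (f g : T -> \bar R) :
  measurable D -> measurable_fun D g -> mu.-integrable D f ->
  (\forall x \ae mu, D x -> f x = g x) -> mu.-integrable D g.
Proof.
move=> mD mg /integrableP[mf fi] fg; apply/integrableP; split => //.
rewrite (@ge0_ae_eq_integral _ _ _ mu D (fun x => `|g x|)%E (fun x => `|f x|)%E) => //.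
- exact: measurableT_comp.
- exact: measurableT_comp.
- by move: fg; apply: filterS => x /= fg /fg ->.
Qed.

Lemma Rintegral_ae_eq d (T : measurableType d) (R : realType)
    (mu : {measure set T -> \bar R}) (D : set T) (f g : T -> R) :
  measurable D -> measurable_fun D f -> measurable_fun D g ->
  (\forall x \ae mu, D x -> f x = g x) ->
  \int[mu]_(x in D) f x = \int[mu]_(x in D) g x.
Proof.
move=> mD mf mg fg; rewrite /Rintegral; congr fine.
apply: ae_eq_integral => //; try exact/measurable_EFinP.
by move: fg; apply: filterS => x /= fg /fg ->.
Qed.

Lemma ae_imply d (T : measurableType d) (R : realType)
    (mu : {measure set T -> \bar R}) (A B : T -> Prop) :
  (forall x, A x -> B x) -> (\forall x \ae mu, A x) -> \forall x \ae mu, B x.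
Proof. by move=> AB; apply: filterS. Qed.

Lemma ae_imply2 d (T : measurableType d) (R : realType)
    (mu : {measure set T -> \bar R}) (A B C : T -> Prop) :
  (forall x, A x -> B x -> C x) ->
  (\forall x \ae mu, A x) -> (\forall x \ae mu, B x) -> \forall x \ae mu, C x.
Proof. by move=> ABC; apply: filterS2. Qed.

Lemma ae_negl1 (R : realType) (t : R) : \forall s \ae leb R, s <> t.
Proof.
exists [set t]; split; first exact: borel_lmeasurable.
  exact: leb_set1.
by move=> s /= /contrapT.
Qed.

Lemma continuous_col (T : topologicalType) (R : realType) n (f : T -> 'cV[R]_n) x :
  (forall i, {for x, continuous (fun s => f s i 0)}) -> {for x, continuous f}.
Proof.
move=> cf; apply/cvg_ballP => e e0.
have : \forall z \near x, forall i, ball (f x i 0) e (f z i 0).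
  by apply: filter_forall => i; apply: (cvg_ball (cf i)).
by apply: filterS => z H; split=> // i j; rewrite ord1.
Qed.

Section velocity.
Context {R : realType} (n m : nat) (P : problem R n m).
Local Notation T := (horizon P).
Hypothesis hb : continuous (dynamics P).
Variable t : R.
Hypothesis tT : t <= T.

(** The extension by 0 lets every state be written as an integral over []-oo, s]], the form in which
    the time change is defined. *)
Definition velocity (y : R -> 'cV[R]_n) (u : R -> 'cV[R]_m) (s : R) : 'cV[R]_n :=
  if s \in `]t, T] then dynamics P (y s) *m u s else 0.

Lemma velocity_out y u s i : s \notin `]t, T] -> velocity y u s i 0 = 0.
Proof. by rewrite /velocity => /negPf ->; rewrite mxE. Qed.

(** Outside [[t, T]] the map [y] is arbitrary. Its continuous substitute [yc] on the whole line is
    what measurability and the Gronwall argument work with. *)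
Lemma W11_continuous (y v : R -> 'cV[R]_n) : W11_deriv t T y v ->
  exists2 yc : R -> 'cV[R]_n, continuous yc & forall s, s \in `[t, T] -> y s = yc s.
Proof.
move=> yv.
have vi i : (leb R).-integrable setT (EFin \o ((fun s => v s i 0) \_ `[t, T])).
  by rewrite -restrict_EFin; apply/(integrable_mkcond _ (lmeasurable_itv _)).1; exact: (yv i).1.
exists (fun s => \col_i (y t i 0 +
  \int[leb R]_(r in `]-oo, s]) ((fun s => v s i 0) \_ `[t, T]) r)).
  move=> s; apply: continuous_col => i.
  rewrite [X in {for _, continuous X}](_ : _ = (fun s => y t i 0 +
     \int[leb R]_(r in `]-oo, s]) ((fun s => v s i 0) \_ `[t, T]) r)); last first.
    by apply/funext => z; rewrite mxE.
  by apply: cvgD; [exact: cvg_cst|exact: (Rintegral_leb_continuous (vi i))].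
move=> s sI; apply/colP => i; rewrite mxE (yv i).2//; congr (_ + _).
rewrite [in RHS]Rintegral_mkcond [in LHS]Rintegral_mkcond; congr (Rintegral _ _ _).
apply/funext => r; rewrite !patchE !mem_setE /=.
move: sI; rewrite !in_itv/= => /andP[ts sT].
have [rs|rs]/= := leP r s; last by rewrite andbF.
by rewrite andbT (le_trans rs sT) andbT.
Qed.

Lemma dynamics_comp_measurable (y : R -> 'cV[R]_n) (u : R -> 'cV[R]_m) (yc : R -> 'cV[R]_n) :
  continuous yc -> (forall s, s \in `[t, T] -> y s = yc s) ->
  (forall j, lmeasurable_fun `[t, T] (fun s => u s j 0)) ->
  forall i, lmeasurable_fun `[t, T] (fun s => (dynamics P (y s) *m u s) i 0).
Proof.
move=> cyc yyc mu i.
apply: (@eq_measurable_fun _ _ (lebT R) R _ (fun s => \sum_j dynamics P (yc s) i j * u s j 0)).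
  by move=> s; rewrite inE => sI; rewrite mxE yyc.
apply: measurable_sum => j; apply: measurable_funM; last exact: mu.
apply: measurable_funTS; apply: (@borel_lmeasurable_fun R _ R).
apply: continuous_measurable_fun => s.
apply: (@continuous_comp _ _ _ yc (fun z => dynamics P z i j)); first exact: cyc.
apply: (@continuous_comp _ _ _ (dynamics P) (fun M => M i j)); first exact: hb.
exact: coord_continuous.
Qed.

(** The derivative [v], known only almost everywhere, is exchanged for the velocity that the
    dynamics prescribes. *)
Lemma W11_velocity (y v : R -> 'cV[R]_n) (u : R -> 'cV[R]_m) :
  W11_deriv t T y v ->
  (\forall s \ae leb R, s \in `[t, T] -> v s = dynamics P (y s) *m u s) ->
  (forall j, lmeasurable_fun `[t, T] (fun s => u s j 0)) ->
  forall i, (leb R).-integrable setT (fun s => (velocity y u s i 0)%:E) /\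
    forall s, s \in `[t, T] ->
      y s i 0 = y t i 0 + \int[leb R]_(r in `]-oo, s]) velocity y u r i 0.
Proof.
move=> yv vE mu i.
have [yc cyc yyc] := W11_continuous yv.
have mD : lmeasurable R `[t, T] by exact: lmeasurable_itv.
have mbu := dynamics_comp_measurable cyc yyc mu i.
have velE : (fun s => velocity y u s i 0) =
    (fun s => (dynamics P (y s) *m u s) i 0) \_ `]t, T].
  by apply/funext => s; rewrite patchE mem_setE /velocity; case: ifP => //; rewrite mxE.
have mvel : lmeasurable_fun setT (fun s => velocity y u s i 0).
  rewrite velE; apply/(measurable_restrictT _ (lmeasurable_itv _)).1.
  apply: measurable_funS mbu => //; exact: subset_itv_oc_cc.
have [vi yE] := yv i.
have aeE : \forall s \ae leb R, ((fun s => v s i 0) \_ `[t, T]) s = velocity y u s i 0.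
  move: vE (ae_negl1 t); apply: ae_imply2 => s vs st.
  rewrite patchE mem_setE /velocity; case: ifPn => sI.
    rewrite vs//; case: ifPn => // /negP; case.
    by move: sI; rewrite !in_itv/= lt_neqAle => /andP[-> ->]; rewrite eq_sym; move/eqP : st => ->.
  case: ifPn; last by rewrite mxE.
  by move=> /subset_itv_oc_cc; rewrite /= (negPf sI).
have vi' : (leb R).-integrable setT (EFin \o ((fun s => v s i 0) \_ `[t, T])).
  by rewrite -restrict_EFin; apply/(integrable_mkcond _ mD).1.
split.
  apply: (integrable_ae_eq measurableT _ vi'); first exact/measurable_EFinP.
  by move: aeE; apply: ae_imply => s /= ->.
move=> s sI; rewrite yE//; congr (_ + _).
transitivity (\int[leb R]_(r in `]-oo, s]) ((fun s => v s i 0) \_ `[t, T]) r).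
  rewrite [in RHS]Rintegral_mkcond [in LHS]Rintegral_mkcond; congr (Rintegral _ _ _).
  apply/funext => r; rewrite !patchE !mem_setE /=.
  move: sI; rewrite !in_itv/= => /andP[ts sT].
  have [rs|rs]/= := leP r s; last by rewrite andbF.
  by rewrite andbT (le_trans rs sT) andbT.
have mvi : lmeasurable_fun setT ((fun s => v s i 0) \_ `[t, T]).
  exact/measurable_EFinP/(measurable_int _ vi').
apply: Rintegral_ae_eq; first exact: lmeasurable_itv.
- exact: measurable_funS mvi.
- exact: measurable_funS mvel.
- by move: aeE; apply: ae_imply => r ->.
Qed.

Lemma velocity_W11 (y : R -> 'cV[R]_n) (u : R -> 'cV[R]_m) :
  (forall i, (leb R).-integrable setT (fun s => (velocity y u s i 0)%:E) /\
    forall s, s \in `[t, T] ->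
      y s i 0 = y t i 0 + \int[leb R]_(r in `]-oo, s]) velocity y u r i 0) ->
  exists2 v, W11_deriv t T y v &
    \forall s \ae leb R, s \in `[t, T] -> v s = dynamics P (y s) *m u s.
Proof.
move=> H; exists (velocity y u) => [i|].
  have [vi yE] := H i; split.
    by apply: (integrableS measurableT _ _ vi) => //; exact: lmeasurable_itv.
  move=> s sI; rewrite yE//; congr (_ + _).
  rewrite [in RHS]Rintegral_mkcond [in LHS]Rintegral_mkcond; congr (Rintegral _ _ _).
  apply/funext => r; rewrite !patchE !mem_setE /=.
  rewrite !in_itv/=; have [tr|rt]//= := leP t r.
  by rewrite velocity_out ?if_same// in_itv/= negb_and -leNgt (ltW rt).
move: (ae_negl1 t); apply: ae_imply => s st sI; rewrite /velocity ifT//.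
by move: sI; rewrite !in_itv/= lt_neqAle => /andP[-> ->]; rewrite eq_sym; move/eqP : st => ->.
Qed.

End velocity.

Lemma measurable_fun_pair_on d d1 d2 (T : measurableType d)
    (T1 : measurableType d1) (T2 : measurableType d2) (D : set T)
    (f : T -> T1) (g : T -> T2) :
  measurable D -> measurable_fun D f -> measurable_fun D g ->
  measurable_fun D (fun x => (f x, g x)).
Proof.
move=> mD mf mg; apply: (measurability _ (@measurable_prod_measurableType _ _ T1 T2)).
move=> _ [_ [A mA [B mB <-]] <-].
have -> : D `&` (fun x => (f x, g x)) @^-1` (A `*` B) =
    (D `&` f @^-1` A) `&` (D `&` g @^-1` B).
  by apply/seteqP; split => [z [Dz [? ?]]|z [[Dz ?] [_ ?]]].
by apply: measurableI; [exact: mf|exact: mg].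
Qed.

Section apriori.
Context {R : realType} (n m : nat) (P : problem R n m) (alpha d : R).
Hypothesis hP : basic_assumptions P alpha d.
Hypothesis hb : continuous (dynamics P).
Local Notation T := (horizon P).
Local Notation L := (lagrangian P).
Context (t : R) (x : 'cV[R]_n).
Hypothesis ht : 0 <= t < T.

Let tT : t <= T. Proof. by case/andP: ht => _ /ltW. Qed.
Let subT s : s \in `[t, T] -> s \in `[0, T].
Proof. by case/andP: ht => t0 _; rewrite !in_itv/= => /andP[ts ->]; rewrite (le_trans t0). Qed.
Let mD : lmeasurable R `[t, T]. Proof. exact: lmeasurable_itv. Qed.

Lemma feasible_control_meas y u : feasible P t x y u ->
  forall j, lmeasurable_fun `[t, T] (fun s => u s j 0).
Proof. by move=> [_ mu _ _ _] j; exact: measurable_col_coord mD mu j. Qed.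

Lemma feasible_continuous y u : feasible P t x y u ->
  exists2 yc : R -> 'cV[R]_n, continuous yc & forall s, s \in `[t, T] -> y s = yc s.
Proof. by move=> [[v yv _] _ _ _ _]; exact: W11_continuous yv. Qed.

Lemma feasible_state_meas y u : feasible P t x y u ->
  forall i, lmeasurable_fun `[t, T] (fun s => y s i 0).
Proof.
move=> /feasible_continuous[yc cyc yyc] i.
apply: (@eq_measurable_fun _ _ (lebT R) R _ (fun s => yc s i 0)).
  by move=> s; rewrite inE => sI; rewrite yyc.
apply: measurable_funTS; apply: (@borel_lmeasurable_fun R _ R).
apply: continuous_measurable_fun => s.
apply: (@continuous_comp _ _ _ yc (fun M => M i 0)); first exact: cyc.
exact: coord_continuous.
Qed.

Lemma feasible_velocity y u : feasible P t x y u ->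
  forall i, (leb R).-integrable setT (fun s => (velocity P t y u s i 0)%:E) /\
    forall s, s \in `[t, T] ->
      y s i 0 = x i 0 + \int[leb R]_(r in `]-oo, s]) velocity P t y u r i 0.
Proof.
move=> H; have mu := feasible_control_meas H.
by case: H => [[v yv vE] _ <- _ _]; exact: (W11_velocity hb yv vE).
Qed.

(** The time [tau] is separate from the parameter [s] because the cost is also considered with
    [psi s] as time argument and the new state and control at [s]. *)
Lemma lagrangian_comp_meas (D : set R) (tau : R -> R)
  (y : R -> 'cV[R]_n) (u : R -> 'cV[R]_m) : lmeasurable R D ->
  @measurable_fun _ _ (lebT R) (lebT R) D tau -> (forall s, D s -> tau s \in `[0, T]) ->
  (forall i, lmeasurable_fun D (fun s => y s i 0)) ->
  (forall j, lmeasurable_fun D (fun s => u s j 0)) ->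
  lmeasurable_fun D (fun s => L (tau s) (y s) (u s)).
Proof.
move=> mE mtau tauT my mu.
pose lbT := (lebT R * borel ('cV[R]_n * 'cV[R]_m)%type)%type.
have mpair : @measurable_fun _ _ (lebT R) lbT D (fun s => (tau s, (y s, u s))).
  exact: (measurable_fun_pair_on mE mtau (measurable_col_pair mE my mu)).
have mX : measurable (`[0, T] `*` setT : set lbT).
  by apply: measurableX; [exact: lmeasurable_itv|exact: measurableT].
apply: (measurable_comp mX _ (lagrangian_meas hP) mpair).
by move=> _ [s Ds <-]; split => //=; exact: tauT.
Qed.

Lemma lagrangian_traj_meas y u : feasible P t x y u ->
  lmeasurable_fun `[t, T] (fun s => L s (y s) (u s)).
Proof.
move=> H; apply: (lagrangian_comp_meas (tau := id) mD).
- by move=> _ A mA; exact: measurableI.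
- exact: subT.
- exact: feasible_state_meas H.
- exact: feasible_control_meas H.
Qed.

Lemma lagrangian_traj_ge0 (y : R -> 'cV[R]_n) (u : R -> 'cV[R]_m) s :
  s \in `[t, T] -> (0 <= L s (y s) (u s))%E.
Proof. by move=> /subT ?; apply: (lagrangian_ge0 hP). Qed.

Lemma endcost_traj_ge0 y u : feasible P t x y u -> (0 <= endcost P (y T))%E.
Proof.
move=> [_ _ _ _ Sy]; apply: (endcost_ge0 hP); apply: Sy.
by rewrite in_itv/= tT lexx.
Qed.

Lemma running_cost_le y u (B : \bar R) : feasible P t x y u ->
  (cost P t y u <= B)%E -> (\int[leb R]_(s in `[t, T]) L s (y s) (u s) <= B)%E.
Proof.
move=> H; apply: le_trans; rewrite /cost leeDl//; exact: endcost_traj_ge0 H.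
Qed.

(** Integrates [alpha |u| - d <= L]. The bound, later called [Cu], is [(T - t)] times the constant
    [cbound]. *)
Lemma control_integral y u (B : R) : feasible P t x y u -> (cost P t y u <= B%:E)%E ->
  (\int[leb R]_(s in `[t, T]) (enorm (u s))%:E <= ((B + d * (T - t)) / alpha)%:E)%E.
Proof.
move=> H HB.
have a0 := alpha_gt0 hP.
have mE : lmeasurable_fun `[t, T] (fun s => (enorm (u s))%:E).
  apply/measurable_EFinP/measurable_enorm; exact: feasible_control_meas H.
suff : (\int[leb R]_(s in `[t, T]) (alpha%:E * (enorm (u s))%:E) <= (B + d * (T - t))%:E)%E.
  rewrite ge0_integralZl_EFin//; last 2 first.
  - by move=> s _; rewrite lee_fin enorm_ge0.
  - exact: ltW.
  by rewrite -lee_pdivlMl// -EFinM mulrC.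
apply: (@le_trans _ _ (\int[leb R]_(s in `[t, T]) (L s (y s) (u s) + d%:E))%E).
  apply: (ae_ge0_le_integral mD).
  - by move=> s _; rewrite mule_ge0// lee_fin ?enorm_ge0// ltW.
  - exact: measurable_funeM.
  - by move=> s sI; rewrite adde_ge0 ?lee_fin ?(d_ge0 hP)//; exact: lagrangian_traj_ge0.
  - by apply: emeasurable_funD; [exact: lagrangian_traj_meas H|exact: measurable_cst].
  case: H => [_ _ _ Uu _].
  move: Uu (lagrangian_growth hP); apply: ae_imply2 => s Uu Lg sI.
  have := Lg (subT sI) (y s) (u s) (Uu sI).
  by rewrite EFinB leeBlDr// EFinM.
rewrite (ge0_integralD (leb R) mD); last 4 first.
- by move=> s sI; exact: lagrangian_traj_ge0.
- exact: lagrangian_traj_meas H.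
- by move=> s _; rewrite lee_fin (d_ge0 hP).
- exact: measurable_cst.
rewrite integral_cst; last exact: mD.
rewrite [X in (_ + _ * X)%E](leb_itvcc tT) -EFinM [leRHS]EFinD leeD//.
exact: running_cost_le H HB.
Qed.

(** The growth condition chooses its constants after [K], so one [K] has to serve all trajectories
    of cost at most [B]. The velocity is at most [theta (1 + |y|) |u|], and the cost controls the
    integral of [|u|]. *)
Lemma state_bound (B : R) : exists2 K : R, 0 <= K &
  forall y u, feasible P t x y u -> (cost P t y u <= B%:E)%E ->
  forall s, s \in `[t, T] -> enorm (y s) <= K.
Proof.
have [theta th0 Hth] := dynamics_growth hP.
pose C := (B + d * (T - t)) / alpha.
(* The Gronwall weight [a] below has total at most [n * theta * C], that is, at most [N] steps of
   1/2. *)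
pose N := Num.bound (2 * (n%:R * theta * C)).
pose f0 := 1 + \sum_(i < n) `|x i 0|.
exists (2 ^+ N * f0).
  by rewrite mulr_ge0 ?exprn_ge0// addr_ge0// sumr_ge0.
move=> y u H HB.
have [yc cyc yyc] := feasible_continuous H.
have Hv := feasible_velocity H.
pose eu := (fun s => enorm (u s)) \_ `]t, T].
have mD' : lmeasurable R `]t, T] by exact: lmeasurable_itv.
have mu : lmeasurable_fun `[t, T] (fun s => enorm (u s)).
  by apply: measurable_enorm; exact: feasible_control_meas H.
have ui : (leb R).-integrable `[t, T] (EFin \o (fun s => enorm (u s))).
  apply/integrableP; split; first exact/measurable_EFinP.
  under eq_integral do rewrite /= ger0_norm ?enorm_ge0//.
  exact: le_lt_trans (control_integral H HB) (ltry _).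
have eui : (leb R).-integrable setT (EFin \o eu).
  rewrite -restrict_EFin; apply/(integrable_mkcond _ mD').1.
  by apply: (integrableS mD mD' _ ui); exact: subset_itv_oc_cc.
have eu0 s : 0 <= eu s by rewrite /eu patchE; case: ifP => // _; exact: enorm_ge0.
pose a s := n%:R * theta * \int[leb R]_(r in `]-oo, s]) eu r.
(* The sum of absolute values dominates [enorm] and can be estimated coordinate by coordinate;
   adding the [n] estimates produces the factor [n] in [a]. *)
pose f s := 1 + \sum_(i < n) `|yc s i 0|.
have euC : \int[leb R]_s eu s <= C.
  have -> : \int[leb R]_s eu s = \int[leb R]_(s in `]t, T]) enorm (u s).
    by rewrite [RHS]Rintegral_mkcond.
  have ui' := integrableS mD mD' (@subset_itv_oc_cc _ _ t T) ui.
  rewrite -lee_fin /Rintegral fineK; last exact: (integrable_fin_num mD' ui').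
  apply: le_trans (control_integral H HB); apply: (ge0_subset_integral (leb R) mD' mD).
  - exact/measurable_EFinP.
  - by move=> s _; rewrite lee_fin enorm_ge0.
  - exact: subset_itv_oc_cc.
have aB s1 s2 : s1 <= s2 ->
    a s2 - a s1 = n%:R * theta * \int[leb R]_(r in `]s1, s2]) eu r.
  by move=> s12; rewrite /a (Rintegral_itvNy_split eui s12); ring.
have nth0 : 0 <= n%:R * theta by rewrite mulr_ge0.
suff main s : s \in `[t, T] -> f s <= 2 ^+ N * f t.
  move=> s sI; apply: le_trans (enorm_le_sum _) _.
  have ft : f t = f0.
    rewrite /f /f0 -yyc; last by rewrite in_itv/= lexx.
    by case: H => _ _ -> _ _.
  by have := main s sI; rewrite ft /f -yyc//; apply: le_trans; rewrite lerDr.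
apply: (doubling_gronwall (a := a) tT) => //.
- apply: continuous_subspaceT => z; apply: cvgD; first exact: cvg_cst.
  apply: cvg_big => [|i _]; first exact: add_continuous.
  apply: cvg_norm.
  apply: (@continuous_comp _ _ _ yc (fun M => M i 0)); first exact: cyc.
  exact: coord_continuous.
- apply: continuous_subspaceT => z; apply: cvgM; first exact: cvg_cst.
  exact: Rintegral_leb_continuous eui z.
- by move=> z _; rewrite addr_ge0// sumr_ge0.
- move=> s1 s2 _ s12 _; rewrite -subr_ge0 aB// mulr_ge0//.
  by apply: Rintegral_ge0 => r _; exact: eu0.
- rewrite /a (@eq_Rintegral _ _ _ _ _ (cst 0)) /=.
    by rewrite Rintegral_cst ?mul0r ?mulr0//; exact: lmeasurable_itv.
  move=> r; rewrite inE/= in_itv/= => rt.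
  by rewrite /eu patchE mem_setE in_itv/= ltNge rt.
- move=> s1 s2 M ts1 s12 s2T fM; rewrite aB//.
  have s1I : s1 \in `[t, T] by rewrite in_itv/= ts1 (le_trans s12).
  have s2I : s2 \in `[t, T] by rewrite in_itv/= s2T (le_trans ts1).
  have key i : `|yc s2 i 0| <= `|yc s1 i 0| + theta * M * \int[leb R]_(r in `]s1, s2]) eu r.
    have [vi yE] := Hv i.
    rewrite -!yyc// [in leLHS]yE// (Rintegral_itvNy_split vi s12) addrA -yE//.
    apply: le_trans (ler_normD _ _) _; rewrite lerD2l.
    have mI : lmeasurable R `]s1, s2] by exact: lmeasurable_itv.
    have vi' := integrable_leb vi mI.
    apply: le_trans (le_normr_Rintegral mI vi') _.
    rewrite -(RintegralZl _ mI (integrable_leb eui mI)).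
    apply: (le_Rintegral mI).
    - exact: (integrable_norm vi').
    - exact: (integrableZl mI _ (integrable_leb eui mI)).
    move=> r rI.
    have {}rI : s1 < r <= s2 by move: rI; rewrite /= in_itv.
    have rtT : r \in `]t, T].
      by case/andP: rI => sr rs; rewrite in_itv/= (le_lt_trans ts1)// (le_trans rs).
    have rtT' : r \in `[t, T] by apply: subset_itv_oc_cc.
    rewrite /velocity rtT /eu patchE mem_setE rtT.
    apply: le_trans (coord_le_enorm _ _) _; apply: le_trans (enorm_mulmx _ _) _.
    rewrite ler_wpM2r ?enorm_ge0//; apply: le_trans (Hth _) _.
    rewrite ler_wpM2l//; apply: le_trans (fM r _); last by case/andP: rI => /ltW -> ->.
    by rewrite /f lerD2l -yyc//; exact: enorm_le_sum.
  rewrite /f -addrA lerD2l.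
  apply: (@le_trans _ _ (\sum_(i < n) (`|yc s1 i 0| + theta * M * \int[leb R]_(r in `]s1, s2]) eu r))).
    by apply: ler_sum => i _.
  rewrite big_split/= lerD2l sumr_const card_ord -mulr_natl le_eqVlt.
  by apply/orP; left; apply/eqP; ring.
- have C0 : 0 <= C.
    by apply: le_trans euC; apply: Rintegral_ge0 => r _; exact: eu0.
  have aT : a T <= n%:R * theta * C.
    rewrite /a ler_wpM2l//; apply: le_trans euC.
    rewrite Rintegral_mkcond.
    rewrite (_ : eu \_ `]-oo, T] = eu)//.
    apply/funext => r; rewrite patchE mem_setE in_itv/=; case: ifPn => //.
    by rewrite -ltNge => Tr; rewrite /eu patchE mem_setE in_itv/= leNgt Tr andbF.
  have N0 : 0 <= 2 * (n%:R * theta * C).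
    by apply: mulr_ge0 => //; exact: mulr_ge0.
  rewrite ler_pdivlMr// mulrC; apply: le_trans (ltW (archi_boundP N0)).
  by rewrite ler_pM2l.
Qed.

End apriori.

(** * Trajectories after a time change *)

Lemma measurable_fun_inv_pos d (T : measurableType d) (R : realType) (D : set T)
    (f : T -> R) : (forall x, 0 < f x) -> measurable_fun D f ->
  measurable_fun D (fun x => (f x)^-1).
Proof.
move=> f0 mf.
rewrite (_ : (fun x => _) = (fun x => expR (- ln (f x)))); last first.
  by apply/funext => x; rewrite expRN lnK// posrE.
apply: (@measurableT_comp _ _ _ _ _ _ (@expR R)); first exact: measurable_expR.
apply: (@measurableT_comp _ _ _ _ _ _ (@GRing.opp R)); first exact: oppr_measurable.
apply: (@measurableT_comp _ _ _ _ _ _ (@ln R)) => //; exact: measurable_ln.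
Qed.

Section time_change_integral.
Context {R : realType} (t T : R) (rho phi psi : R -> R).
Hypothesis tc : time_change t T rho phi psi.
Local Notation phiK := (tc_phiK tc).
Local Notation psiK := (tc_psiK tc).
Local Notation change := (tc_change tc).
Let w0 r : 0 <= 1 + rho r. Proof. exact: ltW (tc_gt0 tc r). Qed.

Let mem_phi (D E : set R) s : (forall z, D z <-> E (phi z)) -> (phi s \in E) = (s \in D).
Proof. by move=> DE; apply/idP/idP; rewrite !inE => /DE. Qed.

Lemma ge0_integral_time_change (D E : set R) (f : R -> \bar R) :
  lmeasurable R D -> lmeasurable R E -> (forall z, D z <-> E (phi z)) ->
  lmeasurable_fun E f -> (forall s, E s -> 0 <= f s)%E ->
  (\int[leb R]_(s in E) f s = \int[leb R]_(s in D) (f (phi s) * (1 + rho s)%:E))%E.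
Proof.
move=> mD mE DE mf f0.
rewrite [LHS]integral_mkcond [RHS]integral_mkcond change.
- apply: eq_integral => s _; rewrite !patchE (mem_phi _ DE).
  by case: ifP => // _; rewrite mul0e.
- exact/(measurable_restrictT _ mE).1.
- by move=> s; rewrite patchE; case: ifPn => //; rewrite inE => /f0.
Qed.

Lemma integrable_time_change (f : R -> R) : lmeasurable_fun setT f ->
  (leb R).-integrable setT (fun s => (f (phi s) * (1 + rho s))%:E) ->
  (leb R).-integrable setT (EFin \o f).
Proof.
move=> mf /integrableP[_ fi]; apply/integrableP; split; first exact/measurable_EFinP.
rewrite change.
- apply: le_lt_trans fi; rewrite le_eqVlt; apply/orP; left; apply/eqP.
  apply: eq_integral => s _; rewrite /= -EFinM normrM; congr ((_ * _)%:E).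
  by rewrite ger0_norm.
- by apply/measurable_EFinP; exact: measurableT_comp.
- by move=> s; rewrite abse_ge0.
Qed.

Lemma Rintegral_time_change (f : R -> R) s : lmeasurable_fun setT f ->
  \int[leb R]_(r in `]-oo, s]) f r =
  \int[leb R]_(r in `]-oo, psi s]) (f (phi r) * (1 + rho r)).
Proof.
move=> mf; rewrite /Rintegral; congr fine.
rewrite [LHS]integralE [RHS]integralE.
have mI (z : R) : lmeasurable R `]-oo, z] by exact: lmeasurable_itv.
have DE z : `]-oo, psi s]%classic z <-> `]-oo, s]%classic (phi z).
  by rewrite /= !in_itv/= -(tc_phi_le tc z (psi s)) psiK.
have mEf : lmeasurable_fun `]-oo, s] (EFin \o f).
  by apply/measurable_EFinP; exact: measurable_funS mf.
congr (_ - _)%E.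
- rewrite (ge0_integral_time_change (mI _) (mI _) DE).
  + by apply: eq_integral => r _; rewrite !funeposE/= -EFin_max -EFinM maxr_pMl// mul0r EFin_max.
  + exact: measurable_funepos.
  + by move=> r _; exact: funepos_ge0.
- rewrite (ge0_integral_time_change (mI _) (mI _) DE).
  + apply: eq_integral => r _; rewrite !funenegE/= -EFin_max -EFinM maxr_pMl//.
    by rewrite mul0r mulNr EFin_max.
  + exact: measurable_funeneg.
  + by move=> r _; exact: funeneg_ge0.
Qed.

Lemma tc_psi_itv s : (psi s \in `[t, T]) = (s \in `[t, T]).
Proof.
rewrite !in_itv/= -[in X in X && _](tc_psi_left tc).
by rewrite -[in X in _ && X](tc_psi_right tc) !(tc_psi_le tc).
Qed.

Lemma tc_psi_itvoc s : (psi s \in `]t, T]) = (s \in `]t, T]).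
Proof.
rewrite !in_itv/= !ltNge -[in X in ~~ X && _](tc_psi_left tc).
by rewrite -[in X in _ && X](tc_psi_right tc) !(tc_psi_le tc).
Qed.

Lemma tc_phi_itv s : (phi s \in `[t, T]) = (s \in `[t, T]).
Proof. by rewrite -tc_psi_itv phiK. Qed.

Lemma measurable_comp_psi d (X : measurableType d) (f : R -> X) :
  @measurable_fun _ _ (lebT R) X `[t, T] f ->
  @measurable_fun _ _ (lebT R) X `[t, T] (f \o psi).
Proof.
move=> mf; apply: (@measurable_comp _ _ _ (lebT R) (lebT R) X `[t, T]) => //.
- exact: lmeasurable_itv.
- by move=> _ [s sI <-]; rewrite /= tc_psi_itv.
- exact: measurable_funTS (tc_psi_meas tc).
Qed.

End time_change_integral.

Section time_change_trajectory.
Context {R : realType} (n m : nat) (P : problem R n m) (alpha d : R).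
Hypothesis hP : basic_assumptions P alpha d.
Hypothesis hb : continuous (dynamics P).
Local Notation T := (horizon P).
Context (t : R) (x : 'cV[R]_n).
Hypothesis ht : 0 <= t < T.
Context (rho phi psi : R -> R).
Hypothesis tc : time_change t T rho phi psi.
Hypothesis mrho : lmeasurable_fun setT rho.
Let tT : t <= T. Proof. by case/andP: ht => _ /ltW. Qed.
Let mD : lmeasurable R `[t, T]. Proof. exact: lmeasurable_itv. Qed.

(** The derivative of [psi] is the inverse of [1 + rho (psi s)]. As the dynamics is linear in the
    control, this factor can be put on [u], and the cone property keeps the result in the control
    set. *)
Definition slowed (u : R -> 'cV[R]_m) (s : R) := (1 + rho (psi s))^-1 *: u (psi s).

Lemma feasible_time_change y u : feasible P t x y u ->
  feasible P t x (y \o psi) (slowed u).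
Proof.
move=> H; have mu := feasible_control_meas H.
have mw : lmeasurable_fun `[t, T] (fun s => (1 + rho s)^-1).
  apply: measurable_funTS; apply: measurable_fun_inv_pos; first exact: tc_gt0 tc.
  exact: measurable_funD.
have ms j : lmeasurable_fun `[t, T] (fun s => slowed u s j 0).
  rewrite (_ : (fun s => _) = (fun s => (1 + rho s)^-1 * u s j 0) \o psi); last first.
    by apply/funext => s; rewrite /slowed mxE.
  by apply: (measurable_comp_psi tc); exact: measurable_funM.
have velE s : velocity P t (y \o psi) (slowed u) s =
    (1 + rho (psi s))^-1 *: velocity P t y u (psi s).
  rewrite /velocity (tc_psi_itvoc tc) /slowed /=; case: ifP => _.
    by rewrite -scalemxAr.
  by rewrite scaler0.
have Hv := feasible_velocity hb H.
split.
- apply: velocity_W11 => i; have [vi yE] := Hv i.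
  have mv : lmeasurable_fun setT (fun s => velocity P t y u s i 0).
    by apply/measurable_EFinP; exact: measurable_int vi.
  have mv' : lmeasurable_fun setT (fun s => velocity P t (y \o psi) (slowed u) s i 0).
    rewrite (_ : (fun s => _) = (fun s => (1 + rho s)^-1 * velocity P t y u s i 0) \o psi).
      apply: (measurableT_comp _ (tc_psi_meas tc)); apply: measurable_funM; last exact: mv.
      apply: measurable_fun_inv_pos; first exact: tc_gt0 tc.
      exact: measurable_funD.
    by apply/funext => s; rewrite velE mxE.
  have vE s : velocity P t (y \o psi) (slowed u) (phi s) i 0 * (1 + rho s) =
      velocity P t y u s i 0.
    rewrite velE mxE (tc_phiK tc) mulrAC mulVf ?mul1r// gt_eqF//.
    exact: tc_gt0 tc s.
  split.
    apply: (integrable_time_change tc mv').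
    by under eq_fun do rewrite vE.
  move=> s sI; rewrite (Rintegral_time_change tc _ mv').
  under eq_Rintegral do rewrite vE.
  rewrite /= yE ?(tc_psi_itv tc)// (tc_psi_left tc).
  by case: H => _ _ -> _ _.
- exact: measurable_col.
- by case: H => _ _ yt _ _; rewrite /= (tc_psi_left tc).
- case: H => _ _ _ Uu _; move: (tc_ae_psi tc Uu); apply: ae_imply => s Us sI.
  apply: (controls_cone hP); first by apply: Us; rewrite (tc_psi_itv tc).
  by rewrite invr_gt0; exact: tc_gt0 tc _.
- by case: H => _ _ _ _ Sy s sI; apply: Sy; rewrite (tc_psi_itv tc).
Qed.

End time_change_trajectory.

(** * Growth condition and distance to the boundary *)

(** The supremum and the infimum in the growth condition may be infinite; a real threshold [xi]
    between them is all that the estimates use. *)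
Lemma ereal_gap_real (R : realType) (a b : \bar R) (c : R) :
  (a + c%:E < b)%E -> exists xi : R, (a <= xi%:E)%E /\ ((xi + c)%:E <= b)%E.
Proof.
case: a b => [a| |] [b| |] //=.
- by rewrite -EFinD lte_fin => h; exists a; split => //; rewrite lee_fin ltW.
- by move=> _; exists a; rewrite leey.
- by move=> _; exists (b - c); rewrite leNye subrK.
- by move=> _; exists 0; rewrite leNye leey.
Qed.

Section growth_slope.
Context {R : realType} (n m : nat) (P : problem R n m) (alpha d : R).
Hypothesis hP : basic_assumptions P alpha d.
Local Notation T := (horizon P).
Local Notation L := (lagrangian P).
Context (t : R) (ht : 0 <= t < T).
Hypothesis hLconvex : \forall s \ae leb R, s \in `[t, T] ->
  forall z : 'cV[R]_n, econvex (L s z).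
Context (kappa A : R) (gamma : R -> R) (B : R).
Hypothesis hH : growth_condition P alpha d kappa A gamma t B.
Local Notation PhiB := (Phi P alpha d kappa A gamma B).

Let subT s : s \in `[t, T] -> s \in `[0, T].
Proof. by case/andP: ht => t0 _; rewrite !in_itv/= => /andP[ts ->]; rewrite (le_trans t0). Qed.

(** The common form of the two alternatives of the growth condition. Where the ray through [w]
    continues inside the domain, convexity in the control yields a subgradient, and in the
    differentiable case the derivative is one. *)
Let def_slope (def : R -> 'cV[R]_n -> 'cV[R]_m -> Prop) (Q : R -> 'cV[R]_n -> 'cV[R]_m -> R) :=
  \forall s \ae leb R, s \in `[t, T] -> forall z w, Dom P (s, (z, w)) ->
    controls P w -> (exists2 rp : R, 1 < rp & (L s z (rp *: w) < +oo)%E) ->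
    def s z w /\ subdiff P s z w (Q s z w).

Let selection_slope Q : selection P Q ->
  def_slope (fun s y u => subdiff P s y u !=set0) Q.
Proof.
move=> sQ; move: hLconvex (Dom_radial hP); apply: ae_imply2 => s Lc Lr sI z w Dw Uw [rp rp1 Lrp].
suff ne : subdiff P s z w !=set0 by split => //; exact: sQ.
apply: (subdiff_ex _ (Lc sI z) rp1 Lrp).
  by move=> v; apply: (lagrangian_ge0 hP); exact: subT.
by move=> r r01; apply: (Lr (subT sI)) => //; exact: Dw.2.
Qed.

Let Du_slope : partial_differentiable P -> def_slope (has_Du P) (Du P).
Proof.
move=> pd; move: hLconvex pd; apply: ae_imply2 => s Lc pd sI z w Dw Uw _.
have hD : has_Du P s z w by apply: pd => //; [exact: subT|exact: Dw.2].
split => //; apply: Du_subdiff => //; [|exact: Lc|exact: Dw.2].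
by move=> v; apply: (lagrangian_ge0 hP); exact: subT.
Qed.

(** The order of the quantifiers matters: the distance [r] is chosen later from [c], and only [xi]
    may depend on it, as the infimum over [Fset K c r] does. *)
Lemma growth_slope (K : R) : 0 <= K -> exists nu c : R,
  [/\ 0 < nu, cbound P alpha d t B < c & forall r : R, 0 < r -> exists xi : R,
    \forall s \ae leb R, s \in `[t, T] -> forall z w, Dom P (s, (z, w)) ->
      controls P w -> enorm z <= K ->
      (exists2 rp : R, 1 < rp & (L s z (rp *: w) < +oo)%E) ->
      exists q, [/\ subdiff P s z w q,
        (nu <= enorm w -> fine (L s z w) - q <= xi) &
        (enorm w < c -> (r%:E <= Defs.dist (s, (z, w)) (bdDom P))%E ->
          xi + 2 * PhiB <= fine (L s z w) - q)]].
Proof.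
move=> K0; have [nu [c [nu0 cc Hgap]]] := hH K0.
have [def [Q [gap slope]]] : exists def Q, growth_gap P K nu c PhiB def Q /\ def_slope def Q.
  case: Hgap => [[_ [Q sQ gap]]|[pd gap]].
    by exists (fun s y u => subdiff P s y u !=set0), Q; split => //; exact: selection_slope.
  by exists (has_Du P), (Du P); split => //; exact: Du_slope.
exists nu, c; split => // r r0; have [xi [supxi infxi]] := ereal_gap_real (gap r r0).
exists xi; move: slope; apply: ae_imply => s slope sI z w Dw Uw zK rpw.
have [defw sub] := slope sI z w Dw Uw rpw.
have LE : (L s z w - (Q s z w)%:E)%E = (fine (L s z w) - Q s z w)%:E.
  rewrite EFinB fineK// ge0_fin_numE; first exact: Dw.2.
  by apply: (lagrangian_ge0 hP); exact: subT.
exists (Q s z w); split => // [nuw|wc rdist].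
- rewrite -lee_fin -LE; apply: le_trans supxi; apply: ereal_sup_ubound.
  by exists (s, (z, w)).
- rewrite -lee_fin -LE; apply: le_trans infxi _; apply: ereal_inf_lbound.
  by exists (s, (z, w)).
Qed.

End growth_slope.

Section domain.
Context {R : realType} (n m : nat) (P : problem R n m).
Local Notation T := (horizon P).
Variables (s : R) (y : 'cV[R]_n) (u : 'cV[R]_m) (r : R).
Hypothesis sT : s \in `[0, T].
Hypothesis Ds : Dom P (s, (y, u)).
Hypothesis r0 : 0 < r.
Hypothesis far : ((4 * r)%:E <= Defs.dist (s, (y, u)) (bdDom P))%E.

Let far_bd q : bdDom P q -> 4 * r <= Defs.edist (s, (y, u)) q.
Proof.
move=> bq; rewrite -lee_fin; apply: le_trans far _; apply: ereal_inf_lbound.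
by exists q.
Qed.

Let ray (a : R) : Defs.point R n m := (s, (y, a *: u)).

Let ray_close a V : nbhs (ray a) V -> exists2 e : R, 0 < e &
  forall b, `|a - b| < e -> V (ray b).
Proof.
move=> /nbhs_ballP[e /= e0 Ve].
have u1 : 0 < 1 + enorm u by rewrite ltr_pwDl// enorm_ge0.
exists (e / (1 + enorm u)); first by rewrite divr_gt0.
move=> b ab; apply: Ve; split; first exact: ballxx.
split; first exact: ballxx.
split => // i j; rewrite ord1 -ball_normE /ball_/= !mxE -mulrBl normrM.
apply: (@le_lt_trans _ _ (`|a - b| * (1 + enorm u))); last by rewrite -ltr_pdivlMr.
rewrite ler_wpM2l//; apply: le_trans (coord_le_enorm u i) _.
by rewrite lerDr.
Qed.

(** If the ray left the domain before [a], the supremum of its parameters in the domain would give a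
    boundary point at distance at most [r], against [far]. *)
Lemma Dom_ray (a : R) : 1 <= a -> (a - 1) * enorm u <= r ->
  Dom P (s, (y, a *: u)).
Proof.
move=> a1 ar; apply: contrapT => nDa.
pose E := [set b : R | 1 <= b <= a /\ Dom P (ray b)].
have E1 : E 1 by split; [rewrite lexx a1|rewrite /ray scale1r].
have hE : has_sup E.
  by split; [exists 1|exists a => b [/andP[_ ->]]].
pose c := sup E.
have c1 : 1 <= c by apply: ub_le_sup => //; case: hE.
have ca : c <= a by apply: sup_le_ub; [exists 1|move=> b [/andP[_ ->]]].
have clD : closure (Dom P) (ray c).
  move=> V /ray_close[e e0 Ve].
  have [b Eb cb] := sup_adherent e0 hE.
  exists (ray b); split; first by case: Eb.
  apply: Ve; rewrite ger0_norm; first by rewrite ltrBlDr -ltrBlDl.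
  by rewrite subr_ge0; apply: ub_le_sup => //; case: hE.
have clC : closure ((`[0, T] `*` setT) `\` Dom P) (ray c).
  have [Dc|nDc] := pselect (Dom P (ray c)); last first.
    by apply: subset_closure; split.
  have {}ca : c < a.
    by rewrite lt_neqAle ca andbT; apply/eqP => cE; apply: nDa; rewrite -cE.
  move=> V /ray_close[e e0 Ve].
  (* A parameter in []c, a]] close to [c]: being beyond the supremum, it is outside the domain, so
     [ray c] is also a limit of points of the complement. *)
  pose b := Num.min a (c + e / 2).
  have cb : c < b by rewrite /b lt_min ca ltrDl divr_gt0.
  have ba : b <= a by rewrite /b ge_min lexx.
  exists (ray b); split.
    split; first by split.
    move=> Db; have : b <= c.
      apply: ub_le_sup; first by case: hE.
      by split => //; rewrite ba andbT (le_trans c1)// ltW.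
    by rewrite leNgt cb.
  apply: Ve; rewrite distrC ger0_norm; last by rewrite subr_ge0 ltW.
  have : b <= c + e / 2 by rewrite /b ge_min lexx orbT.
  by lra.
have := far_bd (conj clD clC).
rewrite edist_radial distrC ger0_norm ?subr_ge0//.
have : (c - 1) * enorm u <= (a - 1) * enorm u.
  by rewrite ler_wpM2r ?enorm_ge0// lerB.
move=> h1 h2; have := le_trans h2 (le_trans h1 ar).
by rewrite -subr_ge0 (_ : r - 4 * r = - (3 * r)); [rewrite oppr_ge0 leNgt mulr_gt0|ring].
Qed.

Lemma dist_ray (a : R) : 1 <= a -> (a - 1) * enorm u <= r ->
  (r%:E <= Defs.dist (s, (y, a *: u)) (bdDom P))%E.
Proof.
move=> a1 ar; apply: le_ereal_inf_tmp => _ [q bq <-]; rewrite lee_fin.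
apply: (edist_shift r0 (far_bd bq)).
by rewrite edist_radial distrC ger0_norm ?subr_ge0.
Qed.

End domain.

(** * Cost of a time change *)

Lemma markov_integral d (T : measurableType d) (R : realType)
    (mu : {measure set T -> \bar R}) (D : set T) (f : T -> \bar R) (a : R) :
  measurable D -> measurable_fun D f -> (forall x, D x -> 0 <= f x)%E -> 0 <= a ->
  (a%:E * mu (D `&` [set x | a%:E <= f x]) <= \int[mu]_(x in D) f x)%E.
Proof.
move=> mD mf f0 a0.
have mE : measurable (D `&` [set x | a%:E <= f x]%E).
  by have := mf mD _ (emeasurable_itv `[a%:E, +oo[); rewrite preimage_itvcy.
rewrite -(@integral_cst _ _ _ mu _ mE).
apply: (@le_trans _ _ (\int[mu]_(x in D `&` [set x | a%:E <= f x]%E) f x)%E).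
  apply: ge0_le_integral => //.
  - exact: measurable_funS mf.
  - by move=> x [].
by apply: ge0_subset_integral => //; exact: subIsetl.
Qed.

(** With [xi = a1 - a2], the pointwise inequality says that [F1] exceeds [F2] by at most
    [xi p - (xi + k) g]. Since [p] and [g] have the same integral, [xi] cancels and the gain
    [k * delta] remains. Splitting [xi] keeps all integrands nonnegative. *)
Lemma integral_trade_off d (T : measurableType d) (R : realType)
    (mu : {measure set T -> \bar R}) (D : set T) (F1 F2 : T -> \bar R)
    (p g : T -> R) (a1 a2 k delta : R) :
  measurable D -> measurable_fun D F1 -> measurable_fun D F2 ->
  measurable_fun D p -> measurable_fun D g ->
  (forall x, D x -> 0 <= F1 x)%E -> (forall x, D x -> 0 <= F2 x)%E ->
  (forall x, D x -> 0 <= p x) -> (forall x, D x -> 0 <= g x) ->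
  0 <= a1 -> 0 <= a2 -> 0 <= k ->
  (\int[mu]_(x in D) (p x)%:E = delta%:E)%E -> (\int[mu]_(x in D) (g x)%:E = delta%:E)%E ->
  (\forall x \ae mu, D x ->
    F1 x + ((k + a1) * g x + a2 * p x)%:E <= F2 x + (a1 * p x + a2 * g x)%:E)%E ->
  (\int[mu]_(x in D) F1 x + (k * delta)%:E <= \int[mu]_(x in D) F2 x)%E.
Proof.
move=> mD mF1 mF2 mp mg F10 F20 p0 g0 a10 a20 k0 pd gd ineq.
have comb b1 b2 : 0 <= b1 -> 0 <= b2 ->
    (\int[mu]_(x in D) (b1 * p x + b2 * g x)%:E = ((b1 + b2) * delta)%:E)%E.
  move=> b10 b20; under eq_integral do rewrite EFinD.
  have t1 b (f : T -> R) : 0 <= b -> (forall x, D x -> 0 <= f x) ->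
      forall x, D x -> (0 <= (b * f x)%:E)%E.
    by move=> b0 f0 x Dx; rewrite lee_fin mulr_ge0// f0.
  have t2 b (f : T -> R) : measurable_fun D f -> measurable_fun D (fun x => (b * f x)%:E).
    by move=> mf; apply/measurable_EFinP; exact: measurable_funM.
  rewrite (ge0_integralD _ mD (t1 _ _ b10 p0) (t2 _ _ mp) (t1 _ _ b20 g0) (t2 _ _ mg)).
  have t3 b (f : T -> R) : 0 <= b -> measurable_fun D f -> (forall x, D x -> 0 <= f x) ->
      (\int[mu]_(x in D) (b * f x)%:E = b%:E * \int[mu]_(x in D) (f x)%:E)%E.
    move=> b0 mf f0; under eq_integral do rewrite EFinM.
    rewrite ge0_integralZl_EFin//; exact/measurable_EFinP.
  rewrite !t3//.
  by rewrite pd gd -!EFinM -EFinD mulrDl.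
have mc b1 b2 : measurable_fun D (fun x => (b1 * p x + b2 * g x)%:E).
  by apply/measurable_EFinP; apply: measurable_funD; exact: measurable_funM.
have c0 b1 b2 x : 0 <= b1 -> 0 <= b2 -> D x -> (0 <= (b1 * p x + b2 * g x)%:E)%E.
  by move=> b10 b20 Dx; rewrite lee_fin addr_ge0// mulr_ge0// ?p0 ?g0.
have ka : 0 <= k + a1 by rewrite addr_ge0.
have : (\int[mu]_(x in D) (F1 x + (a2 * p x + (k + a1) * g x)%:E) <=
        \int[mu]_(x in D) (F2 x + (a1 * p x + a2 * g x)%:E))%E.
  apply: ae_ge0_le_integral => //.
  - by move=> x Dx; rewrite adde_ge0 ?F10 ?c0.
  - by apply: emeasurable_funD => //; exact: mc.
  - by move=> x Dx; rewrite adde_ge0 ?F20 ?c0.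
  - by apply: emeasurable_funD => //; exact: mc.
  - by move: ineq; apply: filterS => x H Dx; rewrite (addrC (a2 * p x)); exact: H.
rewrite !ge0_integralD//; try exact: mc; try (by move=> x Dx; exact: c0).
rewrite !comb//.
have -> : (a2 + (k + a1)) * delta = k * delta + (a1 + a2) * delta by ring.
by rewrite EFinD addeA leeD2rE.
Qed.

(** Integrates the estimate of Condition (S) for a time shift of at most [delta]; it is used with
    [1 - k * delta] in the place of [k]. *)
Lemma integral_shift_bound d (T : measurableType d) (R : realType)
    (mu : {measure set T -> \bar R}) (D : set T) (F F1 : T -> \bar R)
    (e g : T -> R) (k A delta : R) :
  measurable D -> measurable_fun D F -> measurable_fun D F1 ->
  measurable_fun D e -> measurable_fun D g ->
  (forall x, D x -> 0 <= F x)%E -> (forall x, D x -> 0 <= F1 x)%E ->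
  (forall x, D x -> 0 <= e x) -> (forall x, D x -> 0 <= g x) ->
  0 <= k -> 0 <= A -> 0 <= delta ->
  (\forall x \ae mu, D x -> k%:E * F x <= F1 x + (delta * (A * e x + g x))%:E)%E ->
  (k%:E * \int[mu]_(x in D) F x <= \int[mu]_(x in D) F1 x +
    delta%:E * (A%:E * \int[mu]_(x in D) (e x)%:E + \int[mu]_(x in D) (g x)%:E))%E.
Proof.
move=> mD mF mF1 me mg F0 F10 e0 g0 k0 A0 d0 ineq.
have mEe : measurable_fun D (fun x => (e x)%:E) by exact/measurable_EFinP.
have mEg : measurable_fun D (fun x => (g x)%:E) by exact/measurable_EFinP.
have Ee0 x : D x -> (0 <= (e x)%:E)%E by move=> Dx; rewrite lee_fin e0.
have Eg0 x : D x -> (0 <= (g x)%:E)%E by move=> Dx; rewrite lee_fin g0.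
rewrite -!ge0_integralZl_EFin// -ge0_integralD//; last 2 first.
- by move=> x Dx; rewrite mule_ge0 ?lee_fin// e0.
- exact: measurable_funeM.
rewrite -ge0_integralZl_EFin//; last 2 first.
- by move=> x Dx; rewrite adde_ge0 ?mule_ge0 ?lee_fin ?e0 ?g0.
- by apply: emeasurable_funD => //; exact: measurable_funeM.
rewrite -ge0_integralD//; last 2 first.
- by move=> x Dx; rewrite mule_ge0 ?adde_ge0 ?mule_ge0 ?lee_fin ?e0 ?g0.
- by apply: measurable_funeM; apply: emeasurable_funD => //; exact: measurable_funeM.
apply: ae_ge0_le_integral => //.
- by move=> x Dx; rewrite mule_ge0 ?lee_fin ?F0.
- exact: measurable_funeM.
- by move=> x Dx; rewrite adde_ge0 ?F10 ?mule_ge0 ?adde_ge0 ?mule_ge0 ?lee_fin ?e0 ?g0.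
- apply: emeasurable_funD => //; apply: measurable_funeM.
  by apply: emeasurable_funD => //; exact: measurable_funeM.
Qed.

Lemma leeD_shift (R : realType) (X Y : \bar R) (e a b : R) :
  (X <= Y + e%:E)%E -> e + a <= b -> (X + a%:E <= Y + b%:E)%E.
Proof.
move=> XY eab; apply: (@le_trans _ _ (Y + e%:E + a%:E)%E); first exact: leeD2r.
by rewrite -addeA -EFinD leeD2l// lee_fin.
Qed.

Section pointwise.
Context {R : realType} (n m : nat) (P : problem R n m).
Local Notation T := (horizon P).
Local Notation L := (lagrangian P).
Variables (s : R) (z : 'cV[R]_n) (u : 'cV[R]_m) (xi k nu c r : R).
Hypothesis sT : s \in `[0, T].
Hypothesis L0 : forall v, (0 <= L s z v)%E.
Hypothesis Lr : forall v (b : R), (L s z v < +oo)%E -> 0 < b <= 1 -> (L s z (b *: v) < +oo)%E.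
Hypothesis Ucone : forall v (b : R), controls P v -> 0 < b -> controls P (b *: v).
Hypothesis slope : forall w, Dom P (s, (z, w)) -> controls P w ->
  (exists2 rp : R, 1 < rp & (L s z (rp *: w) < +oo)%E) ->
  exists q, [/\ subdiff P s z w q, (nu <= enorm w -> fine (L s z w) - q <= xi) &
    (enorm w < c -> (r%:E <= Defs.dist (s, (z, w)) (bdDom P))%E ->
      xi + k <= fine (L s z w) - q)].
Hypothesis Uu : controls P u.

(** The slowed control still has norm at least [nu], so the upper threshold [xi] applies to it;
    multiplying it by [1 + p] returns [u], which is the point of the ray beyond it. *)
Lemma slow_pointwise (p : R) : 0 <= p -> nu * (1 + p) <= enorm u ->
  (L s z ((1 + p)^-1 *: u) * (1 + p)%:E <= L s z u + (xi * p)%:E)%E.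
Proof.
move=> p0 pu; have [->|pN0] := eqVneq p 0.
  by rewrite addr0 invr1 scale1r mule1 mulr0 adde0.
have {p0 pN0}p0 : 0 < p by rewrite lt_neqAle eq_sym pN0.
have p1 : 0 < 1 + p by rewrite ltr_pwDl// ltW.
have [Lu|] := ltP (L s z u) +oo%E; last by rewrite leye_eq => /eqP ->; rewrite addye// leey.
set w := (1 + p)^-1 *: u.
have uw : (1 + p) *: w = u by rewrite /w scalerA mulfV ?scale1r// gt_eqF.
have Lw : (L s z w < +oo)%E.
  by apply: Lr => //; rewrite invr_gt0 p1 invf_le1// lerDl ltW.
have [|||q [sub h _]] := @slope w.
- by split.
- by apply: Ucone; rewrite ?invr_gt0.
- by exists (1 + p); rewrite ?uw// ltrDl.
have wnu : nu <= enorm w.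
  by rewrite /w enormZ gtr0_norm ?invr_gt0// mulrC ler_pdivlMr.
have := subdiff_rescale L0 p1 Lw sub.
rewrite uw addrAC subrr add0r => /le_trans; apply.
by rewrite leeD2l// lee_fin mulrC ler_wpM2r ?(ltW p0)// h.
Qed.

(** The accelerated control [w] remains below [c] and at distance [r] from the boundary, so the
    lower threshold applies. Because [a0 (1 - eta) > 1], the point [a0 *: u] of the domain lies
    strictly beyond [w] on its ray, as a subgradient at [w] requires. *)
Lemma fast_pointwise (a0 eta : R) : 0 <= eta -> a0^-1 < 1 - eta -> 1 <= a0 -> 0 < r ->
  (L s z u < +oo)%E -> ((4 * r)%:E <= Defs.dist (s, (z, u)) (bdDom P))%E ->
  (a0 - 1) * enorm u <= r -> a0 * enorm u < c ->
  (L s z ((1 - eta)^-1 *: u) * (1 - eta)%:E <= L s z u + (- (eta * (xi + k)))%:E)%E.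
Proof.
move=> e0 ea0 a01 r0 Lu far ar ac; have [->|eN0] := eqVneq eta 0.
  by rewrite subr0 invr1 scale1r mule1 mul0r oppr0 adde0.
have a0_gt0 : 0 < a0 by rewrite (lt_le_trans ltr01).
have e1 : 0 < 1 - eta by apply: lt_trans ea0; rewrite invr_gt0.
set w := (1 - eta)^-1 *: u.
have uw : (1 - eta) *: w = u by rewrite /w scalerA mulfV ?scale1r// gt_eqF.
set a := (1 - eta)^-1.
have a1 : 1 <= a by rewrite /a invf_ge1// gerBl.
have aa0 : a <= a0 by rewrite /a invf_ple ?posrE// ltW.
have ar' : (a - 1) * enorm u <= r.
  by apply: le_trans ar; rewrite ler_wpM2r ?enorm_ge0// lerB.
have Du : Dom P (s, (z, u)) by split.
have Dw : Dom P (s, (z, w)) := Dom_ray sT Du r0 far a1 ar'.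
have Da0 : Dom P (s, (z, a0 *: u)) := Dom_ray sT Du r0 far a01 ar.
have [|||q [sub _ h]] := @slope w.
- exact: Dw.
- by apply: Ucone; rewrite ?invr_gt0.
- exists (a0 * (1 - eta)); first by rewrite mulrC -ltr_pdivrMr// div1r.
  by rewrite -scalerA uw; exact: Da0.2.
have wc : enorm w < c.
  rewrite /w enormZ gtr0_norm ?invr_gt0//; apply: le_lt_trans ac.
  by rewrite ler_wpM2r// enorm_ge0.
have := subdiff_rescale L0 e1 Dw.2 sub.
rewrite /= uw addrAC subrr add0r => /le_trans; apply.
rewrite leeD2l// lee_fin mulNr lerN2 ler_wpM2l// h//.
exact: (dist_ray r0 far a1 ar').
Qed.

End pointwise.

Lemma le_Rintegral_subset d (T : measurableType d) (R : realType)
    (mu : {measure set T -> \bar R}) (A B : set T) (f : T -> R) :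
  measurable A -> measurable B -> A `<=` B -> (forall x, 0 <= f x) ->
  mu.-integrable B (EFin \o f) ->
  \int[mu]_(x in A) f x <= \int[mu]_(x in B) f x.
Proof.
move=> mA mB AB f0 fi; rewrite /Rintegral fine_le//.
- by apply: integrable_fin_num => //; exact: (integrableS mB).
- exact: integrable_fin_num.
- apply: ge0_subset_integral => //; first exact: measurable_int fi.
  by move=> x _; rewrite lee_fin.
Qed.

Lemma measurable_fun_normr d (T : measurableType d) (R : realType) (D : set T)
    (f : T -> R) : measurable_fun D f -> measurable_fun D (fun x => `|f x|).
Proof. by move=> mf; exact: measurableT_comp. Qed.

(** [I] is the old running cost, [X] the new one, and [Y] the new one with shifted time argument. If
    [X] were replaced by [I], the loss would be [delta (k I + A E + G) <= delta Phi], which the gap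
    of at least [2 Phi delta] between [Y] and [I] covers. The bound on [k * delta] keeps the factor
    of [X] positive. *)
Lemma cost_comparison (R : realType) (X Y I E G : \bar R)
    (k A Phi delta Gam Cu B : R) :
  (0 <= X)%E -> (0 <= Y)%E -> (I <= B%:E)%E ->
  (Y + (2 * Phi * delta)%:E <= I)%E ->
  ((1 - k * delta)%:E * X <= Y + delta%:E * (A%:E * E + G))%E ->
  (0 <= E)%E -> (E <= Cu%:E)%E -> (0 <= G)%E -> (G <= Gam%:E)%E ->
  k * B + A * Cu + Gam <= Phi -> 0 <= Phi -> 0 <= delta -> k * delta <= 2^-1 ->
  0 <= k -> 0 <= A -> (X <= I)%E.
Proof.
move=> X0 Y0 IB YI XY E0 EC G0 GG kP P0 d0 kd k0 A0.
have Yf : Y \is a fin_num.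
  rewrite ge0_fin_numE//; apply: le_lt_trans (ltry B); apply: le_trans IB.
  by apply: le_trans YI; rewrite leeDl// lee_fin !mulr_ge0.
have If : I \is a fin_num.
  rewrite ge0_fin_numE; first exact: le_lt_trans IB (ltry _).
  by apply: le_trans YI; rewrite adde_ge0// lee_fin !mulr_ge0.
have Ef : E \is a fin_num by rewrite ge0_fin_numE// (le_lt_trans EC) ?ltry.
have Gf : G \is a fin_num by rewrite ge0_fin_numE// (le_lt_trans GG) ?ltry.
have k1 : 0 < 1 - k * delta.
  by rewrite subr_gt0 (le_lt_trans kd)// invf_lt1 ?ltr1n.
move: If Yf Ef Gf IB YI XY E0 EC G0 GG.
move=> /fineK <- /fineK <- /fineK <- /fineK <-.
move: (fine I) (fine Y) (fine E) (fine G) => i y e g.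
rewrite -?EFinM -?EFinD -?EFinM -?EFinD !lee_fin => iB yi XY e0 eC g0 gG.
have Xf : X \is a fin_num.
  rewrite ge0_fin_numE// ltNge; apply/negP; rewrite leye_eq => /eqP XE.
  by move: XY; rewrite XE gt0_muley ?lte_fin// leye_eq.
move: XY; rewrite -(fineK Xf) -EFinM !lee_fin; move: (fine X) => X' XY.
rewrite -(ler_pM2l k1); apply: le_trans XY _.
have h1 : A * e + g <= Phi - k * B.
  have : A * e <= A * Cu by rewrite ler_wpM2l.
  by move: gG kP; clear; lra.
have h2 : delta * (A * e + g) <= delta * (Phi - k * B) by rewrite ler_wpM2l.
have h3 : k * delta * i <= k * delta * B by rewrite ler_wpM2l// mulr_ge0.
have h4 : 0 <= Phi * delta by rewrite mulr_ge0.
by move: yi h2 h3 h4; clear; rewrite !mulrBr !mulrBl; lra.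
Qed.

(** * Consequences of (h1), (h2) and Condition (S) *)

Section distance_level.
Context {R : realType} (n m : nat) (P : problem R n m).
Hypothesis hDom : ~ real_valued P -> h1 P /\ h2 P.

Lemma dist_level (l : R) : 0 < l -> exists2 r : R, 0 < r &
  forall s z w, Dom P (s, (z, w)) -> controls P w ->
    (lagrangian P s z w <= l%:E)%E ->
    ((4 * r)%:E <= Defs.dist (s, (z, w)) (bdDom P))%E.
Proof.
move=> l0; have [rv|/hDom[_ /(_ (l + 1))]] := pselect (real_valued P).
  exists 1 => // s z w _ _ _; rewrite /Defs.dist.
  have -> : bdDom P = set0 by rewrite /bdDom rv setDv closure0 setI0.
  by rewrite image_set0 ereal_inf0 leey.
(* The level [l + 1] turns the weak inequality of (h2) into a contradiction with cost at most [l];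
   dividing by 4 below prepares for displacements of size [r]. *)
move=> [|r r0 H]; first by rewrite addr_gt0.
exists (r / 4); first by rewrite divr_gt0.
move=> s z w Dw Uw Ll; rewrite mulrCA divff// mulr1 leNgt; apply/negP => far.
by have := le_trans (H _ Dw Uw far) Ll; rewrite lee_fin gerDl ler10.
Qed.

(** Condition (S) compares two times at which the lagrangian is finite; finiteness known at [psi s]
    must therefore carry over to [s]. *)
Lemma Dom_shift s1 s2 z w : s2 \in `[0, horizon P] ->
  Dom P (s1, (z, w)) -> Dom P (s2, (z, w)).
Proof.
move=> s2T; have [rv|/hDom[[D DE] _]] := pselect (real_valued P).
  by rewrite rv => _; split.
by rewrite DE => -[_ /= Dzw]; split.
Qed.

End distance_level.

Section time_regularity.
Context {R : realType} (n m : nat) (P : problem R n m) (alpha d : R).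
Hypothesis hP : basic_assumptions P alpha d.
Local Notation T := (horizon P).
Local Notation L := (lagrangian P).
Context (kappa A : R) (gamma : R -> R) (eps : R).
Hypothesis hS : condS P kappa A gamma eps.
Context (t : R) (ht : 0 <= t < T) (B : R) (B0 : 0 <= B).

Let fin s z w : Dom P (s, (z, w)) -> L s z w = (fine (L s z w))%:E.
Proof.
move=> Dw; rewrite fineK// ge0_fin_numE; first exact: Dw.2.
by apply: (lagrangian_ge0 hP); exact: Dw.1.
Qed.

(** The constants are quantified anew because [Phi] is 0 in the autonomous case, where those of
    Condition (S) have to be replaced by 0. *)
Lemma time_regularity : exists (k A' Gam : R) (g : R -> R),
  [/\ 0 <= k <= kappa, 0 <= A', k * B + A' * ((B + d * (T - t)) / alpha) + Gam <= Phi P alpha d kappa A gamma B,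
    (lmeasurable_fun `[t, T] g /\ forall s, 0 <= g s) &
    (\int[leb R]_(s in `[t, T]) (g s)%:E <= Gam%:E)%E /\
    \forall s \ae leb R, s \in `[0, T] -> forall s2 z w, s2 \in `[0, T] ->
      `|s2 - s| <= eps -> controls P w -> Dom P (s, (z, w)) -> Dom P (s2, (z, w)) ->
      fine (L s z w) <= fine (L s2 z w) +
        (k * fine (L s z w) + A' * enorm w + g s) * `|s2 - s|].
Proof.
case: hS => k0 A0 e0 gi Hs; rewrite /Phi; case: asboolP => [aut|_].
  exists 0, 0, 0, (cst 0); split.
  - by rewrite lexx k0.
  - by [].
  - by rewrite !mul0r !addr0.
  - by split; [exact: measurable_cst|].
  split; first by under eq_integral do rewrite /=; rewrite integral0.
  apply: aeW => s sT s2 z w s2T _ _ _ _; rewrite !mul0r !add0r mul0r addr0.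
  by rewrite (aut s s2).
have mT : lmeasurable R `[0, T] by exact: lmeasurable_itv.
have mtT : lmeasurable R `[t, T] by exact: lmeasurable_itv.
have sub : `[t, T] `<=` `[0, T].
  by move=> s /=; case/andP: ht => t0 _; rewrite !in_itv/= => /andP[ts ->]; rewrite (le_trans t0).
exists kappa, A, (\int[leb R]_(s in `[0, T]) `|gamma s|), (fun s => `|gamma s|); split.
- by rewrite k0 lexx.
- by [].
- rewrite lerD2r lerD2l -mulrA ler_wpM2l// [leRHS]mulrC ler_wpM2r ?invr_ge0 ?(ltW (alpha_gt0 hP))//.
  rewrite lerD2l ler_wpM2l ?(d_ge0 hP)// gerBl.
  by case/andP: ht.
- split; last by [].
  apply: measurable_fun_normr.
  by apply/measurable_EFinP; exact: (measurable_funS mT sub (measurable_int _ gi)).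
have gni := integrable_norm gi.
split.
  rewrite /Rintegral fineK; last exact: (integrable_fin_num mT gni).
  apply: (ge0_subset_integral (leb R) mtT mT _ _ sub).
  - exact: measurable_int gni.
  - by move=> s _; rewrite lee_fin.
move: Hs; apply: ae_imply => s H sT s2 z w s2T s2e Uw D1 D2.
have s_in : s \in `[s - eps, s + eps].
  by rewrite in_itv/= gerBl lerDl ltW.
have s2_in : s2 \in `[s - eps, s + eps].
  by rewrite in_itv/= -ler_distl.
have := H sT s s2 z w s_in sT s2_in s2T Uw D1 D2.
rewrite (fin D1) (fin D2) -EFinB -?EFinM -?EFinD -?EFinM !lee_fin.
set a := fine (L s z w); set b := fine _.
move=> h; have h2 : a - b <= (kappa * a + (A * enorm w + gamma s)) * `|s2 - s|.
  by apply: le_trans h; rewrite distrC ler_norm.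
(* [gamma] may take negative values, whereas [Phi] contains the integral of its absolute value. *)
have h3 : gamma s * `|s2 - s| <= `|gamma s| * `|s2 - s| by rewrite ler_wpM2r// ler_norm.
rewrite -lerBlDl; apply: le_trans h2 _.
by rewrite !mulrDl addrA lerD2l.
Qed.

End time_regularity.

(** * The speed profile *)

(* Running at speed [1 / (1 + p - g)]: [p = v / N - 1] where [v] exceeds [N], and
   [g = eta] on the set where [v < c'] and [F <= l], with [eta] chosen so that [p]
   and [g] have the same integral [delta]. *)
Record speed_profile (R : realType) (t T : R) (v : R -> R) (F : R -> \bar R)
    (N c' l r0 eta0 D : R) (p g : R -> R) (eta delta : R) : Prop := SpeedProfile {
  sp_eta : 0 <= eta <= eta0 ;
  sp_delta : 0 <= delta <= D ;
  sp_p0 : forall s, 0 <= p s ;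
  sp_g0 : forall s, 0 <= g s ;
  sp_mp : lmeasurable_fun setT p ;
  sp_mg : lmeasurable_fun setT g ;
  sp_slow : forall s, p s = 0 \/ N * (1 + p s) = v s /\ g s = 0 ;
  sp_fast : forall s, g s = 0 \/ [/\ p s = 0, g s = eta, v s < c' & (F s <= l%:E)%E] ;
  sp_out : forall s, s \notin `]t, T] -> p s - g s = 0 ;
  sp_intp : (\int[leb R]_(s in `[t, T]) (p s)%:E = delta%:E)%E ;
  sp_intg : (\int[leb R]_(s in `[t, T]) (g s)%:E = delta%:E)%E ;
  sp_int : (leb R).-integrable setT (EFin \o (fun s => p s - g s)) ;
  sp_tot : \int[leb R]_s (p s - g s) = 0 ;
  sp_shift : forall s, `|\int[leb R]_(r in `]-oo, s]) (p r - g r)| <= delta ;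
  sp_ge : forall s, r0 <= 1 + (p s - g s) ;
  sp_bound : forall s, s \in `]t, T] -> v s <= (N + c' / r0) * (1 + (p s - g s)) }.

Section speed_profile_ex.
Context {R : realType} (t T : R) (v : R -> R) (F : R -> \bar R).
Context (N c' l m1 r0 eta0 Cu B : R).
Hypothesis tT : t <= T.
Hypothesis mv : lmeasurable_fun `[t, T] v.
Hypothesis mF : lmeasurable_fun `[t, T] F.
Hypothesis v0 : forall s, 0 <= v s.
Hypothesis F0 : forall s, s \in `[t, T] -> (0 <= F s)%E.
Hypothesis intv : (\int[leb R]_(s in `[t, T]) (v s)%:E <= Cu%:E)%E.
Hypothesis intF : (\int[leb R]_(s in `[t, T]) F s <= B%:E)%E.
Hypothesis N_gt0 : 0 < N.
Hypothesis c'_gt0 : 0 < c'.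
Hypothesis c'N : c' <= N.
Hypothesis l_gt0 : 0 < l.
Hypothesis m1_gt0 : 0 < m1.
Hypothesis m1_le : Cu / c' + B / l + m1 <= T - t.
Hypothesis eta0_ge0 : 0 <= eta0.
Hypothesis r0_gt0 : 0 < r0.
Hypothesis r0_le : r0 <= 1 - eta0.
Hypothesis CuN : Cu / N <= m1 * eta0.

Let mD : lmeasurable R `[t, T]. Proof. exact: lmeasurable_itv. Qed.
Let mD' : lmeasurable R `]t, T]. Proof. exact: lmeasurable_itv. Qed.
Let subD : `]t, T] `<=` `[t, T]. Proof. exact: subset_itv_oc_cc. Qed.

Let E1 := `[t, T]%classic `&` [set s | (c'%:E <= (v s)%:E)%E].
Let E2 := `[t, T]%classic `&` [set s | (l%:E <= F s)%E].
Let G := `]t, T]%classic `\` (E1 `|` E2).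

Let mEv : lmeasurable_fun `[t, T] (fun s => (v s)%:E).
Proof. exact/measurable_EFinP. Qed.

Let mE1 : lmeasurable R E1.
Proof. by have := mEv mD (emeasurable_itv `[c'%:E, +oo[); rewrite preimage_itvcy. Qed.

Let mE2 : lmeasurable R E2.
Proof. by have := mF mD (emeasurable_itv `[l%:E, +oo[); rewrite preimage_itvcy. Qed.

Let mG : lmeasurable R G.
Proof. by apply: measurableD => //; exact: measurableU. Qed.

Let G_lty : (leb R G < +oo)%E.
Proof.
apply: (@le_lt_trans _ _ (leb R `]t, T])); last by rewrite [ltLHS](leb_itvoc tT) ltry.
by apply: le_measure; rewrite ?inE//; exact: subDsetl.
Qed.

(** By Markov's inequality the excluded sets [E1] and [E2] have measure at most [Cu / c'] and
    [B / l], which [m1_le] balances against the length [T - t]. *)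
Let G_ge : (m1%:E <= leb R G)%E.
Proof.
have h1 : (leb R E1 <= (Cu / c')%:E)%E.
  have := @markov_integral _ _ _ (leb R) _ _ c' mD mEv.
  move=> /(_ (fun s _ => v0 s) (ltW c'_gt0)) /le_trans /(_ intv).
  by rewrite -lee_pdivlMl// -EFinM mulrC.
have h2 : (leb R E2 <= (B / l)%:E)%E.
  have := @markov_integral _ _ _ (leb R) _ _ l mD mF F0 (ltW l_gt0).
  by move=> /le_trans /(_ intF); rewrite -lee_pdivlMl// -EFinM mulrC.
have h3 : ((T - t)%:E <= leb R G + (leb R E1 + leb R E2))%E.
  have mU : lmeasurable R (G `|` (E1 `|` E2)).
    by apply: measurableU => //; exact: measurableU.
  apply: (@le_trans _ _ (leb R (G `|` (E1 `|` E2)))).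
    rewrite -[leLHS](leb_itvoc tT); apply: le_measure; rewrite ?inE//.
    by rewrite /G; move=> s Ds; have [|] := pselect ((E1 `|` E2) s); [right|left].
  apply: le_trans (measureU2 _ mG (measurableU _ _ mE1 mE2)) _.
  by apply: leeD2l; exact: measureU2.
have h4 : ((T - t)%:E <= leb R G + (Cu / c' + B / l)%:E)%E.
  by apply: le_trans h3 _; rewrite EFinD leeD2l// leeD.
have Gf : leb R G \is a fin_num by rewrite ge0_fin_numE.
move: h4; rewrite -(fineK Gf) -EFinD !lee_fin => h4.
by rewrite -(lerD2l (Cu / c' + B / l)) addrC [leRHS]addrC; apply: le_trans h4; rewrite addrC.
Qed.

Let p := (fun s => Num.max (v s / N - 1) 0) \_ `]t, T].

Let p0 s : 0 <= p s.
Proof. by rewrite /p patchE; case: ifP => // _; rewrite le_max lexx orbT. Qed.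

Let mp : lmeasurable_fun setT p.
Proof.
apply/(measurable_restrictT _ mD').1; apply: measurable_maxr.
  apply: measurable_funB; last exact: measurable_cst.
  by apply: measurable_funM; [exact: measurable_funS mv|exact: measurable_cst].
exact: measurable_cst.
Qed.

Let p_le s : p s <= v s / N.
Proof.
have vN : 0 <= v s / N by rewrite divr_ge0// ltW.
by rewrite /p patchE; case: ifP => // _; rewrite ge_max vN andbT gerBl.
Qed.

Let p_out s : s \notin `[t, T] -> p s = 0.
Proof.
move=> sD; rewrite /p patchE mem_setE; case: ifPn => // /subD /=.
by rewrite (negPf sD).
Qed.

Let intp_le : (\int[leb R]_(s in `[t, T]) (p s)%:E <= (Cu / N)%:E)%E.
Proof.
apply: (@le_trans _ _ (\int[leb R]_(s in `[t, T]) (N^-1%:E * (v s)%:E))%E).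
  apply: (ge0_le_integral (leb R) mD).
  - by move=> s _; rewrite lee_fin.
  - by apply/measurable_EFinP; exact: measurable_funS mp.
  - exact: measurable_funeM.
  - by move=> s _; rewrite -EFinM lee_fin mulrC.
rewrite (ge0_integralZl_EFin _ mD)//; last 2 first.
- by move=> s _; rewrite lee_fin.
- by rewrite invr_ge0 ltW.
rewrite [(Cu / N)%:E]EFinM muleC; apply: lee_wpmul2r => //.
by rewrite lee_fin invr_ge0 ltW.
Qed.

Let pi : (leb R).-integrable setT (EFin \o p).
Proof.
have -> : p = p \_ `[t, T].
  by apply/funext => s; rewrite [RHS]patchE mem_setE; case: ifPn => // /p_out.
rewrite -restrict_EFin; apply/(integrable_mkcond _ mD).1.
apply/integrableP; split.
  by apply/measurable_EFinP; exact: measurable_funS mp.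
under eq_integral do rewrite /= ger0_norm//.
exact: le_lt_trans intp_le (ltry _).
Qed.

Let delta := \int[leb R]_s p s.

Let intp : (\int[leb R]_(s in `[t, T]) (p s)%:E = delta%:E)%E.
Proof.
rewrite /delta /Rintegral fineK; last exact: (integrable_fin_num measurableT pi).
rewrite [LHS]integral_mkcond; apply: eq_integral => s _.
by rewrite patchE mem_setE; case: ifPn => // /p_out ->.
Qed.

Let delta_itv : 0 <= delta <= Cu / N.
Proof.
by rewrite Rintegral_ge0//= -lee_fin -intp.
Qed.

Let mu := fine (leb R G).
Let muE : leb R G = mu%:E. Proof. by rewrite fineK// ge0_fin_numE. Qed.
Let mu_ge : m1 <= mu. Proof. by rewrite -lee_fin -muE. Qed.
Let mu_gt0 : 0 < mu. Proof. exact: lt_le_trans mu_ge. Qed.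
Let eta := delta / mu.
Let g s := eta * \1_G s.

(** The time to regain is at most [Cu / N], and [N] is so large that this is at most [m1 * eta0],
    while [G] has measure at least [m1]. *)
Let eta_itv : 0 <= eta <= eta0.
Proof.
case/andP: delta_itv => d0 dC; rewrite divr_ge0 ?(ltW mu_gt0)//=.
rewrite ler_pdivrMr//; apply: le_trans dC _; apply: le_trans CuN _.
by rewrite mulrC ler_wpM2l.
Qed.

Let g0 s : 0 <= g s.
Proof. by rewrite mulr_ge0//; case/andP: eta_itv. Qed.

Let mg : lmeasurable_fun setT g.
Proof. by apply: measurable_funM; [exact: measurable_cst|exact: measurable_indic]. Qed.

Let G_sub : G `<=` `[t, T].
Proof. by apply: subset_trans subD; exact: subDsetl. Qed.

Let intg : (\int[leb R]_(s in `[t, T]) (g s)%:E = delta%:E)%E.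
Proof.
have e0 : 0 <= eta by case/andP: eta_itv.
under eq_integral do rewrite /g EFinM.
rewrite (ge0_integralZl_EFin _ mD); last 3 first.
- by move=> s _; rewrite lee_fin.
- by apply/measurable_EFinP; exact: measurable_indic.
- exact: e0.
rewrite integral_indic; [|exact: mD|exact: mG]; rewrite setIidl// [X in (_ * X)%E]muE -EFinM /eta divfK//.
by rewrite gt_eqF.
Qed.

Let gi : (leb R).-integrable setT (EFin \o g).
Proof.
have -> : g = g \_ `[t, T].
  apply/funext => s; rewrite [RHS]patchE mem_setE; case: ifPn => // sD.
  rewrite /g indicE memNset ?mulr0// => /G_sub /=; by rewrite (negPf sD).
rewrite -restrict_EFin; apply/(integrable_mkcond _ mD).1.
apply/integrableP; split.
  by apply/measurable_EFinP; exact: measurable_funS mg.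
under eq_integral do rewrite /= ger0_norm//.
by rewrite intg ltry.
Qed.

Let totg : \int[leb R]_s g s = delta.
Proof.
apply/EFin_inj; rewrite -intg /Rintegral fineK; last exact: (integrable_fin_num measurableT gi).
rewrite [RHS]integral_mkcond; apply: eq_integral => s _.
rewrite patchE mem_setE; case: ifPn => // sD.
rewrite /g indicE memNset ?mulr0// => /G_sub /=; by rewrite (negPf sD).
Qed.

Lemma speed_profile_ex : exists p g eta delta,
  speed_profile t T v F N c' l r0 eta0 (Cu / N) p g eta delta.
Proof.
exists p, g, eta, delta.
have gE s : s \in G -> g s = eta by rewrite /g indicE => ->; rewrite mulr1.
have gN s : s \notin G -> g s = 0 by rewrite /g indicE => /negPf ->; rewrite mulr0.
have Gp s : s \in G -> [/\ p s = 0, v s < c' & (F s <= l%:E)%E].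
  rewrite inE => -[Ds /not_orP[nE1 nE2]].
  have vc : v s < c'.
    by rewrite ltNge; apply/negP => cv; apply: nE1; split; [exact: subD|rewrite /= lee_fin].
  split => //.
    rewrite /p patchE mem_set//; apply/max_idPr.
    rewrite subr_le0 ler_pdivrMr// mul1r; apply: le_trans c'N; exact: ltW.
  rewrite leNgt; apply/negP => lF; apply: nE2; split; [exact: subD|exact: ltW].
have slow s : p s = 0 \/ N * (1 + p s) = v s /\ g s = 0.
  have [->|ps0] := eqVneq (p s) 0; first by left.
  right; split; last first.
    by apply: gN; apply: contra ps0 => /Gp[-> _ _].
  move: ps0; rewrite /p patchE; case: ifPn => //; last by rewrite eqxx.
  move=> _; rewrite /Num.max; case: ifPn => [_|]; first by rewrite eqxx.
  by move=> _ _; rewrite addrC subrK mulrC divfK// gt_eqF.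
have fast s : g s = 0 \/ [/\ p s = 0, g s = eta, v s < c' & (F s <= l%:E)%E].
  have [sG|/gN] := boolP (s \in G); [right|by left].
  by have [? ? ?] := Gp s sG; split => //; exact: gE.
have ge s : r0 <= 1 + (p s - g s).
  apply: le_trans r0_le _; rewrite lerD2l lerBrDl; apply: (@le_trans _ _ (g s - eta0)).
    by [].
  rewrite lerBlDr; apply: (@le_trans _ _ eta0); last by rewrite lerDr.
  by have [->|[_ -> _ _]] := fast s => //; case/andP: eta_itv.
split => //.
- move=> s sD; rewrite [X in X - _](_ : _ = 0) ?sub0r; last first.
    by rewrite /p patchE mem_setE (negPf sD).
  by rewrite gN ?oppr0//; apply/negP; rewrite inE => -[/= ]; rewrite (negPf sD).
- exact: (integrableB measurableT pi gi).
- by rewrite (RintegralB measurableT pi gi) totg subrr.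
- move=> s.
  have mI : lmeasurable R `]-oo, s] by exact: lmeasurable_itv.
  rewrite (RintegralB mI (integrable_leb pi mI) (integrable_leb gi mI)).
  have a1 : \int[leb R]_(r in `]-oo, s]) p r <= delta.
    exact: (le_Rintegral_subset mI measurableT).
  have a2 : \int[leb R]_(r in `]-oo, s]) g r <= delta.
    by rewrite -totg; exact: (le_Rintegral_subset mI measurableT).
  have b1 : 0 <= \int[leb R]_(r in `]-oo, s]) p r by exact: Rintegral_ge0.
  have b2 : 0 <= \int[leb R]_(r in `]-oo, s]) g r by exact: Rintegral_ge0.
  rewrite ler_norml lerBlDr lerBrDl (le_trans _ b1) ?subr_le0//=.
  by apply: le_trans a1 _; rewrite lerDl.
(* On the slow set [v = N (1 + p)]; where the speed is unchanged [v <= N]; on the fast set [v < c'],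
   and there the factor is at least [r0]. *)
- move=> s sD.
  have cr : 0 <= c' / r0 by rewrite divr_ge0// ltW.
  have w0 : 0 <= 1 + (p s - g s) by apply: le_trans (ge s); exact: ltW.
  have [ps|[<- ->]] := slow s; last first.
    by rewrite subr0 ler_wpM2r ?lerDl// addr_ge0.
  have [gs|[_ _ vc _]] := fast s.
    rewrite ps gs subr0 addr0 mulr1; apply: (@le_trans _ _ N); last by rewrite lerDl.
    move: ps; rewrite /p patchE mem_set// => /max_idPr.
    by rewrite subr_le0 ler_pdivrMr// mul1r.
  apply: le_trans (ltW vc) _; rewrite mulrDl -[leLHS]add0r lerD//.
    by rewrite mulr_ge0// ltW.
  rewrite mulrAC ler_pdivlMr// ler_wpM2l//; exact: ltW.
Qed.

End speed_profile_ex.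

(** Any [c'] strictly between [Cu / Tt] and [c] has [Cu / c' < Tt]. Half of the remaining length is
    reserved for [m1], and [l] is taken so large that [B / l] fits into the other half. *)
Lemma level_constants (R : realType) (B Cu Tt c : R) :
  0 <= B -> 0 <= Cu -> 0 < Tt -> Cu / Tt < c ->
  exists c' m1 l : R, [/\ 0 < c', c' < c, 0 < m1, 0 < l & Cu / c' + B / l + m1 <= Tt].
Proof.
move=> B0 C0 T0 cc.
have cb0 : 0 <= Cu / Tt by rewrite divr_ge0// ltW.
pose c' := (Cu / Tt + c) / 2.
have c'0 : 0 < c' by rewrite /c'; lra.
have bc' : Cu / Tt < c' by rewrite /c'; lra.
have c'c : c' < c by rewrite /c'; lra.
have CT : Cu / c' < Tt by rewrite ltr_pdivrMr// mulrC -ltr_pdivrMr.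
pose m1 := (Tt - Cu / c') / 2.
have m10 : 0 < m1 by rewrite divr_gt0// subr_gt0.
have Bm : 0 <= B / m1 by rewrite divr_ge0// ltW.
have l0 : 0 < B / m1 + 1 by lra.
exists c', m1, (B / m1 + 1); split => //.
have Bl : B / (B / m1 + 1) <= m1.
  rewrite ler_pdivrMr// mulrDr mulr1 mulrC divfK ?gt_eqF// lerDl; exact: ltW.
by move: Bl; rewrite /m1; lra.
Qed.

(** [a0] limits the acceleration: controls below [c'] then move by at most [r] and stay below [c].
    The strict inequality for [eta0] leaves room on the ray beyond the accelerated control. *)
Lemma speedup_constants (R : realType) (c' c r : R) : 0 < c' -> c' < c -> 0 < r ->
  exists a0 eta0 : R, [/\ 1 <= a0, (a0 - 1) * c' <= r, a0 * c' < c, 0 < eta0 & a0^-1 < 1 - eta0].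
Proof.
move=> c'0 c'c r0.
pose e := Num.min r ((c - c') / 2).
have e0 : 0 < e by rewrite lt_min r0 divr_gt0// subr_gt0.
have er : e <= r by rewrite ge_min lexx.
have ec : e <= (c - c') / 2 by rewrite ge_min lexx orbT.
have a1 : 1 < 1 + e / c' by rewrite ltrDl divr_gt0.
have ai : (1 + e / c')^-1 < 1 by rewrite invf_lt1// (lt_trans ltr01).
exists (1 + e / c'), ((1 - (1 + e / c')^-1) / 2); split.
- exact: ltW.
- by rewrite addrAC subrr add0r divfK ?gt_eqF.
- rewrite mulrDl mul1r divfK ?gt_eqF//; lra.
- by rewrite divr_gt0// subr_gt0.
- lra.
Qed.

(** The lost time is at most [Cu / N]. A large [N] keeps the shift within the range of Condition
    (S), lets the term in [kappa] be absorbed, and makes the time recoverable. The witness is the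
    sum of the lower bounds for [N]. *)
Lemma slowdown_constant (R : realType) (nu c' Cu eps kappa m : R) :
  0 < nu -> 0 < c' -> 0 <= Cu -> 0 < eps -> 0 <= kappa -> 0 < m ->
  exists N : R, [/\ nu <= N, c' <= N, 0 < N, Cu / N <= eps &
    kappa * (Cu / N) <= 2^-1 /\ Cu / N <= m].
Proof.
move=> nu0 c0 C0 e0 k0 m0.
have h1 : 0 <= Cu / eps by rewrite divr_ge0// ltW.
have h2 : 0 <= 2 * (kappa * Cu) by rewrite !mulr_ge0.
have h3 : 0 <= Cu / m by rewrite divr_ge0// ltW.
exists (nu + c' + Cu / eps + 2 * (kappa * Cu) + Cu / m).
set N := (X in _ <= X).
have N0 : 0 < N by rewrite /N; lra.
split; [rewrite /N; lra|rewrite /N; lra|by []| |split].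
- by rewrite ler_pdivrMr// mulrC -ler_pdivrMr// /N; lra.
- by rewrite mulrA ler_pdivrMr// /N; lra.
- by rewrite ler_pdivrMr// mulrC -ler_pdivrMr// /N; lra.
Qed.

(** * Reparametrization with bounded controls *)

Section bounded_reparam.
Context {R : realType} (n m : nat) (P : problem R n m) (alpha d : R).
Hypothesis hP : basic_assumptions P alpha d.
Hypothesis hb : continuous (dynamics P).
Local Notation T := (horizon P).
Local Notation L := (lagrangian P).
Context (kappa A : R) (gamma : R -> R) (eps : R).
Hypothesis hS : condS P kappa A gamma eps.
Hypothesis hDom : ~ real_valued P -> h1 P /\ h2 P.
Context (t : R) (x : 'cV[R]_n) (ht : 0 <= t < T).
Hypothesis hLconvex : \forall s \ae leb R, s \in `[t, T] ->
  forall z : 'cV[R]_n, econvex (L s z).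
Context (B : R) (B0 : 0 <= B).
Hypothesis hH : growth_condition P alpha d kappa A gamma t B.
Local Notation PhiB := (Phi P alpha d kappa A gamma B).
Local Notation Cu := ((B + d * (T - t)) / alpha).

Let tT : t <= T. Proof. by case/andP: ht => _ /ltW. Qed.
Let subT s : s \in `[t, T] -> s \in `[0, T].
Proof. by case/andP: ht => t0 _; rewrite !in_itv/= => /andP[ts ->]; rewrite (le_trans t0). Qed.
Let mD : lmeasurable R `[t, T]. Proof. exact: lmeasurable_itv. Qed.

Let Cu0 : 0 <= Cu.
Proof.
rewrite divr_ge0 ?(ltW (alpha_gt0 hP))// addr_ge0// mulr_ge0 ?(d_ge0 hP)//.
by rewrite subr_ge0.
Qed.

Section one_trajectory.
Variables (K nu c r xi c' l a0 eta0 N M : R).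
Hypothesis slope : \forall s \ae leb R, s \in `[t, T] -> forall z w, Dom P (s, (z, w)) ->
  controls P w -> enorm z <= K ->
  (exists2 rp : R, 1 < rp & (L s z (rp *: w) < +oo)%E) ->
  exists q, [/\ subdiff P s z w q,
    (nu <= enorm w -> fine (L s z w) - q <= xi) &
    (enorm w < c -> (r%:E <= Defs.dist (s, (z, w)) (bdDom P))%E ->
      xi + 2 * PhiB <= fine (L s z w) - q)].
Hypothesis nuN : nu <= N.
Hypothesis r0 : 0 < r.
Hypothesis far : forall s z w, Dom P (s, (z, w)) -> controls P w ->
    (L s z w <= l%:E)%E -> ((4 * r)%:E <= Defs.dist (s, (z, w)) (bdDom P))%E.
Hypothesis a01 : 1 <= a0.
Hypothesis a0r : (a0 - 1) * c' <= r.
Hypothesis a0c : a0 * c' < c.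
Hypothesis a0eta : a0^-1 < 1 - eta0.
Variables (y : R -> 'cV[R]_n) (u : R -> 'cV[R]_m).
Hypothesis H : feasible P t x y u.
Hypothesis HK : forall s, s \in `[t, T] -> enorm (y s) <= K.
Variables (p g : R -> R) (eta delta : R).
Local Notation F := (fun s => L s (y s) (u s)).
Hypothesis sp : speed_profile t T (fun s => enorm (u s)) F N c' l (1 - eta0) eta0 (Cu / N) p g eta delta.
Let rho s := p s - g s.

Let a1 := Num.max xi 0.
Let a2 := Num.max (- xi) 0.
Let xiE : xi = a1 - a2.
Proof. by rewrite /a1 /a2; have [] := ltP xi 0; have [] := ltP (- xi) 0; lra. Qed.

Lemma pointwise_trade_off : \forall s \ae leb R, s \in `[t, T] ->
  (L s (y s) ((1 + rho s)^-1 *: u s) * (1 + rho s)%:E +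
     ((2 * PhiB + a1) * g s + a2 * p s)%:E <=
   L s (y s) (u s) + (a1 * p s + a2 * g s)%:E)%E.
Proof.
have Uu : \forall s \ae leb R, s \in `[t, T] -> controls P (u s) by case: H.
move: (ae_imply2 (fun s a b => conj a b) slope (ae_imply2 (fun s a b => conj a b) Uu (Dom_radial hP))).
apply: ae_imply => s [Sl [Us Lr]] sI.
have {}Us := Us sI.
have L0 v : (0 <= L s (y s) v)%E by apply: (lagrangian_ge0 hP); exact: subT.
have Lr' v (b : R) : (L s (y s) v < +oo)%E -> 0 < b <= 1 -> (L s (y s) (b *: v) < +oo)%E.
  exact: Lr (subT sI) (y s) v b.
have Sl' w Dw Uw rpw := Sl sI (y s) w Dw Uw (HK sI) rpw.
have sp0 := sp_p0 sp s.
have [gs|[ps gs vc Fl]] := sp_fast sp s.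
  have [ps|[Np _]] := sp_slow sp s.
    rewrite /rho ps gs subrr addr0 invr1 scale1r mule1.
    by apply: (@leeD_shift _ _ _ 0); rewrite ?adde0// !mulr0 !addr0.
  apply: (@leeD_shift _ _ _ (xi * p s)).
    rewrite /rho gs subr0.
    apply: (slow_pointwise (subT sI) L0 Lr' (controls_cone hP) Sl' Us sp0).
    by rewrite -Np ler_wpM2r// addr_ge0.
  by rewrite gs !mulr0 add0r addr0 -mulrDl xiE subrK.
apply: (@leeD_shift _ _ _ (- (eta * (xi + 2 * PhiB)))).
  rewrite /rho ps gs sub0r.
  have [eta_0 eta_1] := andP (sp_eta sp).
  have Lu : (L s (y s) (u s) < +oo)%E by apply: le_lt_trans Fl (ltry _).
  apply: (fast_pointwise (a0 := a0) (subT sI) L0 (controls_cone hP) Sl' Us) => //.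
  - by apply: lt_le_trans a0eta _; rewrite lerB.
  - by apply: far => //; split => //; exact: subT.
  - by apply: le_trans a0r; rewrite ler_wpM2l ?subr_ge0// ltW.
  - by apply: le_lt_trans a0c; rewrite ler_wpM2l ?(le_trans ler01)// ltW.
rewrite ps gs !mulr0 addr0 add0r le_eqVlt; apply/orP; left; apply/eqP.
rewrite [in LHS]xiE; ring.
Qed.

Variables (k A' Gam : R) (gm : R -> R).
Hypothesis k0 : 0 <= k.
Hypothesis A'0 : 0 <= A'.
Hypothesis PhiB_ge : k * B + A' * Cu + Gam <= PhiB.
Hypothesis mgm : lmeasurable_fun `[t, T] gm.
Hypothesis gm0 : forall s, 0 <= gm s.
Hypothesis gmI : (\int[leb R]_(s in `[t, T]) (gm s)%:E <= Gam%:E)%E.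
Hypothesis regular : \forall s \ae leb R, s \in `[0, T] -> forall s2 z w, s2 \in `[0, T] ->
  `|s2 - s| <= eps -> controls P w -> Dom P (s, (z, w)) -> Dom P (s2, (z, w)) ->
  fine (L s z w) <= fine (L s2 z w) +
    (k * fine (L s z w) + A' * enorm w + gm s) * `|s2 - s|.
Hypothesis Ceps : Cu / N <= eps.
Hypothesis kC : k * (Cu / N) <= 2^-1.
Variables (phi psi : R -> R).
Hypothesis tc : time_change t T rho phi psi.

Let delta0 : 0 <= delta. Proof. by case/andP: (sp_delta sp). Qed.
Let deltaC : delta <= Cu / N. Proof. by case/andP: (sp_delta sp). Qed.
Let kdelta : k * delta <= 2^-1. Proof. by apply: le_trans kC; rewrite ler_wpM2l. Qed.

Let mrho : lmeasurable_fun setT rho.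
Proof. exact: measurable_funB (sp_mp sp) (sp_mg sp). Qed.

Let w0 s : 0 <= 1 + rho s. Proof. exact: ltW (tc_gt0 tc s). Qed.

Local Notation y' := (y \o psi).
Local Notation u' := (slowed rho psi u).
Let u1 s := (1 + rho s)^-1 *: u s.

Let u'E s : u' s = u1 (psi s). Proof. by []. Qed.

Let H' : feasible P t x y' u'. Proof. exact: (feasible_time_change hP hb tc mrho H). Qed.

Let psi_close s : `|psi s - s| <= delta.
Proof.
rewrite -{2}(tc_psiK tc s) (tc_phiE tc) opprD addNKr normrN; exact: sp_shift sp _.
Qed.

Let mu1 j : lmeasurable_fun `[t, T] (fun s => u1 s j 0).
Proof.
rewrite (_ : (fun s => _) = (fun s => (1 + rho s)^-1 * u s j 0)); last first.
  by apply/funext => s; rewrite /u1 mxE.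
apply: measurable_funM; last exact: feasible_control_meas H j.
apply: measurable_funTS; apply: measurable_fun_inv_pos; first exact: tc_gt0 tc.
exact: measurable_funD.
Qed.

(** Condition (S) is based at [s], so its term in [k] contains the new running cost itself; moving
    it to the left gives the factor [1 - k * delta]. *)
Let shifted : \forall s \ae leb R, s \in `[t, T] ->
  ((1 - k * delta)%:E * L s (y' s) (u' s) <=
   L (psi s) (y' s) (u' s) + (delta * (A' * enorm (u' s) + gm s))%:E)%E.
Proof.
have Uu : \forall s \ae leb R, s \in `[t, T] -> controls P (u' s) by case: H'.
move: Uu regular; apply: ae_imply2 => s Us reg sI.
have psiI : psi s \in `[t, T] by rewrite (tc_psi_itv tc).
have [Lp|] := ltP (L (psi s) (y' s) (u' s)) +oo%E; last first.
  by rewrite leye_eq => /eqP ->; rewrite addye// leey.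
have D2 : Dom P (psi s, (y' s, u' s)) by split => //; exact: subT.
have D1 : Dom P (s, (y' s, u' s)) := Dom_shift hDom (subT sI) D2.
have fin s1 : Dom P (s1, (y' s, u' s)) ->
    L s1 (y' s) (u' s) = (fine (L s1 (y' s) (u' s)))%:E.
  move=> Dw; rewrite fineK// ge0_fin_numE; first exact: Dw.2.
  by apply: (lagrangian_ge0 hP); exact: Dw.1.
have pe : `|psi s - s| <= eps by apply: le_trans Ceps; exact: le_trans deltaC.
have := reg (subT sI) (psi s) (y' s) (u' s) (subT psiI) pe (Us sI) D1 D2.
have := lagrangian_ge0 hP (y' s) (u' s) (subT sI).
rewrite (fin _ D1) (fin _ D2) -EFinM -EFinD !lee_fin.
have := psi_close s.
set h := `|_|; set a := fine (L s _ _); set b := fine _ => hd a0' hb'.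
have : (k * a + A' * enorm (u' s) + gm s) * h <= (k * a + A' * enorm (u' s) + gm s) * delta.
  by rewrite ler_wpM2l// !addr_ge0// mulr_ge0// enorm_ge0.
move=> h2.
rewrite mulrBl mul1r lerBlDr; apply: le_trans hb' _; rewrite -[leRHS]addrA lerD2l.
apply: le_trans h2 _; rewrite le_eqVlt; apply/orP; left; apply/eqP; ring.
Qed.

(** With the shifted time argument, the change of variables returns to the original times and
    states; only the control is rescaled, so the pointwise trade-off applies. *)
Let change_F1 : (\int[leb R]_(s in `[t, T]) L (psi s) (y' s) (u' s) =
  \int[leb R]_(s in `[t, T]) (L s (y s) (u1 s) * (1 + rho s)%:E))%E.
Proof.
rewrite (ge0_integral_time_change tc mD mD).
- by apply: eq_integral => s _; rewrite /= u'E (tc_phiK tc).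
- by move=> z; rewrite /= (tc_phi_itv tc).
- apply: (lagrangian_comp_meas hP mD).
  + exact: measurable_funTS (tc_psi_meas tc).
  + by move=> s sI; apply: subT; rewrite (tc_psi_itv tc).
  + exact: feasible_state_meas H'.
  + exact: feasible_control_meas H'.
- by move=> s sI; apply: (lagrangian_ge0 hP); apply: subT; rewrite (tc_psi_itv tc).
Qed.

(** The integral of [|u|] is invariant under reparametrization, so the bound [Cu] holds for the new
    control before anything is known about its cost. *)
Let change_E : (\int[leb R]_(s in `[t, T]) (enorm (u' s))%:E =
  \int[leb R]_(s in `[t, T]) (enorm (u s))%:E)%E.
Proof.
rewrite (ge0_integral_time_change tc mD mD).
- apply: eq_integral => s _; rewrite u'E (tc_phiK tc) -EFinM /u1 enormZ.
  rewrite ger0_norm ?invr_ge0// mulrAC mulVf ?mul1r// gt_eqF//.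
  exact: tc_gt0 tc s.
- by move=> z; rewrite /= (tc_phi_itv tc).
- apply/measurable_EFinP/measurable_enorm; exact: feasible_control_meas H'.
- by move=> s _; rewrite lee_fin enorm_ge0.
Qed.

Lemma slowed_cost : (cost P t y u <= B%:E)%E -> (cost P t y' u' <= cost P t y u)%E.
Proof.
move=> HB; rewrite /cost /= (tc_psi_right tc); apply: leeD2r.
have Gam0 : 0 <= Gam.
  rewrite -lee_fin; apply: le_trans gmI; apply: integral_ge0 => s _.
  by rewrite lee_fin.
have Phi0 : 0 <= PhiB.
  by apply: le_trans PhiB_ge; rewrite !addr_ge0// mulr_ge0.
have mF1 : lmeasurable_fun `[t, T] (fun s => L s (y s) (u1 s) * (1 + rho s)%:E)%E.
  apply: emeasurable_funM.
    apply: (lagrangian_comp_meas hP (tau := id) mD).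
    - by move=> _ Z mZ; exact: measurableI.
    - exact: subT.
    - exact: feasible_state_meas H.
    - exact: mu1.
  apply: measurable_funTS; apply/measurable_EFinP; exact: measurable_funD.
have F10 s : s \in `[t, T] -> (0 <= L s (y s) (u1 s) * (1 + rho s)%:E)%E.
  move=> sI; rewrite mule_ge0 ?lee_fin//.
  by apply: (lagrangian_ge0 hP); exact: subT.
have mpsiL : lmeasurable_fun `[t, T] (fun s => L (psi s) (y' s) (u' s)).
  apply: (lagrangian_comp_meas hP mD).
  - exact: measurable_funTS (tc_psi_meas tc).
  - by move=> s sI; apply: subT; rewrite (tc_psi_itv tc).
  - exact: feasible_state_meas H'.
  - exact: feasible_control_meas H'.
have psiL0 s : s \in `[t, T] -> (0 <= L (psi s) (y' s) (u' s))%E.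
  by move=> sI; apply: (lagrangian_ge0 hP); apply: subT; rewrite (tc_psi_itv tc).
have YI := @integral_trade_off _ _ _ (leb R) `[t, T] _ F p g a1 a2 (2 * PhiB) delta
  mD mF1 (lagrangian_traj_meas hP ht H)
  (measurable_funTS (sp_mp sp)) (measurable_funTS (sp_mg sp))
  F10 (fun s sI => lagrangian_traj_ge0 hP ht y u sI)
  (fun s _ => sp_p0 sp s) (fun s _ => sp_g0 sp s).
have a10 : 0 <= a1 by rewrite le_max lexx orbT.
have a20 : 0 <= a2 by rewrite le_max lexx orbT.
have {YI} := YI a10 a20 (mulr_ge0 (ler0n _ 2) Phi0) (sp_intp sp) (sp_intg sp) pointwise_trade_off.
rewrite -change_F1 => YI.
have me' : lmeasurable_fun `[t, T] (fun s => enorm (u' s)).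
  by apply: measurable_enorm; exact: feasible_control_meas H'.
have k1 : 0 <= 1 - k * delta.
  by rewrite subr_ge0 (le_trans kdelta)// invf_le1 ?ler1n.
have XY := @integral_shift_bound _ _ _ (leb R) `[t, T] _ _ (fun s => enorm (u' s)) gm
  (1 - k * delta) A' delta mD (lagrangian_traj_meas hP ht H') mpsiL me' mgm
  (fun s sI => lagrangian_traj_ge0 hP ht y' u' sI) psiL0
  (fun s _ => enorm_ge0 _) (fun s _ => gm0 s) k1 A'0 delta0 shifted.
apply: (cost_comparison _ _ _ YI XY _ _ _ _ PhiB_ge Phi0 delta0 kdelta k0 A'0).
- by apply: integral_ge0 => s sI; exact: (lagrangian_traj_ge0 hP ht y' u' sI).
- by apply: integral_ge0 => s sI; exact: psiL0.
- exact: (running_cost_le hP ht H HB).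
- by apply: integral_ge0 => s _; rewrite lee_fin enorm_ge0.
- by rewrite change_E; exact: (control_integral hP ht H HB).
- by apply: integral_ge0 => s _; rewrite lee_fin.
- exact: gmI.
Qed.

End one_trajectory.

(** The bound [M] must not depend on the trajectory: [K] comes from [B], then [nu] and [c] from [K],
    [c'] and [l] from [c], [r] from [l], [eta0] from [r], and [N] last. *)
Lemma bounded_reparam : exists M K : R, forall y u, feasible P t x y u ->
  (cost P t y u <= B%:E)%E -> exists y' u', [/\ feasible P t x y' u',
    (cost P t y' u' <= cost P t y u)%E,
    forall s, s \in `]t, T] -> enorm (u' s) <= M &
    forall s, s \in `[t, T] -> enorm (y' s) <= K].
Proof.
have [K K0 HK] := state_bound hP hb x ht B.
have [nu [c [nu0 cc Hslope]]] := growth_slope hP ht hLconvex hH K0.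
have Tt0 : 0 < T - t by rewrite subr_gt0; case/andP: ht.
have cb : Cu / (T - t) < c.
  by apply: le_lt_trans cc; rewrite /cbound invfM mulrA.
have [c' [m1 [l [c'0 c'c m10 l0 m1_le]]]] := level_constants B0 Cu0 Tt0 cb.
have [r r0 far] := dist_level hDom l0.
have [a0 [eta0 [a01 a0r a0c eta00 a0eta]]] := speedup_constants c'0 c'c r0.
have [xi slope] := Hslope r r0.
have [k [A' [Gam [gm [/andP[k0 kk] A'0 Pge [mgm gm0] [gmI reg]]]]]] := time_regularity hP hS ht B.
have eps0 : 0 < eps by case: hS.
have [N [nuN c'N N0 Ceps [kC Cm]]] := slowdown_constant nu0 c'0 Cu0 eps0 k0 (mulr_gt0 m10 eta00).
have r1 : 0 < 1 - eta0 by apply: lt_trans a0eta; rewrite invr_gt0 (lt_le_trans ltr01).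
exists (N + c' / (1 - eta0)), K => y u H HB.
have mv : lmeasurable_fun `[t, T] (fun s => enorm (u s)).
  by apply: measurable_enorm; exact: feasible_control_meas H.
have [p [g [eta [delta sp]]]] := speed_profile_ex tT mv (lagrangian_traj_meas hP ht H)
  (fun s => enorm_ge0 _) (lagrangian_traj_ge0 hP ht y u) (control_integral hP ht H HB)
  (running_cost_le hP ht H HB) N0 c'0 c'N l0 m10 m1_le (ltW eta00) r1 (lexx _) Cm.
have [phi [psi tc]] := time_change_ex r1 (sp_int sp) (sp_out sp) (sp_ge sp) (sp_tot sp).
have mrho : lmeasurable_fun setT (fun s => p s - g s).
  exact: measurable_funB (sp_mp sp) (sp_mg sp).
have H' := feasible_time_change hP hb tc mrho H.
have cost_le := slowed_cost slope nuN r0 far a01 a0r a0c a0eta H (HK _ _ H HB) sp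
  k0 A'0 Pge mgm gm0 gmI reg Ceps kC tc HB.
exists (y \o psi), (slowed (fun s => p s - g s) psi u); split => //.
- move=> s sI; rewrite /slowed enormZ ger0_norm ?invr_ge0 ?(ltW (tc_gt0 tc _))//.
  rewrite mulrC ler_pdivrMr; last exact: tc_gt0 tc _.
  by apply: (sp_bound sp); rewrite (tc_psi_itvoc tc).
- by move=> s sI; apply: (HK _ _ H HB); rewrite (tc_psi_itv tc).
Qed.

End bounded_reparam.

(** * Convex combinations converging almost everywhere *)

(* The infima of [q] over [C N] increase to a limit, so the parallelogram inequality
   makes elements of [C N] that are almost minimal for large [N] close in [dd]. *)
Lemma almost_minimal_sequence (R : realType) (X : Type) (C : nat -> set X)
    (mid : X -> X -> X) (q : X -> R) (dd : X -> X -> R) (b : R) (e : nat -> R) :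
  (forall N, C N !=set0) -> (forall N N', (N <= N')%N -> C N' `<=` C N) ->
  (forall N x y, C N x -> C N y -> C N (mid x y)) ->
  (forall x, C 0%N x -> 0 <= q x <= b) ->
  (forall x y, C 0%N x -> C 0%N y -> q (mid x y) + dd x y / 4 <= (q x + q y) / 2) ->
  (forall j, 0 < e j) -> (forall j, e j.+1 <= e j) ->
  exists w : nat -> X, forall j, C j (w j) /\ dd (w j) (w j.+1) <= e j.
Proof.
move=> C0 Cdec Cmid qb par e0 edec.
pose m N := inf (q @` C N).
have C0N N : C N `<=` C 0%N by exact: Cdec.
have hinf N : has_inf (q @` C N).
  have [x Cx] := C0 N; split; first by exists (q x); exists x.
  by exists 0 => _ [y /C0N /qb /andP[? _] <-].
have m_le N x : C N x -> m N <= q x.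
  by move=> Cx; apply: ge_inf; [case: (hinf N)|exists x].
have m_nd N N' : (N <= N')%N -> m N <= m N'.
  move=> NN'; apply: lb_le_inf; first by case: (hinf N').
  by move=> _ [x Cx <-]; apply: m_le; exact: Cdec Cx.
have mb N : m N <= b.
  have [x Cx] := C0 N; apply: le_trans (m_le _ _ Cx) _.
  by case/andP: (qb x (C0N _ _ Cx)).
pose M := sup (range m).
have hM : has_sup (range m).
  by split; [exists (m 0%N); exists 0%N|exists b => _ [N _ <-]].
have m_M N : m N <= M by apply: ub_le_sup; [case: hM|exists N].
(* An eighth: if two values are below [M + e j / 8] and that of the midpoint is above [M - e j / 8],
   then [dd / 4] is at most [e j / 4]. *)
have pick j : exists N, M - e j / 8 < m N.
  have e8 : 0 < e j / 8 by rewrite divr_gt0.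
  by have [_ [N _ <-] MN] := sup_adherent e8 hM; exists N.
pose f j := projT1 (cid (pick j)).
have fP j : M - e j / 8 < m (f j) by rewrite /f; case: cid.
(* The sum makes [N] nondecreasing and at least both [j] and [f j]. *)
pose N j := (j + \sum_(i < j.+1) f i)%N.
have Nf j : (f j <= N j)%N.
  by rewrite /N big_ord_recr/= addnA leq_addl.
have NS j : (N j <= N j.+1)%N.
  by rewrite /N [in leqRHS]big_ord_recr/= leq_add// leq_addr.
have jN j : (j <= N j)%N by exact: leq_addr.
have wex j : exists x, C (N j) x /\ q x < M + e j / 8.
  have e8 : 0 < e j / 8 by rewrite divr_gt0.
  have [_ [x Cx <-] qx] := inf_adherent e8 (hinf (N j)).
  by exists x; split => //; apply: lt_le_trans qx _; rewrite lerD2r m_M.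
pose w j := projT1 (cid (wex j)).
have wC j : C (N j) (w j) by rewrite /w; case: cid => x [].
have wq j : q (w j) < M + e j / 8 by rewrite /w; case: cid => x [].
exists w => j; split; first exact: Cdec (wC j).
have Cw' : C (N j) (w j.+1) by exact: Cdec (wC j.+1).
have h1 := m_le _ _ (Cmid _ _ _ (wC j) Cw').
have h2 := par _ _ (C0N _ _ (wC j)) (C0N _ _ Cw').
have h3 : M - e j / 8 < m (N j) by apply: lt_le_trans (fP j) _; exact: m_nd.
have h4 := wq j; have h5 := wq j.+1; have h6 := edec j.
by move: h1 h2 h3 h4 h5 h6; lra.
Qed.

Lemma le_sqr_weight (R : realFieldType) (b a : R) : 0 < b -> a <= b * a ^+ 2 + b^-1.
Proof.
move=> b0; rewrite -(ler_pM2l b0) mulrDr mulfV ?gt_eqF//.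
by have := sqr_ge0 (b * a - 1); nra.
Qed.

Section ae_convergence.
Local Open Scope ereal_scope.
Context d (T : measurableType d) (R : realType).
Variables (mu : {measure set T -> \bar R}) (D : set T).
Hypothesis mD : measurable D.
Hypothesis muD : mu D < +oo.

(** By [a <= 2^j a^2 + 2^-j] the square integrals [4^-j] make the increments summable in $L^1$, so
    the telescoping series converges absolutely almost everywhere. *)
Lemma ae_cvg_of_sqr (w : nat -> T -> R) :
  (forall j, measurable_fun D (w j)) ->
  (forall j, \int[mu]_(s in D) ((w j.+1 s - w j s) ^+ 2)%:E <= ((4^-1) ^+ j)%:E) ->
  \forall s \ae mu, D s -> cvgn (w ^~ s).
Proof.
move=> mw wint.
pose h j s := `|w j.+1 s - w j s|%R.
have h0 j s : 0 <= (h j s)%:E by rewrite lee_fin normr_ge0.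
have mh j : measurable_fun D (fun s => (h j s)%:E).
  by apply/measurable_EFinP; apply: measurableT_comp => //; exact: measurable_funB.
have hint j : \int[mu]_(s in D) (h j s)%:E <= ((2^-1) ^+ j * (1 + fine (mu D)))%:E.
  have p2 : (0 < 2 ^+ j :> R)%R by rewrite exprn_gt0.
  apply: (@le_trans _ _ (\int[mu]_(s in D)
     ((2 ^+ j)%:E * ((w j.+1 s - w j s) ^+ 2)%:E + ((2^-1) ^+ j)%:E))).
    apply: ge0_le_integral => //.
    - apply: emeasurable_funD => //; apply: measurable_funeM.
      by apply/measurable_EFinP; apply: measurable_funX; exact: measurable_funB.
    - move=> s _; rewrite -EFinM -EFinD lee_fin /h.
      rewrite -(real_normK (num_real (w j.+1 s - w j s)%R)) exprVn.
      exact: le_sqr_weight.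
  rewrite ge0_integralD//; last 2 first.
  - by move=> s _; rewrite -EFinM lee_fin mulr_ge0 ?sqr_ge0// ltW.
  - apply: measurable_funeM; apply/measurable_EFinP; apply: measurable_funX.
    exact: measurable_funB.
  rewrite (ge0_integralZl_EFin _ mD); last 3 first.
  - by move=> s _; rewrite lee_fin sqr_ge0.
  - by apply/measurable_EFinP; apply: measurable_funX; exact: measurable_funB.
  - exact: ltW.
  rewrite integral_cst// mulrDr mulr1 EFinD.
  have muf : mu D \is a fin_num by rewrite ge0_fin_numE.
  rewrite EFinM fineK// leeD2r//.
  apply: (@le_trans _ _ ((2 ^+ j)%:E * ((4^-1) ^+ j)%:E)).
    by rewrite lee_wpmul2l ?lee_fin ?(ltW p2)//; exact: wint.
  by rewrite -EFinM lee_fin -exprMn; rewrite (_ : 2 * 4^-1 = 2^-1)%R//; field.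
have half n : (\sum_(0 <= j < n) (2^-1) ^+ j <= 2 :> R)%R.
  have -> : (\sum_(0 <= j < n) (2^-1) ^+ j = 2 - 2 * (2^-1) ^+ n :> R)%R.
    elim: n => [|n IH]; first by rewrite big_geq// expr0 mulr1 subrr.
    by rewrite big_nat_recr//= IH exprS; field.
  by rewrite gerBl mulr_ge0// exprn_ge0.
have c0 : (0 <= 1 + fine (mu D))%R by rewrite addr_ge0// fine_ge0.
have sumfin : \int[mu]_(s in D) (\sum_(0 <= j <oo) (h j s)%:E) < +oo.
  rewrite integral_nneseries//.
  apply: (@le_lt_trans _ _ (2 * (1 + fine (mu D)))%:E); last exact: ltry.
  apply: lime_le.
    by apply: is_cvg_nneseries => j _ _; apply: integral_ge0 => s _; exact: h0.
  apply: nearW => n.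
  apply: (@le_trans _ _ (\sum_(0 <= j < n) ((2^-1) ^+ j * (1 + fine (mu D)))%:E)).
    by apply: lee_sum => j _; exact: hint.
  by rewrite sumEFin lee_fin -mulr_suml ler_wpM2r.
have hsum0 s : 0 <= \sum_(0 <= j <oo) (h j s)%:E.
  by apply: nneseries_ge0 => j _ _; exact: h0.
have sumi : mu.-integrable D (fun s => \sum_(0 <= j <oo) (h j s)%:E).
  apply/integrableP; split.
    by apply: ge0_emeasurable_sum => [j s _ _|j _]; [exact: h0|exact: mh].
  by under eq_integral do rewrite gee0_abs//.
have := integrable_ae mD sumi; apply: filterS => s H Ds; have {H} := H Ds.
set S := (X in X \is a fin_num) => Sfin.
have cs : cvgn (series (fun j => w j.+1 s - w j s)%R).
  apply: normed_cvg; apply: (@nondecreasing_is_cvgn _ _).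
    by apply: nondecreasing_series => j _ _; exact: normr_ge0.
  exists (fine S) => _ [n _ <-].
  rewrite -lee_fin fineK// /series/= -sumEFin.
  by apply: nneseries_lim_ge => j _ _; exact: h0.
have -> : w ^~ s = (fun n => w 0%N s + series (fun j => w j.+1 s - w j s)%R n)%R.
  by apply/funext => n; rewrite /series/= telescope_sumr// addrC subrK.
by apply: is_cvgD => //; exact: is_cvg_cst.
Qed.

End ae_convergence.

Section integral_tools.
Context d (T : measurableType d) (R : realType) (mu : {measure set T -> \bar R}) (D : set T).
Hypothesis mD : measurable D.

Lemma integrable_bounded (f : T -> R) (C : R) : (mu D < +oo)%E -> measurable_fun D f ->
  (forall s, D s -> `|f s| <= C) -> mu.-integrable D (EFin \o f).
Proof.
move=> Dfin mf fC; apply: measurable_bounded_integrable => //.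
by exists C; split; [exact: num_real|move=> z Cz s Ds; exact: le_trans (fC s Ds) (ltW Cz)].
Qed.

Lemma norm_Rintegral_le_cst (f : T -> R) (C r : R) : mu D = r%:E -> mu.-integrable D (EFin \o f) ->
  (forall s, D s -> `|f s| <= C) -> `|\int[mu]_(s in D) f s| <= C * r.
Proof.
move=> Dr fi fC.
have ci : mu.-integrable D (EFin \o cst C) by apply: (@integrable_bounded _ `|C|) => //; rewrite Dr ltry.
apply: (le_trans (le_normr_Rintegral mD fi)).
apply: (@le_trans _ _ (\int[mu]_(s in D) cst C s)).
  by apply: le_Rintegral => //; exact: integrable_norm.
by rewrite Rintegral_cst// Dr.
Qed.

Lemma Rintegral_bounded_cvg (f_ : nat -> T -> R) (f : T -> R) (C : R) : (mu D < +oo)%E ->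
  (forall j, measurable_fun D (f_ j)) -> measurable_fun D f ->
  (forall j s, D s -> `|f_ j s| <= C) ->
  (\forall s \ae mu, D s -> f_ j s @[j --> \oo] --> f s) ->
  mu.-integrable D (EFin \o f) /\
  \int[mu]_(s in D) f_ j s @[j --> \oo] --> \int[mu]_(s in D) f s.
Proof.
move=> Dfin mf_ mf fC cv.
have ci : mu.-integrable D (EFin \o cst C) by apply: (@integrable_bounded _ `|C|).
have := @dominated_convergence _ _ _ mu _ mD (fun j => EFin \o f_ j) (EFin \o f) (EFin \o cst C) _ _ _ ci.
case.
- by move=> j; apply/measurable_EFinP; exact: mf_.
- exact/measurable_EFinP.
- by move: cv; apply: filterS => s H Ds; apply: cvg_EFin; [exact: nearW|exact: H].
- by apply: aeW => s j Ds; rewrite /= lee_fin; exact: fC.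
move=> fi _ If; split => //.
by apply: fine_cvg; rewrite /Rintegral fineK//; exact: integrable_fin_num.
Qed.

Lemma Rintegral_comb (l : nat -> R) (f : nat -> T -> R) N :
  (forall k, mu.-integrable D (EFin \o f k)) ->
  mu.-integrable D (EFin \o (fun s => \sum_(k < N) l k * f k s)) /\
  \int[mu]_(s in D) (\sum_(k < N) l k * f k s) = \sum_(k < N) l k * \int[mu]_(s in D) f k s.
Proof.
move=> fi; elim: N => [|N [Ii IE]].
  under eq_fun do rewrite big_ord0; rewrite big_ord0; split.
    by rewrite (_ : _ \o _ = cst 0%E)//; exact: integrable0.
  by rewrite Rintegral_cst// mul0r.
have li : mu.-integrable D (EFin \o (fun s => l N * f N s)) := integrableZl mD (l N) (fi N).
under eq_fun do rewrite big_ord_recr/=; rewrite big_ord_recr/=; split.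
  exact: (integrableD mD Ii li).
by rewrite RintegralD// IE RintegralZl.
Qed.

Lemma ge0_integral_comb (l : nat -> R) (F : nat -> T -> \bar R) N : (forall k, 0 <= l k) ->
  (forall k, measurable_fun D (F k)) -> (forall k s, D s -> (0 <= F k s)%E) ->
  (\int[mu]_(s in D) \sum_(k < N) (l k)%:E * F k s =
   \sum_(k < N) (l k)%:E * \int[mu]_(s in D) F k s)%E.
Proof.
move=> l0 mF F0; rewrite ge0_integral_sum//.
- apply: eq_bigr => k _; rewrite ge0_integralZl_EFin//; exact: F0.
- by move=> k; apply: measurable_funeM; exact: mF.
- by move=> k s Ds; rewrite mule_ge0 ?lee_fin//; exact: F0.
Qed.

Lemma measurable_fun_add_point d' (T' : measurableType d') (a : T) (f : T -> T') :
  measurable [set a] -> measurable_fun D f -> measurable_fun (a |` D) f.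
Proof. by move=> ma mf; apply/measurable_funU => //; split => //; exact: measurable_fun_set1. Qed.

End integral_tools.

Section mazur.
Context d (T : measurableType d) (R : realType) (m : nat).
Variables (mu : {measure set T -> \bar R}) (D : set T).
Hypothesis mD : measurable D.
Hypothesis muD : (mu D < +oo)%E.
Variables (v : nat -> T -> 'cV[R]_m) (M : R).
Hypothesis mv : forall k i, measurable_fun D (fun s => v k s i 0).
Hypothesis vM : forall k s i, D s -> `|v k s i 0| <= M.

Let trunc_sum (V : zmodType) (f : nat -> V) a b : (a <= b)%N ->
  (forall k, (a <= k)%N -> f k = 0) -> \sum_(k < b) f k = \sum_(k < a) f k.
Proof.
move=> ab f0; rewrite -!(big_mkord xpredT) (big_cat_nat (n := a))//=.
by rewrite [X in _ + X]big_nat_cond [X in _ + X]big1 ?addr0// => k /andP[/andP[/f0]].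
Qed.

(** The convex hull of the tail from [N]. The weights are sequences vanishing from [bd] on, so that
    combinations of different lengths can be added. *)
Let C N := [set w : T -> 'cV[R]_m | exists (bd : nat) (lam : nat -> R),
  [/\ forall k, 0 <= lam k, forall k, (k < N)%N -> lam k = 0,
      forall k, (bd <= k)%N -> lam k = 0, \sum_(k < bd) lam k = 1 &
      forall s, w s = \sum_(k < bd) lam k *: v k s]].

Let C_coord N w : C N w -> exists (bd : nat) (lam : nat -> R),
  [/\ forall k, 0 <= lam k, \sum_(k < bd) lam k = 1 &
      forall i, (fun s => w s i 0) = (fun s => \sum_(k < bd) lam k * v k s i 0)].
Proof.
move=> [bd [lam [l0 _ _ l1 wE]]]; exists bd, lam; split => // i.
by apply/funext => s; rewrite wE summxE; apply: eq_bigr => k _; rewrite mxE.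
Qed.

Let C_meas N w i : C N w -> measurable_fun D (fun s => w s i 0).
Proof.
move=> /C_coord[bd [lam [_ _ ->]]]; apply: measurable_sum => k.
by apply: measurable_funM.
Qed.

Let C_bound N w s i : C N w -> D s -> `|w s i 0| <= M.
Proof.
move=> /C_coord[bd [lam [l0 l1 /(_ i)/(congr1 (@^~ s))/= ->]]] Ds.
apply: le_trans (ler_norm_sum _ _ _) _.
rewrite -[leRHS]mul1r -l1 mulr_suml; apply: ler_sum => k _.
by rewrite normrM ger0_norm// ler_wpM2l// vM.
Qed.

Let sq (w : T -> 'cV[R]_m) s := \sum_i w s i 0 ^+ 2.

Let sq_int (w : T -> 'cV[R]_m) (c : R) :
  (forall i, measurable_fun D (fun s => w s i 0)) ->
  (forall s i, D s -> `|w s i 0| <= c) -> mu.-integrable D (EFin \o sq w).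
Proof.
move=> mw wc; apply: (@integrable_bounded _ _ _ mu _ mD _ (\sum_(i < m) c ^+ 2) muD).
  by apply: measurable_sum => i; exact: measurable_funX.
move=> s Ds; rewrite ger0_norm; last by apply: sumr_ge0 => i _; exact: sqr_ge0.
apply: ler_sum => i _; rewrite -(real_normK (num_real (w s i 0))).
by rewrite lerXn2r ?nnegrE ?wc// (le_trans _ (wc s i Ds)).
Qed.

Let mid (a b : T -> 'cV[R]_m) s : 'cV[R]_m := 2^-1 *: (a s + b s).
Let diff (a b : T -> 'cV[R]_m) s : 'cV[R]_m := a s - b s.
Let q w := \int[mu]_(s in D) sq w s.
Let dd a b := q (diff a b).

Let C_mid N a b : C N a -> C N b -> C N (mid a b).
Proof.
move=> [b1 [l1 [p1 z1 t1 s1 E1]]] [b2 [l2 [p2 z2 t2 s2 E2]]].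
pose n := maxn b1 b2.
have n1 : (b1 <= n)%N by exact: leq_maxl.
have n2 : (b2 <= n)%N by exact: leq_maxr.
exists n, (fun k => 2^-1 * (l1 k + l2 k)); split.
- by move=> k; rewrite mulr_ge0// addr_ge0.
- by move=> k kN; rewrite z1// z2// addr0 mulr0.
- move=> k; rewrite geq_max => /andP[k1 k2].
  by rewrite t1// t2// addr0 mulr0.
- rewrite -mulr_sumr big_split/= (trunc_sum n1 t1) (trunc_sum n2 t2) s1 s2.
  by field.
- move=> s; rewrite /mid E1 E2.
  rewrite -(trunc_sum (f := fun k => l1 k *: v k s) n1); last first.
    by move=> k /t1 ->; rewrite scale0r.
  rewrite -(trunc_sum (f := fun k => l2 k *: v k s) n2); last first.
    by move=> k /t2 ->; rewrite scale0r.
  rewrite -big_split/= scaler_sumr; apply: eq_bigr => k _.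
  by rewrite -scalerDl scalerA.
Qed.

Let C_int a b : C 0%N a -> C 0%N b -> mu.-integrable D (EFin \o sq (diff a b)).
Proof.
move=> Ca Cb; apply: (@sq_int _ (M + M)).
  move=> i; rewrite (_ : (fun s => _) = (fun s => a s i 0 - b s i 0)); last first.
    by apply/funext => s; rewrite /diff !mxE.
  by apply: measurable_funB; [exact: C_meas Ca|exact: C_meas Cb].
move=> s i Ds; rewrite !mxE; apply: le_trans (ler_normB _ _) _.
by apply: lerD; [exact: C_bound Ca Ds|exact: C_bound Cb Ds].
Qed.

Let C_sqi N a : C N a -> mu.-integrable D (EFin \o sq a).
Proof.
move=> Ca; apply: (@sq_int _ M) => [i|s i Ds]; first exact: C_meas Ca.
exact: C_bound Ca Ds.
Qed.

Let parallelogram a b : C 0%N a -> C 0%N b -> q (mid a b) + dd a b / 4 <= (q a + q b) / 2.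
Proof.
move=> Ca Cb; have Cm := C_mid Ca Cb.
have i1 := C_sqi Cm; have i2 := C_int Ca Cb; have i3 := C_sqi Ca; have i4 := C_sqi Cb.
rewrite /dd /q -(RintegralZr _ mD i2) -(RintegralD mD i3 i4) -RintegralD//; last first.
  exact: (integrableZr mD 4^-1 i2).
rewrite -RintegralZr//; last exact: (integrableD mD i3 i4).
rewrite le_eqVlt; apply/orP; left; apply/eqP; apply: eq_Rintegral => s _.
rewrite /sq /mid /diff mulr_suml -!big_split/= mulr_suml; apply: eq_bigr => i _.
by rewrite !mxE; field.
Qed.

(** This takes the place of weak compactness in $L^2$. The weights do not depend on [s], hence the
    same combinations can be formed of velocities and of running costs. *)
Lemma mazur_ae : exists (lam : nat -> nat -> R) (bd : nat -> nat),
  [/\ forall j k, 0 <= lam j k, forall j k, (k < j)%N -> lam j k = 0,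
      forall j, \sum_(k < bd j) lam j k = 1 &
      \forall s \ae mu, D s -> forall i, cvgn (fun j => \sum_(k < bd j) lam j k * v k s i 0)].
Proof.
have C0 N : C N !=set0.
  exists (v N), N.+1, (fun k => (k == N)%:R); split.
  - by move=> k; rewrite ler0n.
  - by move=> k kN; rewrite ltn_eqF.
  - by move=> k kN; rewrite gtn_eqF.
  - rewrite big_ord_recr/= eqxx big1 ?add0r// => k _.
    by rewrite ltn_eqF.
  - move=> s; rewrite big_ord_recr/= eqxx scale1r big1 ?add0r// => k _.
    by rewrite ltn_eqF// scale0r.
have Cdec N N' : (N <= N')%N -> C N' `<=` C N.
  move=> NN' a [bd [l [p z t' s1 E]]]; exists bd, l; split => // k kN.
  by apply: z; exact: leq_trans NN'.
have qb a : C 0%N a -> 0 <= q a <= q (fun=> const_mx M).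
  move=> Ca; apply/andP; split.
    by apply: Rintegral_ge0 => s _; apply: sumr_ge0 => i _; exact: sqr_ge0.
  apply: (le_Rintegral mD (C_sqi Ca)).
    apply: (@sq_int _ `|M|) => [i|s i _]; last by rewrite mxE.
    by under eq_fun do rewrite mxE; exact: measurable_cst.
  move=> s Ds; apply: ler_sum => i _; rewrite mxE -(real_normK (num_real (a s i 0))).
  have aM := C_bound i Ca Ds.
  by rewrite lerXn2r ?nnegrE// (le_trans _ aM).
have e0 j : 0 < 4^-1 ^+ j :> R by rewrite exprn_gt0.
have edec j : 4^-1 ^+ j.+1 <= 4^-1 ^+ j :> R.
  rewrite exprS; apply: ler_piMl; first exact: ltW (e0 j).
  by rewrite invf_le1 ?ler1n.
have [w Hw] := almost_minimal_sequence C0 Cdec C_mid qb parallelogram e0 edec.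
have Cw j : C j (w j) by case: (Hw j).
have Cw0 j : C 0%N (w j) by exact: Cdec (Cw j).
have ex j : exists p : nat * (nat -> R),
  [/\ forall k, 0 <= p.2 k, forall k, (k < j)%N -> p.2 k = 0,
      \sum_(k < p.1) p.2 k = 1 & forall s, w j s = \sum_(k < p.1) p.2 k *: v k s].
  by have [bd [l [p z _ s1 E]]] := Cw j; exists (bd, l).
exists (fun j => (projT1 (cid (ex j))).2), (fun j => (projT1 (cid (ex j))).1).
split; try by move=> j; case: cid => -[bd l] [? ? ? ?].
have cvi : forall i : 'I_m, \forall s \ae mu, D s -> cvgn (fun j => w j s i 0).
  move=> i; apply: (ae_cvg_of_sqr mD muD) => j; first exact: C_meas (Cw j).
  have [_ dj] := Hw j.
  have ci := C_int (Cw0 j) (Cw0 j.+1).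
  apply: (@le_trans _ _ (\int[mu]_(s in D) (sq (diff (w j) (w j.+1)) s)%:E)%E).
    apply: ge0_le_integral => //.
    - by move=> s _; rewrite lee_fin sqr_ge0.
    - apply/measurable_EFinP; apply: measurable_funX.
      by apply: measurable_funB; [exact: C_meas (Cw j.+1)|exact: C_meas (Cw j)].
    - exact: measurable_int ci.
    - move=> s _; rewrite lee_fin /sq (bigD1 i)//= /diff !mxE -sqrrN opprB lerDl.
      by apply: sumr_ge0 => k _; exact: sqr_ge0.
  rewrite -(fineK (integrable_fin_num mD ci)) lee_fin.
  exact: dj.
have : \forall s \ae mu, forall i : 'I_m, D s -> cvgn (fun j => w j s i 0).
  exact: filter_forall.
apply: filterS => s cw Ds i; have := cw i Ds.
rewrite (_ : (fun j => w j s i 0) = (fun j => \sum_(k < (projT1 (cid (ex j))).1)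
  (projT1 (cid (ex j))).2 k * v k s i 0)) //; apply/funext => j.
case: (cid (ex j)) => -[b l] /= [_ _ _ E].
by rewrite E summxE; apply: eq_bigr => k _; rewrite mxE.
Qed.

End mazur.

(** * Lower semicontinuity *)

Lemma cvg_bigsum (T : Type) (F : set_system T) (FF : Filter F) (R : realType) (I : Type) (r : seq I)
    (f : I -> T -> R) (l : I -> R) :
  (forall i, f i x @[x --> F] --> l i) -> \sum_(i <- r) f i x @[x --> F] --> \sum_(i <- r) l i.
Proof.
by move=> fl; apply: cvg_big => [|i _]; [exact: add_continuous|exact: fl].
Qed.

Lemma compact_box (R : realType) m (M : R) : compact [set v : 'cV[R]_m | forall i, `|v i 0| <= M].
Proof.
have -> : [set v : 'cV[R]_m | forall i, `|v i 0| <= M] =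
    trmx @` [set v : 'rV[R]_m | forall i, v ord0 i \in `[-M, M]].
  apply/seteqP; split => [v vM|_ [v vM <-] i].
    exists v^T; last by rewrite trmxK.
    by move=> i /=; rewrite mxE in_itv/= -ler_norml; exact: vM.
  by rewrite mxE ler_norml; have := vM i; rewrite in_itv.
apply: continuous_compact.
  apply: continuous_subspaceT => v; apply: continuous_col => i.
  rewrite (_ : (fun _ => _) = (fun v : 'rV[R]_m => v ord0 i)); last by apply/funext => z; rewrite mxE.
  exact: coord_continuous.
apply: (@rV_compact R m (fun=> [set` `[-M, M]])) => i; exact: segment_compact.
Qed.

Lemma sqr_le_norm (R : realDomainType) (x c : R) : x ^+ 2 <= c -> `|x| <= c + 1.
Proof. by move=> xc; rewrite ler_norml; apply/andP; split; nra. Qed.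

(** The first-order condition for the squared distance along a segment issuing from a closest
    point. *)
Lemma first_order_ge0 (R : realFieldType) (N Q : R) : 0 <= Q ->
  (forall l, 0 < l <= 1 -> 0 <= 2 * l * N + l ^+ 2 * Q) -> 0 <= N.
Proof.
move=> Q0 H; rewrite leNgt; apply/negP => N0.
have d0 : 0 < Q - N by lra.
(* For this [l], if [N < 0], one has [2 N + l Q = N + l N < 0]. *)
have l01 : 0 < - N / (Q - N) <= 1.
  by rewrite divr_gt0 ?oppr_gt0//= ler_pdivrMr//; lra.
have := H _ l01; rewrite leNgt => /negP; apply.
have /andP[l0 _] := l01.
set l := - N / _ in l0 *; have ll : l * (Q - N) = - N by rewrite /l divfK// gt_eqF.
rewrite (_ : 2 * l * N + _ = l * (2 * N + l * Q)); last by ring.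
rewrite pmulr_rlt0//.
have : l * N < 0 by rewrite pmulr_rlt0.
lra.
Qed.

Section minorant.
Context (R : realType) (m : nat).
Implicit Types (f : 'cV[R]_m -> \bar R).

Definition epigraph f : set ('cV[R]_m * R) := [set p | (f p.1 <= p.2%:E)%E].

Lemma closed_epigraph f : lower_semicontinuous f -> closed (epigraph f).
Proof.
move=> lf [v r] cl; rewrite /epigraph/= leNgt; apply/negP => rf.
have [r1 rr1 r1f] : exists2 r1 : R, r < r1 & (r1%:E < f v)%E.
  case: (f v) rf => [x| |] //=.
  - by rewrite lte_fin => rx; exists ((r + x) / 2); rewrite ?lte_fin; lra.
  - by move=> _; exists (r + 1); rewrite ?ltrDl ?ltry.
have [V nV Vf] := lf v _ r1f.
have [[v' r'] [/= ve [Vv' r'r]]] : epigraph f `&` (V `*` [set r' : R | r' < r1]) !=set0.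
  apply: cl; exists (V, [set r' : R | r' < r1]) => //; split => //=.
  by apply: lt_nbhsl.
have := lt_le_trans (Vf _ Vv') ve.
by rewrite lte_fin ltNge (ltW r'r).
Qed.

Lemma convex_epigraph f p p' l : econvex f -> (forall v, (0 <= f v)%E) ->
  0 <= l <= 1 -> epigraph f p -> epigraph f p' ->
  epigraph f (l *: p.1 + (1 - l) *: p'.1, l * p.2 + (1 - l) * p'.2).
Proof.
move=> cf f0 l01; rewrite /epigraph/= => ep ep'; apply: (le_trans (cf _ _ _ l01)).
rewrite [leRHS]EFinD; case/andP: l01 => l0 l1.
by apply: leeD; rewrite EFinM; apply: lee_wpmul2l => //; rewrite lee_fin// subr_ge0.
Qed.

Let sqd (w : 'cV[R]_m) (a : R) (p : 'cV[R]_m * R) := \sum_i (p.1 i 0 - w i 0) ^+ 2 + (p.2 - a) ^+ 2.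

Let sqd_continuous w a : continuous (sqd w a).
Proof.
move=> p; apply: cvgD.
  apply: cvg_bigsum => i; apply: (@continuous_comp _ _ _ (fun p : 'cV[R]_m * R => p.1 i 0 - w i 0)
    (fun x => x ^+ 2)).
    apply: cvgB; last exact: cvg_cst.
    apply: (@continuous_comp _ _ _ (@fst 'cV[R]_m R) (fun v : 'cV[R]_m => v i 0)); first exact: cvg_fst.
    exact: coord_continuous.
  exact: exprn_continuous.
apply: (@continuous_comp _ _ _ (fun p : 'cV[R]_m * R => p.2 - a)
  (fun x => x ^+ 2)); last exact: exprn_continuous.
apply: cvgB; last exact: cvg_cst.
exact: cvg_snd.
Qed.

(** Points no farther than [p0] lie in a compact box, so the minimum over [E] is one over a compact
    set. *)
Lemma closest_point (E : set ('cV[R]_m * R)) w a : closed E -> E !=set0 ->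
  exists2 p, E p & forall p', E p' -> sqd w a p <= sqd w a p'.
Proof.
(* The summand 1 is there because a bound [x^2 <= c] is used in the form [|x| <= c + 1]. *)
move=> cE [p0 Ep0]; set c := sqd w a p0 + 1.
pose box : set ('cV[R]_m * R) := [set v : 'cV[R]_m | forall i, `|v i 0| <= c + \sum_j `|w j 0|] `*`
   [set` `[- (c + `|a|), c + `|a|]].
have inbox p : sqd w a p <= sqd w a p0 -> box p.
  move=> ple; split => /=.
    move=> i; have : `|p.1 i 0 - w i 0| <= c.
      apply: sqr_le_norm; apply: le_trans ple; rewrite /sqd (bigD1 i)//=.
      by rewrite -addrA lerDl addr_ge0 ?sqr_ge0// sumr_ge0// => j _; rewrite sqr_ge0.
    have : `|w i 0| <= \sum_j `|w j 0| by rewrite (bigD1 i)//= lerDl sumr_ge0.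
    have := ler_normB (p.1 i 0 - w i 0) (- w i 0); rewrite normrN opprK subrK.
    by move=> h1 h2 h3; apply: (le_trans h1); rewrite lerD.
  rewrite in_itv/= -ler_norml; have : `|p.2 - a| <= c.
    apply: sqr_le_norm; apply: le_trans ple; rewrite /sqd lerDr.
    by apply: sumr_ge0 => j _; rewrite sqr_ge0.
  have := ler_normB (p.2 - a) (- a); rewrite normrN opprK subrK.
  by move=> h1 h2; apply: (le_trans h1); rewrite lerD2r.
have cbox : compact (E `&` box).
  rewrite setIC; apply: compact_closedI => //.
  by apply: compact_setX; [exact: compact_box|exact: segment_compact].
have [p pE pmin] := compact_EVT_min (ex_intro _ p0 (conj Ep0 (inbox _ (lexx _)))) cbox
  (continuous_subspaceT (@sqd_continuous w a)).
move: pE; rewrite inE => -[Ep _]; exists p => // p' Ep'.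
have pp0 : sqd w a p <= sqd w a p0 by apply: pmin; rewrite inE; split => //; exact: inbox.
have [p'p0|/ltW] := leP (sqd w a p') (sqd w a p0); last exact: le_trans.
by apply: pmin; rewrite inE; split => //; exact: inbox.
Qed.

(* The point (w, a) is separated from the epigraph of [f] at its closest point (p, q);
   if the separating hyperplane is vertical, that is [q = a], then [f >= 0] makes any
   multiple of it an affine minorant on the domain of [f]. *)
Lemma affine_minorant f w a : lower_semicontinuous f -> econvex f ->
  (forall v, (0 <= f v)%E) -> (a%:E < f w)%E ->
  exists (c : R) (xi : 'I_m -> R),
    (forall v : 'cV[R]_m, ((c + \sum_i xi i * v i 0)%:E <= f v)%E) /\
    a < c + \sum_i xi i * w i 0.
Proof.
move=> lf cf f0 afw.
have [E0|/nonemptyPn E0] := pselect (epigraph f !=set0); last first.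
  (* An empty epigraph means that [f] is [+oo] everywhere, and a constant above [a] will do. *)
  exists (a + 1), (fun=> 0); split => [v|]; last by rewrite big1 => [|i _]; rewrite ?mul0r//; lra.
  case fv: (f v) => [r| |]; rewrite ?leey//; last by have := f0 v; rewrite fv.
  by have : epigraph f (v, r); [rewrite /epigraph/= fv lexx|rewrite E0].
have [[p q] /= Ep pmin] := closest_point w a (closed_epigraph lf) E0.
pose N (v : 'cV[R]_m) := \sum_i (p i 0 - w i 0) * (v i 0 - p i 0).
(* The variational inequality at the closest point: no segment from [(p, q)] into the epigraph
   approaches [(w, a)]. *)
have fo v r : (f v <= r%:E)%E -> 0 <= N v + (q - a) * (r - q).
  move=> vr; pose Q := \sum_i (v i 0 - p i 0) ^+ 2 + (r - q) ^+ 2.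
  apply: (@first_order_ge0 _ _ Q) => [|l /andP[l0 l1]].
    by rewrite addr_ge0 ?sqr_ge0// sumr_ge0// => i _; rewrite sqr_ge0.
  have l01 : 0 <= l <= 1 by rewrite (ltW l0).
  have := pmin _ (convex_epigraph (p := (v, r)) (p' := (p, q)) cf f0 l01 vr Ep).
  rewrite -subr_ge0; congr (_ <= _).
  rewrite /sqd/= /N /Q !mulrDr !mulr_sumr opprD addrACA -sumrB addrACA -big_split/=.
  congr (_ + _); last by ring.
  by apply: eq_bigr => i _; rewrite !mxE; ring.
have Nw : N w = - \sum_i (p i 0 - w i 0) ^+ 2.
  by rewrite /N -sumrN; apply: eq_bigr => i _; ring.
have Nv v : N v = \sum_i (p i 0 - w i 0) * v i 0 - \sum_i (p i 0 - w i 0) * p i 0.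
  by rewrite /N -sumrB; apply: eq_bigr => i _; ring.
have scale k (v : 'cV[R]_m) :
    \sum_i (- k * (p i 0 - w i 0)) * v i 0 = - k * \sum_i (p i 0 - w i 0) * v i 0.
  by rewrite mulr_sumr; apply: eq_bigr => i _; ring.
(* The epigraph is stable upwards, so it contains [(p, q + 1)]. *)
have aq : a <= q.
  have := fo p (q + 1); rewrite {1}/N big1 => [H|i _]; last by rewrite subrr mulr0.
  have /H : (f p <= (q + 1)%:E)%E by apply: (le_trans Ep); rewrite lee_fin lerDl.
  by rewrite add0r addrAC subrr add0r mulr1 subr_ge0.
have S0 : 0 <= \sum_i (p i 0 - w i 0) ^+ 2 by apply: sumr_ge0 => i _; exact: sqr_ge0.
have [qa|qa] := eqVneq q a.
  have S1 : 0 < \sum_i (p i 0 - w i 0) ^+ 2.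
    rewrite lt_neqAle S0 andbT eq_sym; apply/eqP => S1.
    have pw : p = w.
      apply/matrixP => i j; rewrite ord1; apply/eqP; rewrite -subr_eq0 -sqrf_eq0.
      by have /eqP := S1; rewrite psumr_eq0 => [/allP/(_ i (mem_index_enum _))|k _]//; rewrite sqr_ge0.
    by move: Ep afw; rewrite /epigraph/= qa pw => /le_lt_trans/[apply]; rewrite ltxx.
  set S := \sum_i _ in S0 S1 Nw.
  (* The multiple of the vertical hyperplane that takes the value [|a| + 1] at [w]. *)
  pose k := (`|a| + 1) / S.
  have k0 : 0 < k by rewrite divr_gt0// ltr_wpDl.
  have shape (v : 'cV[R]_m) : k * (\sum_i (p i 0 - w i 0) * p i 0) +
      \sum_i (- k * (p i 0 - w i 0)) * v i 0 = - k * N v.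
    by rewrite Nv scale; ring.
  exists (k * (\sum_i (p i 0 - w i 0) * p i 0)), (fun i => - k * (p i 0 - w i 0)); split.
    move=> v; rewrite shape; case fv: (f v) => [r| |]; rewrite ?leey//; last by have := f0 v; rewrite fv.
    have := fo v r; rewrite fv lexx qa subrr mul0r addr0 => /(_ isT) Nv0.
    have := f0 v; rewrite fv !lee_fin; apply: le_trans.
    by rewrite mulNr oppr_le0 mulr_ge0// ltW.
  rewrite shape Nw mulrNN /k divfK ?gt_eqF//.
  by have := ler_norm a; lra.
have t0 : 0 < q - a by rewrite subr_gt0 lt_neqAle aq andbT eq_sym.
(* The hyperplane is not vertical, and dividing by [q - a] makes it the graph of an affine
   function. *)
pose k := (q - a)^-1.
have k0 : 0 < k by rewrite invr_gt0.
have shape (v : 'cV[R]_m) : q + k * (\sum_i (p i 0 - w i 0) * p i 0) +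
    \sum_i (- k * (p i 0 - w i 0)) * v i 0 = q - k * N v.
  by rewrite Nv scale; ring.
exists (q + k * (\sum_i (p i 0 - w i 0) * p i 0)), (fun i => - k * (p i 0 - w i 0)); split.
  move=> v; rewrite shape; case fv: (f v) => [r| |]; rewrite ?leey//; last by have := f0 v; rewrite fv.
  have := fo v r; rewrite fv lexx => /(_ isT) H.
  rewrite lee_fin lerBlDr -lerBlDl -(ler_pM2l t0) mulrA mulfV ?gt_eqF// mul1r; lra.
rewrite shape Nw mulrN opprK; apply: (@lt_le_trans _ _ q); first by lra.
by rewrite lerDl mulr_ge0// ltW.
Qed.

End minorant.

Lemma affine_continuous (R : realType) m (c : R) (xi : 'I_m -> R) :
  continuous (fun v : 'cV[R]_m => c + \sum_i xi i * v i 0).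
Proof.
move=> v; apply: (@cvgD _ _ _ (nbhs v) _ (fun=> c) (fun v : 'cV[R]_m => \sum_i xi i * v i 0)).
  exact: cvg_cst.
apply: (@cvg_bigsum _ (nbhs v)) => i; apply: (@cvgM _ _ (nbhs v)); first exact: cvg_cst.
exact: (@coord_continuous _ _ _ i 0 v).
Qed.

(** Each [v] has a neighbourhood that works for all [z'] near [z]; compactness of the box makes the
    neighbourhood of [z] uniform in [v]. The loss [e] pays for this. *)
Lemma minorant_near (R : realType) (m : nat) (Z : topologicalType) (f : Z * 'cV[R]_m -> \bar R)
    (z : Z) (c : R) (xi : 'I_m -> R) (M e : R) :
  lower_semicontinuous f ->
  (forall v : 'cV[R]_m, ((c + \sum_i xi i * v i 0)%:E <= f (z, v))%E) -> 0 < e ->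
  \forall z' \near z, forall v : 'cV[R]_m, (forall i, `|v i 0| <= M) ->
    ((c + \sum_i xi i * v i 0 - e)%:E < f (z', v))%E.
Proof.
move=> lf fl e0; pose l (v : 'cV[R]_m) := c + \sum_i xi i * v i 0.
apply: (compact_near_coveringP _).1 (@compact_box R m M) _ _ (fun z' v => ((l v - e)%:E < f (z', v))%E) _ _ => v vM.
have [V [[A B] /= [nA nB] AB] Vf] : exists2 V, nbhs (z, v) V & forall y, V y -> ((l v - e / 2)%:E < f y)%E.
  by apply: lf; apply: lt_le_trans (fl v); rewrite lte_fin ltrBlDr ltrDl divr_gt0.
have nl : \forall v' \near v, `|l v - l v'| < e / 2.
  by apply: (cvgr_dist_lt l (l v) (@affine_continuous _ _ c xi v)); rewrite divr_gt0.
exists (B `&` [set v' | `|l v - l v'| < e / 2], A); first by split => //=; exact: filterI.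
move=> [v' z'] [/= [Bv' lv'] Az'].
apply: (lt_trans _ (Vf (z', v') _)); last exact: AB.
by rewrite lte_fin; move: lv'; rewrite ltr_norml => /andP[]; lra.
Qed.

(** The combination mixes values of [f] at different [z_ k], so convexity of [f (z, _)] does not
    apply to it directly. An affine minorant valid near [z] does commute with the combination. *)
Lemma convex_comb_lower_bound (R : realType) (m : nat) (Z : topologicalType)
    (f : Z * 'cV[R]_m -> \bar R) (z_ : nat -> Z) (z : Z) (v : nat -> 'cV[R]_m) (w : 'cV[R]_m) (M a : R)
    (lam : nat -> nat -> R) (bd : nat -> nat) :
  lower_semicontinuous f -> econvex (fun v => f (z, v)) -> (forall p, (0 <= f p)%E) ->
  z_ k @[k --> \oo] --> z -> (forall k i, `|v k i 0| <= M) ->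
  (forall j k, 0 <= lam j k) -> (forall j k, (k < j)%N -> lam j k = 0) ->
  (forall j, \sum_(k < bd j) lam j k = 1) ->
  (forall i, \sum_(k < bd j) lam j k * v k i 0 @[j --> \oo] --> w i 0) ->
  (a%:E < f (z, w))%E ->
  \forall j \near \oo, (a%:E <= \sum_(k < bd j) (lam j k)%:E * f (z_ k, v k))%E.
Proof.
move=> lf cf f0 zz vM l0 lz l1 vw afw.
have lfz : lower_semicontinuous (fun v => f (z, v)).
  move=> v0 a0 /lf[V [[A B] /= [nA nB] AB] Vf]; exists B => // y By.
  by apply: Vf; apply: AB; split => //=; exact: nbhs_singleton.
have [c [xi [fl lw]]] := affine_minorant lfz cf (fun v => f0 (z, v)) afw.
set l := c + _ in lw.
have e0 : 0 < (l - a) / 2 by lra.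
have [N _ HN] := zz _ (minorant_near M lf fl e0).
have cvl : c + \sum_i xi i * (\sum_(k < bd j) lam j k * v k i 0) @[j --> \oo] --> l.
  apply: cvgD; first exact: cvg_cst.
  by apply: cvg_bigsum => i; apply: cvgM; [exact: cvg_cst|exact: vw].
near=> j.
have close : l - (l - a) / 2 < c + \sum_i xi i * (\sum_(k < bd j) lam j k * v k i 0).
  near: j; apply: (cvgr_gt l cvl); lra.
have Nj : (N <= j)%N by near: j; exact: nbhs_infty_ge.
(* Half of the margin [l - a] is lost to the approximate minorant, half to the convergence of the
   combinations. *)
have -> : a = l - (l - a) / 2 - (l - a) / 2 by field.
apply: (@le_trans _ _ (\sum_(k < bd j) (lam j k)%:E * (c + \sum_i xi i * v k i 0 - (l - a) / 2)%:E)%E).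
  rewrite [leRHS](_ : _ = (\sum_(k < bd j) lam j k * (c + \sum_i xi i * v k i 0 - (l - a) / 2))%:E);
    last by rewrite -sumEFin; apply: eq_bigr => k _; rewrite EFinM.
  rewrite lee_fin.
  have -> : \sum_(k < bd j) lam j k * (c + \sum_i xi i * v k i 0 - (l - a) / 2) =
      c + \sum_i xi i * (\sum_(k < bd j) lam j k * v k i 0) - (l - a) / 2.
    rewrite (eq_bigr (fun k : 'I_(bd j) => lam j k * (c - (l - a) / 2) + \sum_i xi i * (lam j k * v k i 0))).
      rewrite big_split/= -mulr_suml l1 mul1r exchange_big/= addrAC; congr (_ + _ - _).
      by apply: eq_bigr => i _; rewrite mulr_sumr.
    move=> k _; rewrite addrAC mulrDr mulr_sumr; congr (_ + _).
    by apply: eq_bigr => i _; ring.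
  by rewrite lerB// ltW.
apply: lee_sum => k _; have [kj|jk] := ltnP k j; first by rewrite lz// !mul0e.
apply: lee_wpmul2l; first by rewrite lee_fin.
by apply: ltW; apply: (HN k) => //=; exact: leq_trans jk.
Unshelve. all: by end_near. Qed.

(** * Ascoli's theorem *)

Section cluster_pointwise.
Import ArrowAsProduct.

(** Tychonoff's theorem gives a cluster point for an arbitrary index set, where a convergent
    subsequence need not exist; it is approached on finite sets of indices. *)
Lemma cluster_pointwise (R : realType) (I : eqType) (Z : nat -> I -> R) (K : R) :
  (forall k i, `|Z k i| <= K) ->
  exists y : I -> R, forall (r : seq I) (e : R) (N : nat), 0 < e ->
    exists2 k, (N <= k)%N & forall i, i \in r -> `|Z k i - y i| < e.
Proof.
move=> ZK.
have cK := @tychonoff I (fun=> R : topologicalType) (fun=> [set` `[-K, K]])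
  (fun=> @segment_compact R (-K) K).
have [|y [_ cy]] := cK (Z k @[k --> \oo]) _ .
  by exists 0%N => // k _ i /=; rewrite in_itv/= -ler_norml.
exists y => r e N e0.
have nr : nbhs y [set f : I -> R | forall i, i \in r -> `|f i - y i| < e].
  elim: r => [|j r IH]; first by apply: filterS filterT.
  have nj : nbhs y (proj j @^-1` [set x : R | `|x - y j| < e]).
    apply: (@proj_continuous I (fun=> R : topologicalType) j y).
    by apply: filterS (nbhsx_ballx (y j) e e0) => x; rewrite /ball/= distrC.
  apply: filterS (filterI IH nj) => f [fr fj] i; rewrite in_cons => /orP[/eqP->|]; first exact: fj.
  exact: fr.
have [_ [[k /= Nk <-] kr]] : [set Z k | k in [set k | (N <= k)%N]] `&`
    [set f : I -> R | forall i, i \in r -> `|f i - y i| < e] !=set0.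
  apply: cy nr; exists N => // k /= Nk; by exists k.
by exists k.
Qed.

End cluster_pointwise.

Lemma three_point_estimate (R : realFieldType) (C d e x1 x2 y1 y2 : R) : 0 <= C -> d <= e ->
  `|y1 - y2| <= C * d -> `|x1 - x2| <= C * d -> `|x2 - y2| < e -> `|x1 - y1| <= (2 * C + 1) * e.
Proof.
move=> C0 de; have := ler_wpM2l C0 de.
rewrite !ler_norml ltr_norml => ? /andP[? ?] /andP[? ?] /andP[? ?]; apply/andP; split; lra.
Qed.

(** Closeness to the cluster point on a grid of mesh [j.+1^-1] spreads to the whole interval by the
    common Lipschitz constant. The indices [phi j] need not increase, but [j <= phi j] lets them
    inherit tail estimates. *)
Lemma ascoli_lipschitz (R : realType) n (a b : R) (Y : nat -> R -> 'cV[R]_n) (K C : R) :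
  (forall k s i, s \in `[a, b] -> `|Y k s i 0| <= K) -> 0 <= C ->
  (forall k s s' i, s \in `[a, b] -> s' \in `[a, b] ->
    `|Y k s i 0 - Y k s' i 0| <= C * `|s - s'|) ->
  exists (y : R -> 'cV[R]_n) (phi : nat -> nat),
    [/\ forall j, (j <= phi j)%N,
        forall s s' i, s \in `[a, b] -> s' \in `[a, b] -> `|y s i 0 - y s' i 0| <= C * `|s - s'| &
        forall s, s \in `[a, b] -> Y (phi j) s @[j --> \oo] --> y s].
Proof.
move=> YK C0 YC.
pose Z k (p : R * 'I_n) := if p.1 \in `[a, b] then Y k p.1 p.2 0 else 0.
have ZK k p : `|Z k p| <= `|K|.
  by rewrite /Z; case: ifP => [/YK H|_]; [exact: le_trans (H _ _) (ler_norm _)|rewrite normr0].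
have [y0 Hy0] := cluster_pointwise ZK.
pose y s : 'cV[R]_n := \col_i y0 (s, i).
have yC s s' i : s \in `[a, b] -> s' \in `[a, b] -> `|y s i 0 - y s' i 0| <= C * `|s - s'|.
  move=> sI s'I; apply/ler_addgt0Pr => e e0; have e20 : 0 < e / 2 by rewrite divr_gt0.
  have [k _ H] := Hy0 [:: (s, i); (s', i)] _ 0%N e20.
  have := H (s, i); have := H (s', i); rewrite /Z/= sI s'I !inE !eqxx orbT => /(_ isT) h1 /(_ isT) h2.
  have h3 := YC k s s' i sI s'I; rewrite !mxE; move: h1 h2 h3.
  rewrite !ltr_norml !ler_norml => /andP[? ?] /andP[? ?] /andP[? ?]; apply/andP; split; lra.
have ex j : exists k, (j <= k)%N /\ forall s i, s \in `[a, b] ->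
    `|Y k s i 0 - y s i 0| <= (2 * C + 1) / j.+1%:R.
  have j0 : 0 < j.+1%:R :> R by rewrite ltr0n.
  pose node l := a + l%:R / j.+1%:R.
  have j1 : 0 < j.+1%:R^-1 :> R by rewrite invr_gt0.
  (* The node just below [s] has the index [Num.truncn ((s - a) * j.+1%:R)], hence the range of
     [l]. *)
  pose nodes := [seq (node l, i) | l <- iota 0 (Num.truncn ((b - a) * j.+1%:R)).+1,
    i <- enum 'I_n].
  have [k jk H] := Hy0 nodes _ j j1.
  exists k; split => // s i sI; have := sI; rewrite in_itv/= => /andP[as_ sb].
  have sa0 : 0 <= (s - a) * j.+1%:R by rewrite mulr_ge0 ?subr_ge0// ltW.
  pose l := Num.truncn ((s - a) * j.+1%:R).
  have /andP[l1 l2] := truncn_itv sa0; rewrite -/l in l1 l2.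
  have ns : node l <= s by rewrite /node -lerBrDl ler_pdivrMr.
  have sn : s <= node l + j.+1%:R^-1.
    rewrite /node -addrA (_ : l%:R / _ + _ = l.+1%:R / j.+1%:R) -?lerBlDl.
      by rewrite ler_pdivlMr// ltW.
    by rewrite -[l.+1%:R]natr1 mulrDl mul1r.
  have nI : node l \in `[a, b].
    by rewrite in_itv/= (le_trans ns sb) andbT /node lerDl divr_ge0.
  have := H (node l, i); rewrite /Z/= nI.
  have /[swap]/[apply] : (node l, i) \in nodes.
    apply/allpairsP; exists (l, i); split; rewrite ?mem_enum// mem_iota leq0n add0n ltnS.
    by apply: le_truncn; rewrite ler_wpM2r ?lerB// ltW.
  move=> h4; have := YC k s _ i sI nI; have := yC s _ i sI nI; move: h4; rewrite /y !mxE.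
  have h1 : `|s - node l| <= j.+1%:R^-1 by rewrite ger0_norm ?subr_ge0// lerBlDl.
  by move=> h4 h2 h3; exact: three_point_estimate h1 h2 h3 h4.
have [phi Hphi] := choice ex.
exists y, phi; split => //; first by move=> j; case: (Hphi j).
move=> s sI; apply/cvg_ballP => e e0.
have C1 : 0 < 2 * C + 1 by lra.
have d0 : 0 < e / (2 * C + 1) by rewrite divr_gt0.
apply: filterS (near_infty_natSinv_lt (PosNum d0)) => j /= je.
split=> // i k; rewrite ord1 /ball/= distrC.
have [_ /(_ s i sI)/le_lt_trans] := Hphi j; apply.
by rewrite mulrC -ltr_pdivlMr.
Qed.

(** * Limits of trajectories *)

Lemma le_limn_einf (R : realType) (u : (\bar R)^nat) (f : \bar R) : (forall k, (0 <= u k)%E) ->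
  (forall a : R, (a%:E < f)%E -> \forall j \near \oo, (a%:E <= u j)%E) -> (f <= limn_einf u)%E.
Proof.
move=> u0 H; rewrite limn_einf_lim.
have low a : (a%:E < f)%E -> (a%:E <= limn (einfs u))%E.
  move=> /H[N _ HN]; apply: lime_ge; first exact: is_cvg_einfs.
  exists N => // n Nn; apply: le_ereal_inf_tmp => _ [k nk <-].
  by apply: HN => /=; exact: leq_trans nk.
have l0 : (0 <= limn (einfs u))%E.
  apply: lime_ge; first exact: is_cvg_einfs.
  by apply: nearW => n; apply: le_ereal_inf_tmp => _ [k nk <-].
case: f H low => [r| |] H low; last by rewrite leNye.
- by apply/lee_addgt0Pr => e e0; rewrite -leeBlDr// -EFinB; apply: low; rewrite lte_fin ltrBlDr ltrDl.
- by rewrite leye_eq; apply/eqP/eqyP => e e0; apply: low; rewrite ltry.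
Qed.

Lemma limn_einf_le_cst (R : realType) (u : (\bar R)^nat) (b : \bar R) :
  (\forall j \near \oo, (u j <= b)%E) -> (limn_einf u <= b)%E.
Proof.
move=> [N _ H]; rewrite limn_einf_lim; apply: lime_le; first exact: is_cvg_einfs.
exists N => // n Nn; apply: le_trans (H n Nn).
by apply: ereal_inf_lbound; exists n => /=.
Qed.

(** Fatou's lemma with its pointwise hypothesis in the form that [convex_comb_lower_bound] delivers,
    namely real lower bounds valid eventually. *)
Lemma fatou_bound d (T : measurableType d) (R : realType) (mu : {measure set T -> \bar R}) (D : set T)
    (f : T -> \bar R) (F : nat -> T -> \bar R) (b : \bar R) : measurable D ->
  measurable_fun D f -> (forall s, D s -> (0 <= f s)%E) ->
  (forall j, measurable_fun D (F j)) -> (forall j s, D s -> (0 <= F j s)%E) ->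
  (\forall s \ae mu, D s -> forall a : R, (a%:E < f s)%E -> \forall j \near \oo, (a%:E <= F j s)%E) ->
  (\forall j \near \oo, (\int[mu]_(s in D) F j s <= b)%E) -> (\int[mu]_(s in D) f s <= b)%E.
Proof.
move=> mD mf f0 mF F0 H Hb.
apply: (@le_trans _ _ (\int[mu]_(s in D) limn_einf (F^~ s))%E).
  apply: ae_ge0_le_integral => //.
  - move=> s Ds; rewrite limn_einf_lim; apply: lime_ge; first exact: is_cvg_einfs.
    by apply: nearW => n; apply: le_ereal_inf_tmp => _ [k nk <-]; exact: F0.
  - apply: (@measurableT_comp _ _ _ _ _ _ (@oppe R)); first exact: oppe_measurable.
    apply: measurable_fun_limn_esup => j.
    by apply: (@measurableT_comp _ _ _ _ _ _ (@oppe R)); first exact: oppe_measurable.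
  - by move: H; apply: filterS => s H Ds; apply: le_limn_einf => [k|]; [exact: F0|exact: H].
apply: (le_trans (fatou mu mD mF F0)); exact: limn_einf_le_cst.
Qed.

Section tail_combinations.
Context {R : realType} (lam : nat -> nat -> R) (bd : nat -> nat).
Hypothesis lam0 : forall j k, 0 <= lam j k.
Hypothesis lam_tail : forall j k, (k < j)%N -> lam j k = 0.
Hypothesis lam1 : forall j, \sum_(k < bd j) lam j k = 1.

(** Averages whose weights in row [j] sit on the indices [k >= j] see only the tail of the
    sequence. *)
Lemma tail_comb_cvg (a : nat -> R) (l : R) : a k @[k --> \oo] --> l ->
  \sum_(k < bd j) lam j k * a k @[j --> \oo] --> l.
Proof.
move=> al; apply/cvgrPdist_le => e e0.
have /cvgrPdist_le/(_ e e0)[N _ HN] := al.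
exists N => // j /= Nj.
have -> : l = \sum_(k < bd j) lam j k * l by rewrite -mulr_suml lam1 mul1r.
rewrite -sumrB (le_trans (ler_norm_sum _ _ _))//.
apply: (@le_trans _ _ (\sum_(k < bd j) lam j k * e)); last by rewrite -mulr_suml lam1 mul1r.
apply: ler_sum => k _; rewrite -mulrBr normrM ger0_norm//.
have [kj|jk] := ltnP k j; first by rewrite lam_tail// !mul0r.
by rewrite ler_wpM2l//; apply: HN => /=; exact: leq_trans jk.
Qed.

Lemma comb_norm_le (a : nat -> R) (M : R) j : (forall k, `|a k| <= M) ->
  `|\sum_(k < bd j) lam j k * a k| <= M.
Proof.
move=> aM; rewrite (le_trans (ler_norm_sum _ _ _))//.
rewrite (_ : M = \sum_(k < bd j) lam j k * M); last by rewrite -mulr_suml lam1 mul1r.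
by apply: ler_sum => k _; rewrite normrM ger0_norm// ler_wpM2l.
Qed.

Lemma tail_comb_le (r : nat -> \bar R) (b e : R) (N : nat) j : 0 <= e ->
  (forall k, (N <= k)%N -> (r k <= (b + e)%:E)%E) -> (N <= j)%N ->
  (\sum_(k < bd j) (lam j k)%:E * r k <= (b + e)%:E)%E.
Proof.
move=> e0 H Nj.
have -> : (b + e)%:E = (\sum_(k < bd j) (lam j k)%:E * (b + e)%:E)%E.
  under eq_bigr do rewrite -EFinM.
  by rewrite sumEFin -mulr_suml lam1 mul1r.
apply: lee_sum => k _; have [kj|jk] := ltnP k j; first by rewrite lam_tail// !mul0e.
by apply: lee_wpmul2l; rewrite ?lee_fin//; apply: H; exact: leq_trans jk.
Qed.

End tail_combinations.

Section convex_cone.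
Context {R : realType} (m : nat) (U : set 'cV[R]_m).
Hypothesis U0 : U !=set0.
Hypothesis Ucone : forall u (l : R), U u -> 0 < l -> U (l *: u).
Hypothesis Uconvex : convex_set (U : set (convex_lmodType 'cV[R]_m)).
Hypothesis Uclosed : closed U.

Lemma convex_coneD u v : U u -> U v -> U (u + v).
Proof.
move=> Uu Uv.
have h0 : 0 <= (2^-1 : R) by rewrite invr_ge0.
have h1 : (2^-1 : R) <= 1 by rewrite invf_le1 ?ler1n.
have /set_mem mid := Uconvex (Itv01 h0 h1) (mem_set Uu) (mem_set Uv).
have : U (2 *: (2^-1 *: u + (1 - 2^-1) *: v)) by apply: Ucone mid _.
by rewrite scalerDr !scalerA mulrBr mulr1 mulfV ?pnatr_eq0// (_ : 2 - 1 = 1) ?scale1r//; ring.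
Qed.

Lemma convex_cone_closed (u : 'cV[R]_m) (v : nat -> 'cV[R]_m) : (forall k, U (v k)) ->
  (forall i, v k i 0 @[k --> \oo] --> u i 0) -> U u.
Proof.
move=> Uv vu; suff cvu : v k @[k --> \oo] --> u.
  by apply: (closed_cvg _ Uclosed _ _ cvu); exists 0%N => // k _; exact: Uv.
apply/cvg_ballP => e e0.
have : \forall k \near \oo, forall i, ball (u i 0) e (v k i 0).
  by apply: filter_forall => i; apply: (cvg_ball (vu i)).
by apply: filterS => k H; split=> // i j; rewrite ord1.
Qed.

(** The cone is stable under positive factors only; 0 enters as the limit of [u / (k + 1)] and
    starts the sums below. *)
Lemma convex_cone0 : U 0.
Proof.
have [u Uu] := U0.
apply: (@convex_cone_closed 0 (fun k => k.+1%:R^-1 *: u)).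
  by move=> k; apply: Ucone.
move=> i; rewrite mxE -(mul0r (u i 0)); under eq_fun do rewrite mxE.
apply: cvgM; [exact: cvg_harmonic|exact: cvg_cst].
Qed.

Lemma convex_cone_sum (l : nat -> R) (v : nat -> 'cV[R]_m) N : (forall k, 0 <= l k) ->
  (forall k, U (v k)) -> U (\sum_(k < N) l k *: v k).
Proof.
move=> l0 Uv; elim: N => [|N IH]; first by rewrite big_ord0; exact: convex_cone0.
rewrite big_ord_recr/=; have [->|lN] := eqVneq (l N) 0; first by rewrite scale0r addr0.
by apply: convex_coneD => //; apply: Ucone => //; rewrite lt_neqAle eq_sym lN l0.
Qed.

End convex_cone.

Lemma norm_clamp_le (R : realDomainType) (M x : R) : 0 <= M -> `|Num.max (- M) (Num.min M x)| <= M.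
Proof. by move=> M0; rewrite ler_norml le_max lexx/= ge_max ge_min lexx/= andbT; lra. Qed.

Lemma clamp_id (R : realDomainType) (M x : R) : `|x| <= M -> Num.max (- M) (Num.min M x) = x.
Proof. by rewrite ler_norml => /andP[? ?]; rewrite min_r// max_r. Qed.

(** The limit superior, clamped to [[-M, M]], is measurable and bounded at every point, also where
    the combinations diverge, and equals the limit where there is one. *)
Lemma mazur_limit d (T : measurableType d) (R : realType) (m : nat) (mu : {measure set T -> \bar R})
    (D : set T) (v : nat -> T -> 'cV[R]_m) (M : R) : measurable D -> (mu D < +oo)%E ->
  (forall k i, measurable_fun D (fun s => v k s i 0)) -> 0 <= M ->
  (forall k s i, D s -> `|v k s i 0| <= M) ->
  exists (lam : nat -> nat -> R) (bd : nat -> nat) (u : T -> 'cV[R]_m),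
  [/\ [/\ forall j k, 0 <= lam j k, forall j k, (k < j)%N -> lam j k = 0 &
          forall j, \sum_(k < bd j) lam j k = 1],
      forall i, measurable_fun D (fun s => u s i 0),
      forall s i, `|u s i 0| <= M &
      \forall s \ae mu, D s ->
        forall i, \sum_(k < bd j) lam j k * v k s i 0 @[j --> \oo] --> u s i 0].
Proof.
move=> mD muD mv M0 vM.
have [lam [bd [lam0 lamt lam1 cv]]] := mazur_ae mD muD mv vM.
pose w j s i := \sum_(k < bd j) lam j k * v k s i 0.
have wM j s i : D s -> `|w j s i| <= M.
  by move=> Ds; apply: (comb_norm_le lam0 lam1 (a := fun k => v k s i 0)) => k; exact: vM.
exists lam, bd, (fun s => \col_i Num.max (- M) (Num.min M (limn_sup (fun j => w j s i)))); split => //.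
- move=> i; under eq_fun do rewrite mxE.
  apply: measurable_maxr; first exact: measurable_cst.
  apply: measurable_minr; first exact: measurable_cst.
  apply: measurable_fun_limn_sup => [s Ds|s Ds|j].
  + by exists M => _ [j _ <-]; have := wM j s i Ds; rewrite ler_norml => /andP[].
  + by exists (- M) => _ [j _ <-]; have := wM j s i Ds; rewrite ler_norml => /andP[].
  + by apply: measurable_sum => k; apply: measurable_funM; [exact: measurable_cst|exact: mv].
- by move=> s i; rewrite mxE norm_clamp_le.
- move: cv; apply: filterS => s cs Ds i; have ci := cs Ds i.
  rewrite mxE (cvg_limn_supE ci) clamp_id//.
  rewrite ler_norml; apply/andP; split.
    apply: limr_ge => //; apply: nearW => j; have := wM j s i Ds.
    by rewrite ler_norml => /andP[].
  apply: limr_le => //; apply: nearW => j; have := wM j s i Ds.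
  by rewrite ler_norml => /andP[].
Qed.

Lemma max_contract (R : realDomainType) (a x y : R) :
  `|Num.max a x - Num.max a y| <= `|x - y|.
Proof.
have := ler_norm (x - y); have := ler_norm (y - x); rewrite (distrC y x).
by rewrite ler_norml; case: (leP a x) => ?; case: (leP a y) => ? ? ?; apply/andP; split; lra.
Qed.

Lemma min_contract (R : realDomainType) (a x y : R) :
  `|Num.min a x - Num.min a y| <= `|x - y|.
Proof.
have := ler_norm (x - y); have := ler_norm (y - x); rewrite (distrC y x).
by rewrite ler_norml; case: (leP a x) => ?; case: (leP a y) => ? ? ?; apply/andP; split; lra.
Qed.

(** Composing the limit with the projection of the line onto [[a, b]], a contraction, extends it to
    a continuous function on the line without changing the Lipschitz constant. *)
Lemma ascoli_continuous (R : realType) n (a b : R) (Y : nat -> R -> 'cV[R]_n) (K C : R) : a <= b ->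
  (forall k s i, s \in `[a, b] -> `|Y k s i 0| <= K) -> 0 <= C ->
  (forall k s s' i, s \in `[a, b] -> s' \in `[a, b] ->
    `|Y k s i 0 - Y k s' i 0| <= C * `|s - s'|) ->
  exists (y : R -> 'cV[R]_n) (phi : nat -> nat),
    [/\ forall j, (j <= phi j)%N, continuous y,
        forall s s' i, `|y s i 0 - y s' i 0| <= C * `|s - s'| &
        forall s, s \in `[a, b] -> Y (phi j) s @[j --> \oo] --> y s].
Proof.
move=> ab YK C0 YC; have [y [phi [jphi yC yl]]] := ascoli_lipschitz YK C0 YC.
pose p s := Num.max a (Num.min b s).
have pI s : p s \in `[a, b] by rewrite in_itv/= le_max lexx/= ge_max ab ge_min lexx.
have p_id s : s \in `[a, b] -> p s = s.
  by rewrite in_itv/= => /andP[? ?]; rewrite /p min_r// max_r.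
have p1 s s' : `|p s - p s'| <= `|s - s'|.
  exact: (le_trans (max_contract _ _ _) (min_contract _ _ _)).
have lip s s' i : `|y (p s) i 0 - y (p s') i 0| <= C * `|s - s'|.
  by apply: (le_trans (yC _ _ i (pI s) (pI s'))); rewrite ler_wpM2l.
exists (y \o p), phi; split; [exact: jphi| |exact: lip|]; last first.
  by move=> s sI; rewrite /= p_id//; exact: yl.
move=> s; apply: continuous_col => i; apply/cvgrPdist_le => e e0.
have C1 : 0 < C + 1 by lra.
have d0 : 0 < e / (C + 1) by rewrite divr_gt0.
apply: filterS (nbhsx_ballx s _ d0) => s'; rewrite /ball/= => ss'.
apply: (le_trans (lip s s' i)); apply: (@le_trans _ _ ((C + 1) * `|s - s'|)).
  by rewrite ler_wpM2r//; lra.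
by rewrite -ler_pdivlMl// mulrC ltW.
Qed.

Section bounded_trajectories.
Context {R : realType} (n m : nat) (P : problem R n m) (alpha d : R).
Hypothesis hP : basic_assumptions P alpha d.
Hypothesis hb : continuous (dynamics P).
Local Notation T := (horizon P).
Context (t : R) (x : 'cV[R]_n) (ht : 0 <= t < T).

Let tT : t <= T. Proof. by case/andP: ht => _ /ltW. Qed.

Lemma velocity_bound (M K : R) : exists2 C : R, 0 <= C & forall y u,
  (forall s, s \in `]t, T] -> enorm (u s) <= M) -> (forall s, s \in `[t, T] -> enorm (y s) <= K) ->
  forall s i, `|velocity P t y u s i 0| <= C.
Proof.
have [theta th0 Hth] := dynamics_growth hP.
exists (theta * (1 + `|K|) * `|M|); first by rewrite !mulr_ge0// addr_ge0.
move=> y u uM yK s i; rewrite /velocity; case: ifPn => [sI|_]; last first.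
  by rewrite mxE normr0 !mulr_ge0// addr_ge0.
apply: (le_trans (coord_le_enorm _ _)); apply: (le_trans (enorm_mulmx _ _)).
have uM' := le_trans (uM _ sI) (ler_norm M).
have yK' := le_trans (yK s (subset_itv_oc_cc sI)) (ler_norm K).
apply: (@le_trans _ _ (theta * (1 + `|K|) * enorm (u s))).
  rewrite ler_wpM2r ?enorm_ge0// (le_trans (Hth _))// ler_wpM2l// lerD2l//.
by rewrite ler_wpM2l// mulr_ge0// addr_ge0.
Qed.

Lemma velocity_integral_itv y u i s : s \in `[t, T] ->
  (leb R).-integrable setT (fun s => (velocity P t y u s i 0)%:E) ->
  \int[leb R]_(r in `]-oo, s]) velocity P t y u r i 0 =
  \int[leb R]_(r in `]t, s]) velocity P t y u r i 0.
Proof.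
rewrite in_itv/= => /andP[ts sT] vi.
rewrite (Rintegral_itvNy_split vi ts) [X in X + _](_ : _ = 0) ?add0r//.
rewrite /Rintegral integral0_eq// => r /=; rewrite in_itv/= => rt.
by rewrite velocity_out// in_itv/= negb_and -leNgt rt.
Qed.

Lemma feasible_lipschitz y u (C : R) : feasible P t x y u ->
  (forall s i, `|velocity P t y u s i 0| <= C) ->
  forall s s' i, s \in `[t, T] -> s' \in `[t, T] -> `|y s i 0 - y s' i 0| <= C * `|s - s'|.
Proof.
move=> H vC.
have mono s s' i : s \in `[t, T] -> s' \in `[t, T] -> s <= s' ->
    `|y s i 0 - y s' i 0| <= C * `|s - s'|.
  move=> sI s'I ss'; have [vi yE] := feasible_velocity hb H i.
  rewrite distrC [`|s - _|]distrC (yE _ sI) (yE _ s'I) (Rintegral_itvNy_split vi ss').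
  rewrite opprD addrACA subrr add0r [X in `|X|]addrC addKr [X in C * X]ger0_norm ?subr_ge0//.
  apply: (@norm_Rintegral_le_cst _ _ R (leb R) _ (lmeasurable_itv _) _ C (s' - s)).
  - exact: leb_itvoc.
  - exact: (integrable_leb vi (lmeasurable_itv _)).
  - by move=> r _; exact: vC.
move=> s s' i sI s'I; have [ss|/ltW ss] := leP s s'; first exact: mono.
by rewrite distrC [`|s - _|]distrC; exact: mono.
Qed.

End bounded_trajectories.

(** Write [B_ k *m v k] as [(B_ k - B) *m v k + B *m v k]: the first part tends to 0 as the [v k]
    are bounded, the second is linear in the combination. *)
Lemma tail_comb_mulmx (R : realType) (n m : nat) (lam : nat -> nat -> R) (bd : nat -> nat)
    (B_ : nat -> 'M[R]_(n, m)) (B : 'M[R]_(n, m)) (v : nat -> 'cV[R]_m) (u : 'cV[R]_m) (M : R) i :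
  (forall j k, 0 <= lam j k) -> (forall j k, (k < j)%N -> lam j k = 0) ->
  (forall j, \sum_(k < bd j) lam j k = 1) ->
  (forall l, B_ k i l @[k --> \oo] --> B i l) -> (forall k l, `|v k l 0| <= M) ->
  (forall l, \sum_(k < bd j) lam j k * v k l 0 @[j --> \oo] --> u l 0) ->
  \sum_(k < bd j) lam j k * (B_ k *m v k) i 0 @[j --> \oo] --> (B *m u) i 0.
Proof.
move=> l0 lt l1 BB vM vu.
pose a k := \sum_l (B_ k i l - B i l) * v k l 0.
have a0 : a k @[k --> \oo] --> 0.
  rewrite (_ : 0 = \sum_(l < m) (0 : R)); last by rewrite big1.
  apply: cvg_bigsum => l; apply/cvgrPdist_le => e e0.
  have M1 : 0 < `|M| + 1 by rewrite ltr_wpDl.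
  have e1 : 0 < e / (`|M| + 1) by rewrite divr_gt0.
  have /cvgrPdist_le/(_ _ e1) := BB l; apply: filterS => k Bk.
  rewrite sub0r normrN normrM distrC -[e](divfK (lt0r_neq0 M1)).
  apply: ler_pM => //; apply: (le_trans (vM k l)); apply: (le_trans (ler_norm _)).
  by rewrite lerDl.
have -> : (fun j => \sum_(k < bd j) lam j k * (B_ k *m v k) i 0) =
    (fun j => \sum_(k < bd j) lam j k * a k + \sum_l B i l * (\sum_(k < bd j) lam j k * v k l 0)).
  apply/funext => j; under [X in _ + X]eq_bigr do rewrite mulr_sumr.
  rewrite exchange_big/= -big_split/=; apply: eq_bigr => k _.
  rewrite mxE /a !mulr_sumr -big_split/=; apply: eq_bigr => l _; ring.
rewrite -[X in _ --> X]add0r; apply: cvgD; first exact: tail_comb_cvg a0.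
by rewrite mxE; apply: cvg_bigsum => l; apply: cvgM; [exact: cvg_cst|exact: vu].
Qed.

Section limit_trajectory.
Context {R : realType} (n m : nat) (P : problem R n m) (alpha d : R).
Hypothesis hP : basic_assumptions P alpha d.
Hypothesis hb : continuous (dynamics P).
Local Notation T := (horizon P).
Local Notation L := (lagrangian P).
Context (t : R) (x : 'cV[R]_n) (ht : 0 <= t < T).
Context (Y : nat -> R -> 'cV[R]_n) (U : nat -> R -> 'cV[R]_m).
Hypothesis YU : forall k, feasible P t x (Y k) (U k).
Context (M C : R).
Hypothesis UM : forall k s i, s \in `]t, T] -> `|U k s i 0| <= M.
Hypothesis VC : forall k s i, `|velocity P t (Y k) (U k) s i 0| <= C.
Context (y : R -> 'cV[R]_n) (u : R -> 'cV[R]_m).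
Hypothesis cy : continuous y.
Hypothesis Yy : forall s, s \in `[t, T] -> Y k s @[k --> \oo] --> y s.
Context (lam : nat -> nat -> R) (bd : nat -> nat).
Hypothesis lam0 : forall j k, 0 <= lam j k.
Hypothesis lam_tail : forall j k, (k < j)%N -> lam j k = 0.
Hypothesis lam1 : forall j, \sum_(k < bd j) lam j k = 1.
Hypothesis mu : forall i, lmeasurable_fun `[t, T] (fun s => u s i 0).
Hypothesis Uu : \forall s \ae leb R, s \in `]t, T] ->
  forall i, \sum_(k < bd j) lam j k * U k s i 0 @[j --> \oo] --> u s i 0.

Let tT : t <= T. Proof. by case/andP: ht => _ /ltW. Qed.

Lemma limit_state_in : closed (states P) -> forall s, s \in `[t, T] -> states P (y s).
Proof.
move=> Sc s sI; apply: (closed_cvg _ Sc _ _ (Yy sI)).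
by apply: nearW => k; case: (YU k) => _ _ _ _; exact.
Qed.

Lemma limit_control_in : closed (controls P) ->
  convex_set (controls P : set (convex_lmodType 'cV[R]_m)) ->
  \forall s \ae leb R, s \in `[t, T] -> controls P (u s).
Proof.
move=> Uc Ucv.
have Uk : \forall s \ae leb R, (forall k, s \in `[t, T] -> controls P (U k s)) /\ s <> t.
  have H : \forall s \ae leb R, forall k, s \in `[t, T] -> controls P (U k s).
    by apply: ae_foralln => k; case: (YU k).
  by move: H (ae_negl1 t); apply: ae_imply2.
move: Uu Uk; apply: ae_imply2 => s us [Uks st] sI.
have sI' : s \in `]t, T].
  by move: sI; rewrite !in_itv/= lt_neqAle eq_sym => /andP[-> ->]; rewrite !andbT; exact/eqP.
apply: (convex_cone_closed Uc (v := fun j => \sum_(k < bd j) lam j k *: U k s)).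
  move=> j; apply: (convex_cone_sum (controls_neq0 hP) (controls_cone hP) Ucv Uc (l := lam j)
    (v := fun k => U k s)) => // k.
  exact: Uks.
move=> i; have := us sI' i; rewrite (_ : (fun j => \sum_(k < bd j) lam j k * U k s i 0) =
  (fun j => (\sum_(k < bd j) lam j k *: U k s) i 0)) //.
by apply/funext => j; rewrite summxE; apply: eq_bigr => k _; rewrite mxE.
Qed.

Lemma limit_velocity_cvg i : \forall s \ae leb R, s \in `[t, T] ->
  \sum_(k < bd j) lam j k * velocity P t (Y k) (U k) s i 0 @[j --> \oo] --> velocity P t y u s i 0.
Proof.
move: Uu; apply: ae_imply => s us sI; rewrite /velocity.
case: ifPn => sI'; last first.
  under eq_fun do (under eq_bigr do rewrite mxE mulr0; rewrite big1//).
  by rewrite mxE; exact: cvg_cst.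
apply: (@tail_comb_mulmx _ _ _ lam bd (fun k => dynamics P (Y k s)) (dynamics P (y s))
  (fun k => U k s) (u s) M) => //.
- move=> l; apply: (@cvg_comp _ _ _ (fun k => dynamics P (Y k s)) (fun M : 'M[R]_(n, m) => M i l)).
    by apply: (cvg_comp _ _ (Yy sI)); exact: hb.
  exact: coord_continuous.
- by move=> k l; exact: UM.
- exact: us.
Qed.

(** The integral equations of the [Y k] are combined with the weights [lam j]. The states on the
    left tend to [y s], the integrals on the right converge by bounded convergence, and uniqueness
    of limits gives the equation for [y]. *)
Lemma limit_velocity_integral (i : 'I_n) s : s \in `[t, T] ->
  (leb R).-integrable `]t, s] (EFin \o (fun r => velocity P t y u r i 0)) /\
  y s i 0 = x i 0 + \int[leb R]_(r in `]t, s]) velocity P t y u r i 0.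
Proof.
move=> sI; have mD : lmeasurable R `]t, s] by exact: lmeasurable_itv.
have ts : t <= s by move: sI; rewrite in_itv/= => /andP[].
have subD : `]t, s] `<=` `[t, T].
  move=> r /=; move: sI; rewrite !in_itv/= => /andP[_ sT] /andP[/ltW -> rs].
  exact: le_trans sT.
have Dfin : (leb R `]t, s] < +oo)%E by rewrite [X in (X < _)%E](leb_itvoc ts) ltry.
have vki k : (leb R).-integrable `]t, s] (EFin \o (fun r => velocity P t (Y k) (U k) r i 0)).
  have [vi _] := feasible_velocity hb (YU k) i; exact: (integrable_leb vi mD).
have mv : lmeasurable_fun `]t, s] (fun r => velocity P t y u r i 0).
  apply: (@eq_measurable_fun _ _ (lebT R) R _ (fun r => (dynamics P (y r) *m u r) i 0)).
    move=> r; rewrite inE => rI; rewrite /velocity ifT//=.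
    by move: rI sI; rewrite /= !in_itv/= => /andP[-> rs] /andP[_]; exact: le_trans.
  exact: (measurable_funS (lmeasurable_itv _) subD (dynamics_comp_measurable hb cy (fun _ _ => erefl) mu i)).
pose f_ j r := \sum_(k < bd j) lam j k * velocity P t (Y k) (U k) r i 0.
have mf j : lmeasurable_fun `]t, s] (f_ j).
  apply: measurable_sum => k; apply: measurable_funM; first exact: measurable_cst.
  exact/measurable_EFinP/(measurable_int _ (vki k)).
have fC j r : r \in `]t, s] -> `|f_ j r| <= C.
  by move=> _; apply: (comb_norm_le lam0 lam1 (a := fun k => velocity P t (Y k) (U k) r i 0)).
have cv : \forall r \ae leb R, r \in `]t, s] -> f_ j r @[j --> \oo] --> velocity P t y u r i 0.
  by move: (limit_velocity_cvg i); apply: ae_imply => r H rI; apply: H; exact: subD.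
have [vi If] := Rintegral_bounded_cvg mD Dfin mf mv fC cv.
split; first exact: vi.
have fE j : \int[leb R]_(r in `]t, s]) f_ j r = \sum_(k < bd j) lam j k * Y k s i 0 - x i 0.
  have [_ ->] := Rintegral_comb mD (lam j) (bd j) vki.
  rewrite -[X in _ - X]mul1r -(lam1 j) mulr_suml -sumrB; apply: eq_bigr => k _.
  have [vki' yE] := feasible_velocity hb (YU k) i.
  by rewrite (yE _ sI) (velocity_integral_itv sI vki') -mulrBr addrAC subrr add0r.
have yl : \sum_(k < bd j) lam j k * Y k s i 0 - x i 0 @[j --> \oo] --> y s i 0 - x i 0.
  apply: cvgB; last exact: cvg_cst.
  apply: (tail_comb_cvg lam0 lam_tail lam1 (a := fun k => Y k s i 0)).
  apply: (@cvg_comp _ _ _ (fun k => Y k s) (fun M : 'cV[R]_n => M i 0)); first exact: Yy.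
  exact: coord_continuous.
have yI : \sum_(k < bd j) lam j k * Y k s i 0 - x i 0 @[j --> \oo] -->
    \int[leb R]_(r in `]t, s]) velocity P t y u r i 0.
  rewrite (_ : (fun j => \sum_(k < bd j) lam j k * Y k s i 0 - x i 0) =
    (fun j => \int[leb R]_(r in `]t, s]) f_ j r)); first exact: If.
  by apply/funext => j; rewrite fE.
by rewrite -(cvg_unique _ yl yI) // addrC subrK.
Qed.

Lemma limit_feasible : closed (states P) -> closed (controls P) ->
  convex_set (controls P : set (convex_lmodType 'cV[R]_m)) -> feasible P t x y u.
Proof.
move=> Sc Uc Ucv; have yt i : y t i 0 = x i 0.
  have [|_ ->] := @limit_velocity_integral i t; first by rewrite in_itv/= lexx tT.
  by rewrite set_itvoc0 Rintegral_set0 addr0.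
have vi i : (leb R).-integrable setT (fun s => (velocity P t y u s i 0)%:E).
  have [|vi _] := @limit_velocity_integral i T; first by rewrite in_itv/= lexx tT.
  rewrite (_ : (fun s => _) = (EFin \o (fun s => velocity P t y u s i 0)) \_ `]t, T]).
    by apply/(integrable_mkcond _ (lmeasurable_itv _)).1.
  apply/funext => s; rewrite patchE mem_setE; case: ifPn => // sI.
  by rewrite velocity_out.
split.
- apply: velocity_W11 => // i; split => // s sI.
  rewrite (velocity_integral_itv sI (vi i)) yt.
  by case: (limit_velocity_integral i sI).
- exact: (measurable_col (lmeasurable_itv _) mu).
- by apply/colP => i; rewrite yt.
- exact: limit_control_in.
- exact: limit_state_in.
Qed.

Hypothesis Llsc : \forall s \ae leb R, s \in `[t, T] ->
  lower_semicontinuous (fun p : 'cV[R]_n * 'cV[R]_m => L s p.1 p.2).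
Hypothesis Lconvex : \forall s \ae leb R, s \in `[t, T] ->
  forall z : 'cV[R]_n, econvex (L s z).

(** The integral of a combination of running costs is the same combination of integrals, each at
    most [b] in the tail, so Fatou's lemma applies to the combinations. *)
Lemma limit_running_cost (b : R) (N : nat) : feasible P t x y u ->
  (forall k, (N <= k)%N -> (\int[leb R]_(s in `[t, T]) L s (Y k s) (U k s) <= b%:E)%E) ->
  (\int[leb R]_(s in `[t, T]) L s (y s) (u s) <= b%:E)%E.
Proof.
move=> H Hb; have mD : lmeasurable R `[t, T] by exact: lmeasurable_itv.
have mF k := lagrangian_traj_meas hP ht (YU k).
have F0 k s : `[t, T]%classic s -> (0 <= L s (Y k s) (U k s))%E.
  by move=> sI; exact: (lagrangian_traj_ge0 hP ht).
apply: (@fatou_bound _ _ R (leb R) `[t, T] (fun s => L s (y s) (u s))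
  (fun j s => (\sum_(k < bd j) (lam j k)%:E * L s (Y k s) (U k s))%E) b%:E mD).
- exact: (lagrangian_traj_meas hP ht H).
- by move=> s sI; exact: (lagrangian_traj_ge0 hP ht).
- by move=> j; apply: emeasurable_sum => k; apply: measurable_funeM; exact: mF.
- by move=> j s sI; apply: sume_ge0 => k _; rewrite mule_ge0 ?lee_fin//; exact: F0.
- have LL : \forall s \ae leb R, [/\ s \in `[t, T] ->
        lower_semicontinuous (fun p : 'cV[R]_n * 'cV[R]_m => L s p.1 p.2),
      s \in `[t, T] -> forall z : 'cV[R]_n, econvex (L s z) & s <> t].
    have H2 : \forall s \ae leb R, (s \in `[t, T] -> forall z : 'cV[R]_n, econvex (L s z)) /\ s <> t.
      by move: Lconvex (ae_negl1 t); apply: ae_imply2.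
    by move: Llsc H2; apply: ae_imply2 => s h1 [].
  move: Uu LL; apply: ae_imply2 => s us [ls cs st] sI a aL.
  have sI' : s \in `]t, T].
    by move: sI; rewrite /= !in_itv/= lt_neqAle eq_sym => /andP[-> ->]; rewrite !andbT; exact/eqP.
  apply: (@convex_comb_lower_bound _ _ _ (fun p : 'cV[R]_n * 'cV[R]_m => L s p.1 p.2)
    (fun k => Y k s) (y s) (fun k => U k s) (u s) M a lam bd (ls sI)) => //.
  + exact: cs sI (y s).
  + by move=> p; exact: (@lagrangian_traj_ge0 _ _ _ _ _ _ hP t ht (fun=> p.1) (fun=> p.2) s sI).
  + exact: Yy.
  + by move=> k i; exact: UM.
  + exact: us.
- exists N => // j /= Nj.
  rewrite (ge0_integral_comb (F := fun k s => L s (Y k s) (U k s)) (leb R) mD (bd j) (lam0 j) mF F0).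
  have := tail_comb_le lam0 lam_tail lam1 (r := fun k => (\int[leb R]_(s in `[t, T]) L s (Y k s) (U k s))%E)
    (b := b) (e := 0) (N := N) (j := j).
  by rewrite addr0; apply.
Qed.

Hypothesis glsc : @lower_semicontinuous (subspace (states P)) R (endcost P).

(** Semicontinuity of the end cost is relative to the state set, so it is applied within that set,
    to which all [Y k T] belong. *)
Lemma limit_endcost (c : R) : feasible P t x y u -> (c%:E < endcost P (y T))%E ->
  \forall k \near \oo, (c%:E <= endcost P (Y k T))%E.
Proof.
move=> H cg; have TI : T \in `[t, T] by rewrite in_itv/= tT lexx.
have Sy : states P (y T) by case: H => _ _ _ _; exact.
have [V nV gV] := glsc cg.
have /(Yy TI)[N _ HN] : within (states P) (nbhs (y T)) V by rewrite (nbhs_subspace_in Sy); exact: nV.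
exists N => // k Nk; have Vk := HN k Nk.
apply: ltW; apply: gV; apply: Vk.
by case: (YU k) => _ _ _ _; exact.
Qed.

(** A real [c] below the end cost of the limit separates the two parts of the cost: the running
    costs in the tail are then nearly at most [I - c], and [c] is raised to the end cost. *)
Lemma limit_cost (I : R) : feasible P t x y u ->
  (forall k, (cost P t (Y k) (U k) <= (I + k.+1%:R^-1)%:E)%E) -> (cost P t y u <= I%:E)%E.
Proof.
move=> H Hc.
have running (c : R) : (c%:E < endcost P (y T))%E ->
    (\int[leb R]_(s in `[t, T]) L s (y s) (u s) <= (I - c)%:E)%E.
  move=> cg; apply/lee_addgt0Pr => e e0; rewrite -EFinD.
  have [N1 _ H1] := limit_endcost H cg.
  have [N2 _ H2] := near_infty_natSinv_lt (PosNum e0).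
  apply: (@limit_running_cost _ (maxn N1 N2) H) => k.
  rewrite geq_max => /andP[k1 k2]; have := Hc k; rewrite /cost => Hk.
  have ck := H1 k k1; have /= ek := H2 k k2.
  have -> : I - c + e = (I + e) - c by ring.
  rewrite EFinB leeBrDr//; apply: (le_trans (leeD2l _ ck)); apply: (le_trans Hk).
  by rewrite lee_fin lerD2l ltW.
have A0 : (0 <= \int[leb R]_(s in `[t, T]) L s (y s) (u s))%E.
  by apply: integral_ge0 => s sI; exact: (lagrangian_traj_ge0 hP ht).
have g0 := endcost_traj_ge0 hP ht H.
move: running g0; rewrite /cost; case: (endcost P (y T)) => [g| |] running g0 //.
- have : (\int[leb R]_(s in `[t, T]) L s (y s) (u s) <= (I - g)%:E)%E.
    apply/lee_addgt0Pr => e e0; rewrite -EFinD (_ : I - g + e = I - (g - e)); last by ring.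
    by apply: running; rewrite lte_fin ltrBlDr ltrDl.
  by rewrite EFinB leeBrDr.
(* An infinite end cost would allow [c = I + 1] and so force a running cost of at most -1. *)
- have /(le_trans A0) := running (I + 1) (ltry _).
  by rewrite lee_fin opprD addNKr oppr_ge0 ler10.
Qed.

End limit_trajectory.

(** * Existence of bounded solutions *)

Lemma norm_col_le (R : realType) n (v : 'cV[R]_n) (C : R) : 0 <= C ->
  (forall i, `|v i 0| <= C) -> `|v| <= C.
Proof.
move=> C0 vC; rewrite [leLHS]mx_normrE; apply: bigmax_le => // -[i j] _ /=.
by rewrite (ord1 j).
Qed.

Lemma lipschitz_col (R : realType) n (D : set R) (y : R -> 'cV[R]_n) (C : R) : 0 <= C ->
  (forall s s' i, `|y s i 0 - y s' i 0| <= C * `|s - s'|) ->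
  [lipschitz (y : R^o -> 'cV[R]_n) s | s in D].
Proof.
move=> C0 yC; exists C; split; first exact: num_real.
move=> c Cc [s s'] _ /=; apply: norm_col_le => [|i].
  by rewrite mulr_ge0// ltW// (le_lt_trans C0).
rewrite !mxE; apply: (le_trans (yC s s' i)).
by rewrite ler_wpM2r// ltW.
Qed.

Lemma bounded_col (R : realType) m (D : set R) (u : R -> 'cV[R]_m) (M : R) : 0 <= M ->
  (forall s i, `|u s i 0| <= M) -> [bounded u s | s in D].
Proof.
move=> M0 uM; exists M; split; first exact: num_real.
move=> c Mc s _ /=; apply: norm_col_le => [|i]; first exact: le_trans (ltW Mc).
exact: le_trans (uM s i) (ltW Mc).
Qed.

Section existence.
Context {R : realType} (n m : nat) (P : problem R n m) (alpha d : R).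
Hypothesis hP : basic_assumptions P alpha d.
Hypothesis hb : continuous (dynamics P).
Local Notation T := (horizon P).
Context (t : R) (x : 'cV[R]_n) (ht : 0 <= t < T).
Hypothesis Llsc : \forall s \ae leb R, s \in `[t, T] ->
  lower_semicontinuous (fun p : 'cV[R]_n * 'cV[R]_m => lagrangian P s p.1 p.2).
Hypothesis Lconvex : \forall s \ae leb R, s \in `[t, T] ->
  forall z : 'cV[R]_n, econvex (lagrangian P s z).
Hypothesis glsc : @lower_semicontinuous (subspace (states P)) R (endcost P).
Hypothesis Uclosed : closed (controls P).
Hypothesis Uconvex : convex_set (controls P : set (convex_lmodType 'cV[R]_m)).
Hypothesis Sclosed : closed (states P).

Let tT : t <= T. Proof. by case/andP: ht => _ /ltW. Qed.

Lemma limit_of_bounded_sequence (Y : nat -> R -> 'cV[R]_n) (U : nat -> R -> 'cV[R]_m) (M K I : R) :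
  (forall k, feasible P t x (Y k) (U k)) ->
  (forall k s, s \in `]t, T] -> enorm (U k s) <= M) ->
  (forall k s, s \in `[t, T] -> enorm (Y k s) <= K) ->
  (forall k, (cost P t (Y k) (U k) <= (I + k.+1%:R^-1)%:E)%E) ->
  exists y u, [/\ feasible P t x y u, (cost P t y u <= I%:E)%E,
    [lipschitz (y : R^o -> 'cV[R]_n) s | s in `[t, T]] & [bounded u s | s in `[t, T]]].
Proof.
move=> YU UM YK Hc.
have [C C0 HC] := velocity_bound hP t M K.
have VC k s i : `|velocity P t (Y k) (U k) s i 0| <= C by apply: HC; [exact: UM|exact: YK].
have [y [phi [jphi cy yC Yy]]] := ascoli_continuous tT
  (fun k s i sI => le_trans (coord_le_enorm (Y k s) i) (YK k s sI)) C0
  (fun k => feasible_lipschitz hb (YU k) (VC k)).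
have mD : lmeasurable R `]t, T] by exact: lmeasurable_itv.
have Dfin : (leb R `]t, T] < +oo)%E by rewrite [X in (X < _)%E](leb_itvoc tT) ltry.
have mU k i : lmeasurable_fun `]t, T] (fun s => U (phi k) s i 0).
  exact: (measurable_funS (lmeasurable_itv _) (@subset_itv_oc_cc _ _ _ _)
    (feasible_control_meas (YU (phi k)) i)).
have UM' k s i : s \in `]t, T] -> `|U (phi k) s i 0| <= `|M|.
  by move=> sI; apply: (le_trans (coord_le_enorm _ _)); exact: le_trans (UM _ _ sI) (ler_norm M).
have [lam [bd [u [[lam0 lamt lam1] mu uM Uu]]]] :=
  @mazur_limit _ _ R m (leb R) `]t, T] (fun k => U (phi k)) `|M| mD Dfin mU (normr_ge0 M) UM'.
(* The limit control was built on []t, T]], where the controls are bounded; feasibility asks for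
   measurability on the closed interval. *)
have mu' i : lmeasurable_fun `[t, T] (fun s => u s i 0).
  have <- : t |` `]t, T] = `[t, T]%classic by rewrite setU1itv// bnd_simp.
  by apply: measurable_fun_add_point => //; exact: borel_lmeasurable.
have YU' k := YU (phi k).
have H := limit_feasible hP hb ht YU' UM' (fun k => VC (phi k)) cy Yy lam0 lamt lam1 mu' Uu
  Sclosed Uclosed Uconvex.
have Hc' k : (cost P t (Y (phi k)) (U (phi k)) <= (I + k.+1%:R^-1)%:E)%E.
  apply: (le_trans (Hc _)); rewrite lee_fin lerD2l lef_pV2 ?posrE ?ltr0n// ler_nat ltnS.
  exact: jphi.
exists y, u; split => //.
- exact: (limit_cost hP ht YU' UM' Yy lam0 lamt lam1 Uu Llsc Lconvex glsc H Hc').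
- exact: lipschitz_col C0 yC.
- exact: bounded_col (normr_ge0 M) uM.
Qed.

End existence.

Theorem corollary6p2 (R : realType) (n m : nat) (P : problem R n m)
    (alpha d kappa A : R) (gamma : R -> R) (eps : R)
    (t : R) (x : 'cV[R]_n) (y : R -> 'cV[R]_n) (u : R -> 'cV[R]_m)
    (hn : (1 <= n)%N) (hm : (1 <= m)%N)
    (hP : basic_assumptions P alpha d)
    (hA : radial_convex P \/ partial_differentiable P)
    (hS : condS P kappa A gamma eps)
    (hDom : ~ real_valued P -> h1 P /\ h2 P)
    (ht : 0 <= t < horizon P) (hx : states P x)
    (hyu : admissible P t x y u)
    (hH : growth_condition P alpha d kappa A gamma t (fine (cost P t y u)))
    (hLlsc : \forall s \ae leb R, s \in `[t, horizon P] ->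
      lower_semicontinuous
        (fun p : 'cV[R]_n * 'cV[R]_m => lagrangian P s p.1 p.2))
    (hLconvex : \forall s \ae leb R, s \in `[t, horizon P] ->
      forall z : 'cV[R]_n, econvex (lagrangian P s z))
    (hg : @lower_semicontinuous (subspace (states P)) R (endcost P))
    (hb : continuous (dynamics P))
    (hUclosed : closed (controls P)) (hUconvex : convex_set (controls P))
    (hSclosed : closed (states P)) :
  exists (ystar : R -> 'cV[R]_n) (ustar : R -> 'cV[R]_m),
    [/\ solution P t x ystar ustar,
        [lipschitz (ystar : R^o -> 'cV[R]_n) s | s in `[t, horizon P]] &
        [bounded ustar s | s in `[t, horizon P]]].
Proof.
have cost0 y' u' : feasible P t x y' u' -> (0 <= cost P t y' u')%E.
  move=> H; rewrite /cost adde_ge0 ?(endcost_traj_ge0 hP ht H)//.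
  by apply: integral_ge0 => s sI; exact: (lagrangian_traj_ge0 hP ht).
have [Hyu yufin] := hyu.
have cfin : cost P t y u \is a fin_num by rewrite ge0_fin_numE// cost0.
have cE : cost P t y u = (fine (cost P t y u))%:E by rewrite fineK.
have B0 : 0 <= fine (cost P t y u) by apply: fine_ge0; exact: cost0.
pose costs := [set c | exists y' u', feasible P t x y' u' /\ c = cost P t y' u'].
have inf_lb y' u' : feasible P t x y' u' -> (ereal_inf costs <= cost P t y' u')%E.
  by move=> H; apply: ereal_inf_lbound; exists y', u'.
have inf0 : (0 <= ereal_inf costs)%E.
  by apply: le_ereal_inf_tmp => _ [y' [u' [H ->]]]; exact: cost0.
have inf_fin : ereal_inf costs \is a fin_num.
  by rewrite ge0_fin_numE//; apply: le_lt_trans yufin; exact: inf_lb.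
have [I IE] : exists I, ereal_inf costs = I%:E by exists (fine (ereal_inf costs)); rewrite fineK.
have [M [K reparam]] := bounded_reparam hP hb hS hDom x ht hLconvex B0 hH.
have ex k : exists p : (R -> 'cV[R]_n) * (R -> 'cV[R]_m), [/\ feasible P t x p.1 p.2,
    forall s, s \in `]t, horizon P] -> enorm (p.2 s) <= M,
    forall s, s \in `[t, horizon P] -> enorm (p.1 s) <= K &
    (cost P t p.1 p.2 <= (I + k.+1%:R^-1)%:E)%E].
  (* The reparametrization applies to cost at most [B]. An almost minimizing pair that costs more
     than [(y, u)] is replaced by [(y, u)], which is then almost minimizing too. *)
  have [y1 [u1 [H1 c1 c1B]]] : exists y1 u1, [/\ feasible P t x y1 u1,
      (cost P t y1 u1 <= (I + k.+1%:R^-1)%:E)%E & (cost P t y1 u1 <= (fine (cost P t y u))%:E)%E].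
    have [_ [y1 [u1 [H1 ->]]] c1] : exists2 c, costs c & (c < (I + k.+1%:R^-1)%:E)%E.
      by apply: ereal_inf_lt; rewrite IE lte_fin ltrDl invr_gt0.
    have [le1|/ltW le1] := leP (cost P t y1 u1) (cost P t y u).
      by exists y1, u1; split => //; [exact: ltW|rewrite -cE].
    by exists y, u; split => //; [exact: le_trans le1 (ltW c1)|rewrite -cE].
  have [y2 [u2 [H2 c2 uM yK]]] := reparam _ _ H1 c1B.
  by exists (y2, u2); split => //; exact: le_trans c1.
have [Z HZ] := choice ex.
have [ystar [ustar [Hs cs lip bnd]]] := @limit_of_bounded_sequence _ _ _ P alpha d hP hb t x ht
  hLlsc hLconvex hg hUclosed hUconvex hSclosed (fun k => (Z k).1) (fun k => (Z k).2) M K I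
  (fun k => let: And4 h _ _ _ := HZ k in h) (fun k => let: And4 _ h _ _ := HZ k in h)
  (fun k => let: And4 _ _ h _ := HZ k in h) (fun k => let: And4 _ _ _ h := HZ k in h).
exists ystar, ustar; split => //; split.
  by split => //; apply: (le_lt_trans cs); exact: ltry.
by move=> y' u' H'; apply: (le_trans cs); rewrite -IE; exact: inf_lb.
Qed.
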